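(* Let $0\leq\sigma\leq 3$ and $s\ge 2$. Let $u\in C([0,T^{\ast});X^s(\mathbb{R}^2))\cap C^1([0,T^{\ast});X^{s-2}(\mathbb{R}^2))$ be a solution, with maximal existence time $T^{\ast}$, of the equation (the case $\kappa=0$ of the rod-KP equation) $$u_t + \sigma u u_x + p_x \ast \Big( \tfrac{3-\sigma}{2}u^2 +\tfrac{\sigma}{2} u_x^2 \Big) + p \ast \partial_x^{-1} u_{yy} =0 .$$ If there is a nonempty open set $\Omega\subset[0,T^{\ast})\times\mathbb{R}$ such that $u(t,x,y)=0$ for all $(t,x)\in\Omega$ and all $y\in\mathbb{R}$, then $u=0$ in $[0,T^{\ast})\times\mathbb{R}^2$.
   Context: Here $u=u(t,x,y)$ is real valued. $p(x)=\frac12 e^{-|x|}$ is the kernel of $(1-\partial_x^2)^{-1}$ on $\mathbb{R}$, $p_x$ is its derivative, and $\ast$ denotes convolution in the $x$ variable only. The operator $\partial_x^{-1}$ is defined by $\partial_x^{-1}u=\mathscr{F}^{-1}\big((i\xi)^{-1}\mathscr{F}(u)(\xi,\eta)\big)$, where $\mathscr F$ is the Fourier transform in $(x,y)$ with dual variables $(\xi,\eta)$. For $s\ge 0$, $X^s(\mathbb{R}^2)=\{u\in H^s(\mathbb{R}^2): u_x\in H^s(\mathbb{R}^2),\ \partial_x^{-1}u\in H^s(\mathbb{R}^2)\}$ with norm $\Vert u\Vert_{X^s}=\big(\Vert u\Vert_{H^s}^2+\Vert\partial_x^{-1}u\Vert_{H^s}^2+\Vert u_x\Vert_{H^s}^2\big)^{1/2}$.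 *)

(* Defs.v *)
From HB Require Import structures.
From mathcomp Require Import all_boot all_order all_algebra.
From mathcomp Require Import all_classical all_reals all_analysis.
From mathcomp.real_closed Require Import complex.

Set Implicit Arguments.
Unset Strict Implicit.
Unset Printing Implicit Defensive.
Import Order.TTheory GRing.Theory Num.Theory.
Import numFieldNormedType.Exports.
Local Open Scope classical_set_scope.
Local Open Scope complex_scope.
Local Open Scope ring_scope.

Notation leb2 := (@lebesgue_measure _ \x @lebesgue_measure _)%E.

Section Fourier.
Context {R : realType}.
Implicit Types (u v w : R * R -> R) (U : R * R -> R[i]) (z zeta : R * R).

Definition isL2 u := u \in Lfun leb2 2%:E.

Definition L2norm (f : R * R -> R) : \bar R := 'N[leb2]_2%:E[EFin \o f].

Definition box (n : nat) : set (R * R) :=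
  [set z | `|z.1| <= n%:R /\ `|z.2| <= n%:R].

(* (2 pi)^-1 \int_(box n) u(z) e^(- i z . zeta) dz, for u real valued *)
Definition trunc_fourier u (n : nat) zeta : R[i] :=
  (2 * pi)^-1 *
    (\int[leb2]_(z in box n) (u z * cos (z.1 * zeta.1 + z.2 * zeta.2))) +i*
  (- ((2 * pi)^-1 *
    (\int[leb2]_(z in box n) (u z * sin (z.1 * zeta.1 + z.2 * zeta.2))))).

(* U is the (Plancherel) Fourier transform of the L^2 function u: the L^2 limit
   of the Fourier integrals of the truncations of u. *)
Definition is_fourier u U :=
  [/\ isL2 u, isL2 (@complex.Re R \o U), isL2 (@complex.Im R \o U) &
      L2norm (fun zeta => ComplexField.Normc.normc (U zeta - trunc_fourier u n zeta))
        @[n --> \oo] --> 0%E].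

Definition fourier u : R * R -> R[i] := xget (cst 0) [set U | is_fourier u U].

Definition Hnorm (s : R) u : \bar R :=
  L2norm (fun zeta =>
    (1 + zeta.1 ^+ 2 + zeta.2 ^+ 2) `^ (s / 2) * ComplexField.Normc.normc (fourier u zeta)).

(* By Plancherel's theorem the first conjunct amounts to u in L^2. *)
Definition Hs (s : R) u := is_fourier u (fourier u) /\ (Hnorm s u < +oo)%E.

End Fourier.

Section Derivatives.
Context {R : realType}.
Implicit Types (u v w phi : R * R -> R) (z : R * R).

Definition ex : R * R := (1, 0).
Definition ey : R * R := (0, 1).

Fixpoint Ck (k : nat) phi : Prop :=
  if k is k'.+1 then
    [/\ forall z, differentiable phi z, Ck k' ('D_ex phi) & Ck k' ('D_ey phi)]
  else continuous phi.

Definition test_function phi :=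
  (forall k, Ck k phi) /\ compact (closure [set z | phi z != 0]).

Definition is_wderiv (e : R * R) u v :=
  [/\ isL2 u, isL2 v & forall phi, test_function phi ->
      \int[leb2]_z (u z * 'D_e phi z) = - \int[leb2]_z (v z * phi z)].

(* [wderiv] and [dxinv] below are total functions; the predicates [wderivable]
   and [dxinvable] say that their values are meaningful. *)
Definition wderiv (e : R * R) u : R * R -> R :=
  xget (cst 0) [set v | is_wderiv e u v].

Definition wderivable e u := is_wderiv e u (wderiv e u).

(* The symbol is unaffected by the value of the total inverse at xi = 0, since
   {xi = 0} is a null set. *)
Definition is_dxinv u v :=
  exists2 U, is_fourier u U &
    is_fourier v (fun zeta => ('i%C * (zeta.1)%:C)^-1 * U zeta).

Definition dxinv u : R * R -> R := xget (cst 0) [set v | is_dxinv u v].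

Definition dxinvable u := is_dxinv u (dxinv u).

Definition Xs (s : R) u :=
  [/\ Hs s u, wderivable ex u /\ Hs s (wderiv ex u)
    & dxinvable u /\ Hs s (dxinv u)].

Definition Xnorm (s : R) u : \bar R :=
  ((Hnorm s u ^+ 2 + Hnorm s (dxinv u) ^+ 2 + Hnorm s (wderiv ex u) ^+ 2)
     `^ 2^-1)%E.

End Derivatives.

Section Solutions.
Context {R : realType}.
Implicit Types (s sigma : R) (T : \bar R) (u v ut : R -> R * R -> R).

Definition time_dom T : set R := [set t | 0 <= t /\ (t%:E < T)%E].

(* u \in C([0, T); X^s) *)
Definition continuousX s T u := forall t, time_dom T t ->
  Xs s (u t) /\
  Xnorm s (u t' \- u t) @[t' --> within (time_dom T) (nbhs t)] --> 0%E.

(* u_t = ut as a limit of difference quotients in X^s; one-sided at t = 0 *)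
Definition has_derivX s T u ut := forall t, time_dom T t ->
  Xnorm s (fun z => (t' - t)^-1 * (u t' z - u t z) - ut t z)
    @[t' --> within (time_dom T) t^'] --> 0%E.

Definition pker (x : R) : R := 2^-1 * expR (- `|x|).

Definition convx (k : R -> R) (f : R * R -> R) : R * R -> R :=
  fun z => \int[@lebesgue_measure R]_x (k (z.1 - x) * f (x, z.2)).

(* The equation for w = u(t) and wt = u_t(t), as an identity between L^2
   functions. For w in X^s with s >= 2 the four definedness clauses hold
   automatically. *)
Definition rodKP sigma (w wt : R * R -> R) :=
  let wx := wderiv ex w in
  let wyy := wderiv ey (wderiv ey w) in
  [/\ wderivable ex w, wderivable ey w, wderivable ey (wderiv ey w),
      dxinvable wyy &
      {ae leb2, forall z,
        wt z + sigma * w z * wx z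
        + convx (derive1 pker) (fun z' => (3 - sigma) / 2 * w z' ^+ 2
                                 + sigma / 2 * wx z' ^+ 2) z
        + convx pker (dxinv wyy) z = 0}].

(* Elements of X^s are classes modulo null sets; for s > 1 they are represented
   by their continuous representative, so that pointwise values make sense. *)
Definition rodKP_solution sigma s T u :=
  [/\ continuousX s T u,
      forall t, time_dom T t -> continuous (u t) &
      exists ut, [/\ continuousX (s - 2) T ut, has_derivX (s - 2) T u ut &
        forall t, time_dom T t -> rodKP sigma (u t) (ut t)]].

(* T is maximal: u does not extend to a solution on a larger interval. *)
Definition maximal_rodKP_solution sigma s T u :=
  rodKP_solution sigma s T u /\
  forall T' v, rodKP_solution sigma s T' v ->
    (forall t, time_dom T t -> v t = u t) -> (T' <= T)%E.

End Solutions.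

(* Main.v *)
Require Import Defs.
From HB Require Import structures.
From mathcomp Require Import all_boot all_order all_algebra.
From mathcomp Require Import finmap.
From mathcomp Require Import all_classical all_reals all_analysis.
From mathcomp Require Import measurable_realfun ring lra.
From mathcomp.real_closed Require Import complex.

Set Implicit Arguments.
Unset Strict Implicit.
Unset Printing Implicit Defensive.
Import Order.TTheory GRing.Theory Num.Theory.
Import numFieldNormedType.Exports.
Local Open Scope classical_set_scope.
Local Open Scope complex_scope.
Local Open Scope ring_scope.

(** The energy [E = |u|^2 + |u_x|^2] (norms of L^2) is conserved: pairing the
equation with [u - u_xx] gives
[- E' / 2 = sigma <u u_x, u - u_xx> - <u_x, F> + <dx^-1 u_yy, u>] with
[F = (3 - sigma) / 2 u^2 + sigma / 2 u_x^2]. The last term is zero by skew-symmetry.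
Since [<u u_x, u_xx> = - <u_x^2, u_x> / 2] and [<u^2, u_x> = 0], which are obtained
from difference quotients for lack of regularity, the other two cancel.

At a time [t0] met by [Omega], both [u] and [u_t] vanish on a strip
[x0 - d < x < x0 + d], where [F = 0] and [p_x * F + p * dx^-1 u_yy = 0].
Differentiating in [x] and using [p_xx = p - delta] gives
[p * F + (p * u)_yy = 0] on the strip. Tested against [psi (x) chi (y / r)], the
second term disappears as [r --> oo]; as [p > 0] and [F >= 0] this forces [F = 0],
hence [u = 0] at [t0], so that [E = 0] at [t0] and then at all times. *)

(** The obstacle is that everything is known only in L^2: [dx^-1 u_yy] is an L^2 function accessible
    only through [xi] times its transform, [u_t] lies two derivatives below [u], and [u_xx] occurs
    in products. Identities are therefore checked on the integrands of Parseval's formula, where the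
    bad terms cancel pointwise before anything is integrated separately. This rests on Plancherel's
    theorem, obtained by exponential damping and Poisson kernels, and on a passage from weak
    derivatives to multipliers through exact difference identities.

    The range of [sigma] enters as the sign of the two coefficients of [F]. For [sigma < 3], [F = 0]
    gives [u = 0]; at [sigma = 3] it only gives [u_x = 0], which suffices because [xi] is nonzero
    almost everywhere.

    The weight [p * psi] is positive on the whole line although [psi] lives on the strip: this is
    what carries information out of the strip. The second derivative of [chi (y / r)] has L^2 norm
    of order [r^(-3/2)], hence the decay of the nonlocal term. *)

Lemma eq_cvgn (R : realType) (u v : nat -> R) (l : R) :
  (forall n, u n = v n) -> v @ \oo --> l -> u @ \oo --> l.
Proof. by move=> /funext ->. Qed.

Lemma cvgn_eq (R : realType) (l l' : R) (u : nat -> R) :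
  l = l' -> u @ \oo --> l -> u @ \oo --> l'.
Proof. by move=> ->. Qed.

(** * Integrable real-valued functions *)

Section real_integrable.
Context d (T : measurableType d) (R : realType).
Variable mu : {measure set T -> \bar R}.
Implicit Types f g h : T -> R.

Definition rint f := mu.-integrable [set: T] (EFin \o f).

Lemma aeS (P Q : T -> Prop) : (forall x, P x -> Q x) ->
  {ae mu, forall x, P x} -> {ae mu, forall x, Q x}.
Proof. by move=> h; exact: filterS. Qed.

Lemma aeS2 (P Q S : T -> Prop) : (forall x, P x -> Q x -> S x) ->
  {ae mu, forall x, P x} -> {ae mu, forall x, Q x} -> {ae mu, forall x, S x}.
Proof. by move=> h; exact: filterS2. Qed.

Lemma eq_ler (x y : R) : x = y -> x <= y.
Proof. by move=> ->. Qed.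

Lemma rint_measurable f : rint f -> measurable_fun setT f.
Proof. by move=> /measurable_int /measurable_EFinP. Qed.

Lemma rint_le f g : measurable_fun setT f -> rint g ->
  (forall x, `|f x| <= g x) -> rint f.
Proof.
move=> mf ig fg; apply: le_integrable ig => //; first exact/measurable_EFinP.
move=> x _ /=; rewrite lee_fin (le_trans (fg x))// ler_norm//.
Qed.

Lemma rintD f g : rint f -> rint g -> rint (fun x => f x + g x).
Proof. by move=> fi gi; exact: (integrableD measurableT fi gi). Qed.

Lemma rintB f g : rint f -> rint g -> rint (fun x => f x - g x).
Proof. by move=> fi gi; exact: (integrableB measurableT fi gi). Qed.

Lemma rintZ a f : rint f -> rint (fun x => a * f x).
Proof. by move=> fi; exact: (integrableZl measurableT a fi). Qed.

Lemma rintN f : rint f -> rint (fun x => - f x).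
Proof. by move=> fi; exact: (integrableN fi). Qed.

Lemma rint0 : rint (fun=> 0).
Proof. exact: integrable0. Qed.

Lemma rint_norm f : rint f -> rint (fun x => `|f x|).
Proof. by move=> /integrable_norm; exact. Qed.

Lemma rint_bounded (M : R) (b f : T -> R) : measurable_fun setT b -> (forall x, `|b x| <= M) ->
  rint f -> rint (fun x => b x * f x).
Proof.
move=> mb bM fi; apply: (@rint_le _ (fun x => M * `|f x|)).
- by apply: measurable_funM => //; exact: rint_measurable.
- exact/rintZ/rint_norm.
- by move=> x; rewrite normrM ler_wpM2r.
Qed.

Lemma rint_fin f : rint f -> (\int[mu]_x (f x)%:E = (\int[mu]_x f x)%:E)%E.
Proof. by move=> fi; rewrite /Rintegral fineK// integrable_fin_num. Qed.

Lemma rint_lty f : measurable_fun setT f ->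
  (\int[mu]_x `|f x|%:E < +oo)%E -> rint f.
Proof. by move=> mf h; apply/integrableP; split; [exact/measurable_EFinP|]. Qed.

Lemma rint_ltyP f : rint f -> (\int[mu]_x `|f x|%:E < +oo)%E.
Proof. by move=> /integrableP[]. Qed.

(** No completeness of [mu] is assumed, so measurability does not pass along almost everywhere
    equality and is asked of [g] separately. *)
Lemma rint_ae f g : measurable_fun setT g ->
  {ae mu, forall x, f x = g x} -> rint f -> rint g.
Proof.
move=> mg fg /[dup] fi /integrableP[mf foo]; apply: rint_lty => //.
rewrite (_ : (\int[mu]_x _)%E = (\int[mu]_x `|(f x)%:E|)%E)//.
apply: ge0_ae_eq_integral => //=.
- by apply/measurable_EFinP; exact: measurableT_comp.
- apply/measurable_EFinP; apply: measurableT_comp => //; exact: rint_measurable fi.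
- by apply: filterS fg => x /= -> _.
Qed.

Lemma Rintegral_ae f g : measurable_fun setT f -> measurable_fun setT g ->
  {ae mu, forall x, f x = g x} -> \int[mu]_x f x = \int[mu]_x g x.
Proof.
move=> mf mg fg; congr fine; apply: ae_eq_integral => //.
- exact/measurable_EFinP.
- exact/measurable_EFinP.
- by apply: filterS fg => x /= -> _.
Qed.

Lemma Rint_eq0 f : (forall x, 0 <= f x) -> rint f -> \int[mu]_x f x = 0 ->
  {ae mu, forall x, f x = 0}.
Proof.
move=> f0 fi f00.
have mf : measurable_fun setT (EFin \o f) by exact/measurable_EFinP/rint_measurable.
have [+ _] := ae_eq_integral_abs mu measurableT mf.
have -> : (\int[mu]_x `|(EFin \o f) x| = 0)%E.
  under eq_integral do rewrite /= ger0_norm//.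
  by rewrite rint_fin// f00.
by move=> /(_ erefl); apply: filterS => x /= /(_ Logic.I) [].
Qed.

Lemma dct (fs : nat -> T -> R) f g : (forall n, measurable_fun setT (fs n)) ->
  rint g -> (forall n x, `|fs n x| <= g x) ->
  {ae mu, forall x, fs ^~ x @ \oo --> f x} ->
  measurable_fun setT f ->
  rint f /\ (fun n => \int[mu]_x fs n x) @ \oo --> \int[mu]_x f x.
Proof.
move=> mf_ ig fg ff mf.
have [] := @dominated_convergence _ T R mu setT measurableT
  (fun n => EFin \o fs n) (EFin \o f) (EFin \o g).
- by move=> n; exact/measurable_EFinP.
- exact/measurable_EFinP.
- by apply: filterS ff => x h _; apply/cvg_EFin => //=; exact: nearW.
- exact: ig.
- by apply: aeW => x n _ /=; rewrite lee_fin.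
move=> fi _ h; split => //.
have fin n : rint (fs n) by exact: rint_le ig _.
apply/fine_cvg; rewrite -(rint_fin fi).
by [].
Qed.

End real_integrable.
Arguments rint_le {d T R} mu {f} g.
Arguments rint_bounded {d T R} mu M {b f}.
Arguments dct {d T R} mu fs f g.

(** * Square-integrable functions: inner product and convergence *)

Section L2.
Context d (T : measurableType d) (R : realType).
Variable mu : {measure set T -> \bar R}.
Implicit Types f g h : T -> R.

Definition L2 f := measurable_fun setT f /\ rint mu (fun x => f x ^+ 2).
Definition ip f g := \int[mu]_x (f x * g x).
(** The square of the norm is the basic quantity: it is polynomial, so expansions involve no roots,
    at the price of factors 2 in the triangle inequality. *)
Definition n2 f := ip f f.

Lemma L2_measurable f : L2 f -> measurable_fun setT f. Proof. by case. Qed.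

Lemma L2M f g : L2 f -> L2 g -> rint mu (fun x => f x * g x).
Proof.
move=> [mf f2] [mg g2]; apply: (rint_le mu (fun x => f x ^+ 2 + g x ^+ 2)).
- exact: measurable_funM.
- exact: rintD.
- move=> x; rewrite ler_norml; apply/andP.
  have := sqr_ge0 (f x - g x); have := sqr_ge0 (f x + g x).
  have := sqr_ge0 (f x); have := sqr_ge0 (g x).
  by rewrite !expr2; split; nra.
Qed.

Lemma L2_le f g : measurable_fun setT f -> L2 g ->
  (forall x, `|f x| <= `|g x|) -> L2 f.
Proof.
move=> mf [mg g2] fg; split => //; apply: (rint_le mu (fun x => g x ^+ 2)) => //.
  exact: measurable_funX.
by move=> x; rewrite normrX -[leRHS]real_normK ?num_real// lerXn2r ?nnegrE.
Qed.

Lemma L2D f g : L2 f -> L2 g -> L2 (fun x => f x + g x).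
Proof.
move=> /[dup] lf [mf f2] /[dup] lg [mg g2]; split; first exact: measurable_funD.
have -> : (fun x => (f x + g x) ^+ 2) =
    (fun x => (f x ^+ 2 + g x ^+ 2) + 2 * (f x * g x)).
  by apply/funext => x; ring.
by apply: rintD; [exact: rintD|apply: rintZ; exact: L2M].
Qed.

Lemma L2_bounded (M : R) (b : T -> R) f : measurable_fun setT b ->
  (forall x, `|b x| <= M) -> L2 f -> L2 (fun x => b x * f x).
Proof.
move=> mb bM [mf f2]; split; first exact: measurable_funM.
have -> : (fun x => (b x * f x) ^+ 2) = (fun x => b x ^+ 2 * f x ^+ 2).
  by apply/funext => x; rewrite exprMn.
apply: (rint_bounded mu (M ^+ 2)) => //; first exact: measurable_funX.
by move=> x; rewrite normrX lerXn2r ?nnegrE// (le_trans _ (bM x)).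
Qed.

Lemma L2Z a f : L2 f -> L2 (fun x => a * f x).
Proof. exact: (@L2_bounded `|a| (fun=> a)). Qed.

Lemma L2N f : L2 f -> L2 (fun x => - f x).
Proof.
by move=> /(L2Z (-1)); under eq_fun do rewrite mulN1r.
Qed.

Lemma L2B f g : L2 f -> L2 g -> L2 (fun x => f x - g x).
Proof. by move=> lf lg; apply: (L2D lf); exact: L2N. Qed.

Lemma L20 : L2 (fun=> 0).
Proof.
split; first exact: measurable_cst.
by under eq_fun do rewrite expr0n/=; exact: rint0.
Qed.

Lemma L2_ae f g : measurable_fun setT g -> {ae mu, forall x, f x = g x} ->
  L2 f -> L2 g.
Proof.
move=> mg fg [mf f2]; split => //; apply: rint_ae f2; first exact: measurable_funX.
by apply: filterS fg => x ->.
Qed.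

Lemma ipC f g : ip f g = ip g f.
Proof. by apply: eq_Rintegral => x _; rewrite mulrC. Qed.

Lemma ipDl f g h : L2 f -> L2 g -> L2 h ->
  ip (fun x => f x + g x) h = ip f h + ip g h.
Proof.
move=> lf lg lh; rewrite /ip -RintegralD//; try exact: L2M.
by apply: eq_Rintegral => x _; rewrite mulrDl.
Qed.

Lemma ipZl a f h : L2 f -> L2 h -> ip (fun x => a * f x) h = a * ip f h.
Proof.
move=> lf lh; rewrite /ip -RintegralZl//; last exact: L2M.
by apply: eq_Rintegral => x _; rewrite mulrA.
Qed.

Lemma ipNl f h : L2 f -> L2 h -> ip (fun x => - f x) h = - ip f h.
Proof.
move=> lf lh; rewrite -mulN1r -ipZl//.
by congr ip; apply/funext => x; rewrite mulN1r.
Qed.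

Lemma ipBl f g h : L2 f -> L2 g -> L2 h ->
  ip (fun x => f x - g x) h = ip f h - ip g h.
Proof. by move=> lf lg lh; rewrite ipDl// ?ipNl//; exact: L2N. Qed.

Lemma ipDr f g h : L2 f -> L2 g -> L2 h ->
  ip h (fun x => f x + g x) = ip h f + ip h g.
Proof. by move=> *; rewrite ![ip h _]ipC ipDl. Qed.

Lemma ipBr f g h : L2 f -> L2 g -> L2 h ->
  ip h (fun x => f x - g x) = ip h f - ip h g.
Proof. by move=> *; rewrite ![ip h _]ipC ipBl. Qed.

Lemma ipZr a f h : L2 f -> L2 h -> ip h (fun x => a * f x) = a * ip h f.
Proof. by move=> *; rewrite ![ip h _]ipC ipZl. Qed.

Lemma ipNr f h : L2 f -> L2 h -> ip h (fun x => - f x) = - ip h f.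
Proof. by move=> *; rewrite ![ip h _]ipC ipNl. Qed.

Lemma ip_ae f f' g g' : measurable_fun setT f -> measurable_fun setT f' ->
  measurable_fun setT g -> measurable_fun setT g' ->
  {ae mu, forall x, f x = f' x} -> {ae mu, forall x, g x = g' x} ->
  ip f g = ip f' g'.
Proof.
move=> mf mf' mg mg' ff gg; apply: Rintegral_ae; try exact: measurable_funM.
by apply: filterS2 ff gg => x -> ->.
Qed.

Lemma n2_ae f g : measurable_fun setT f -> measurable_fun setT g ->
  {ae mu, forall x, f x = g x} -> n2 f = n2 g.
Proof. by move=> *; exact: ip_ae. Qed.

Lemma n2_ge0 f : 0 <= n2 f.
Proof. by apply: Rintegral_ge0 => x _; rewrite -expr2 sqr_ge0. Qed.

Lemma n2E f : n2 f = \int[mu]_x (f x ^+ 2).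
Proof. by apply: eq_Rintegral => x _; rewrite expr2. Qed.

Lemma n2D f g : L2 f -> L2 g ->
  n2 (fun x => f x + g x) = n2 f + 2 * ip f g + n2 g.
Proof.
move=> lf lg; rewrite /n2 ipDl ?ipDr//; last exact: L2D.
by rewrite (ipC g f); ring.
Qed.

Lemma n2B f g : L2 f -> L2 g ->
  n2 (fun x => f x - g x) = n2 f - 2 * ip f g + n2 g.
Proof.
move=> lf lg; rewrite /n2 ipBl ?ipBr//; last exact: L2B.
by rewrite (ipC g f); ring.
Qed.

Lemma n2Z a f : L2 f -> n2 (fun x => a * f x) = a ^+ 2 * n2 f.
Proof. by move=> lf; rewrite /n2 ipZl ?ipZr//; [ring|exact: L2Z]. Qed.

Lemma n2N f : n2 (fun x => - f x) = n2 f.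
Proof. by apply: eq_Rintegral => x _; rewrite mulrNN. Qed.

Lemma n2BC f g : n2 (fun x => f x - g x) = n2 (fun x => g x - f x).
Proof. by rewrite -n2N; congr n2; apply/funext => x; rewrite opprB. Qed.

(** The polynomial [a -> n2 (f + a g)] is nonnegative; it is evaluated at its minimum, the
    degenerate case [n2 g = 0] being apart. *)
Lemma cauchy f g : L2 f -> L2 g -> ip f g ^+ 2 <= n2 f * n2 g.
Proof.
move=> lf lg.
have h (a : R) : 0 <= n2 f + 2 * a * ip f g + a ^+ 2 * n2 g.
  have := n2_ge0 (fun x => f x + a * g x).
  rewrite n2D ?n2Z ?ipZr//; last exact: L2Z.
  by rewrite mulrA.
have [g0|g0] := eqVneq (n2 g) 0; last first.
  have {}g0 : 0 < n2 g by rewrite lt_def g0 n2_ge0.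
  have := h (- (ip f g / n2 g)).
  rewrite -(pmulr_rge0 _ g0).
  have -> : n2 g * (n2 f + 2 * - (ip f g / n2 g) * ip f g +
    (- (ip f g / n2 g)) ^+ 2 * n2 g) = n2 f * n2 g - ip f g ^+ 2.
    by field; rewrite gt_eqF.
  by rewrite subr_ge0.
rewrite g0 mulr0; have [->|i0] := eqVneq (ip f g) 0; first by rewrite expr0n.
(* When [n2 g = 0] the polynomial is affine in [a]; this value makes it equal to [-1]. *)
have := h (- ((n2 f + 1) / (2 * ip f g))).
rewrite g0 mulr0 addr0.
have -> : 2 * - ((n2 f + 1) / (2 * ip f g)) * ip f g = - (n2 f + 1) by field.
by rewrite opprD addNKr oppr_ge0 ler10.
Qed.

Lemma cauchy_abs f g : L2 f -> L2 g -> `|ip f g| <= Num.sqrt (n2 f) * Num.sqrt (n2 g).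
Proof.
move=> lf lg; rewrite -sqrtrM ?n2_ge0// -sqrtr_sqr ler_wsqrtr//.
exact: cauchy.
Qed.

Lemma n2D_le f g : L2 f -> L2 g -> n2 (fun x => f x + g x) <= 2 * n2 f + 2 * n2 g.
Proof.
move=> lf lg; rewrite n2D//; have := n2_ge0 (fun x => f x - g x).
by rewrite n2B//; lra.
Qed.

Lemma n2_triangle g f h : L2 f -> L2 g -> L2 h ->
  n2 (fun x => f x - h x) <= 2 * n2 (fun x => f x - g x) + 2 * n2 (fun x => g x - h x).
Proof.
move=> lf lg lh; apply: le_trans (n2D_le _ _); [|exact: L2B|exact: L2B].
by apply: eq_ler; congr n2; apply/funext => x; ring.
Qed.

Lemma le_n2 f g : measurable_fun setT f -> L2 g ->
  (forall x, `|f x| <= `|g x|) -> n2 f <= n2 g.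
Proof.
move=> mf lg fg; have lf := L2_le mf lg fg.
rewrite !n2E; apply: le_Rintegral => //; [by case: lf|by case: lg|].
move=> x _; rewrite -[leLHS]real_normK ?num_real// -[leRHS]real_normK ?num_real//.
by rewrite lerXn2r ?nnegrE.
Qed.

Lemma n2_bounded (M : R) (b : T -> R) f : measurable_fun setT b ->
  (forall x, `|b x| <= M) -> L2 f -> n2 (fun x => b x * f x) <= M ^+ 2 * n2 f.
Proof.
move=> mb bM lf; rewrite -n2Z//; apply: le_n2; last 2 first.
- exact: L2Z.
- move=> x; rewrite !normrM ler_wpM2r// (le_trans (bM x))// ler_norm//.
- by apply: measurable_funM => //; exact: L2_measurable.
Qed.

Lemma n2_eq0 f : L2 f -> n2 f = 0 -> {ae mu, forall x, f x = 0}.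
Proof.
move=> lf; rewrite n2E => f0.
have := Rint_eq0 _ lf.2 f0 => /(_ (fun x => sqr_ge0 _)).
by apply: filterS => x /eqP; rewrite sqrf_eq0 => /eqP.
Qed.

Lemma n2B_eq0 f g : L2 f -> L2 g -> n2 (fun x => f x - g x) = 0 ->
  {ae mu, forall x, f x = g x}.
Proof.
move=> lf lg /n2_eq0 h; have /h : L2 (fun x => f x - g x) by exact: L2B.
by apply: filterS => x /eqP; rewrite subr_eq0 => /eqP.
Qed.

Lemma n2_0 : n2 (fun=> 0) = 0.
Proof. by rewrite n2E; under eq_Rintegral do rewrite expr0n/=; rewrite Rintegral_cst// mul0r. Qed.

Implicit Types (fs gs : nat -> T -> R).

Definition cvg2 (fs : nat -> T -> R) f :=
  (fun n => n2 (fun x => fs n x - f x)) @ \oo --> (0 : R).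

Lemma squeeze0 (u v : nat -> R) : (forall n, 0 <= u n <= v n) ->
  v @ \oo --> (0 : R) -> u @ \oo --> (0 : R).
Proof.
move=> uv v0; apply: (squeeze_cvgr _ (cvg_cst (0 : R)) v0).
exact: nearW.
Qed.

Lemma cvg2_cst f : cvg2 (fun=> f) f.
Proof.
rewrite /cvg2; under eq_fun do under [X in n2 X]eq_fun do rewrite subrr.
by rewrite n2_0; exact: cvg_cst.
Qed.

Lemma cvg2D fs gs f g : (forall n, L2 (fs n)) -> (forall n, L2 (gs n)) ->
  L2 f -> L2 g -> cvg2 fs f -> cvg2 gs g ->
  cvg2 (fun n x => fs n x + gs n x) (fun x => f x + g x).
Proof.
move=> lf_ lg_ lf lg cf cg.
apply: (@squeeze0 _ (fun n => 2 * n2 (fun x => fs n x - f x) + 2 * n2 (fun x => gs n x - g x))).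
  move=> n; rewrite n2_ge0/=; apply: le_trans (n2D_le _ _); [|exact: L2B..].
  by apply: eq_ler; congr n2; apply/funext => x; ring.
rewrite -[X in _ --> X](_ : 2 * 0 + 2 * 0 = 0 :> R); last by rewrite mulr0 addr0.
by apply: cvgD; apply: cvgM => //; exact: cvg_cst.
Qed.

Lemma cvg2_bounded (M : R) (b : T -> R) fs f : measurable_fun setT b ->
  (forall x, `|b x| <= M) -> (forall n, L2 (fs n)) -> L2 f -> cvg2 fs f ->
  cvg2 (fun n x => b x * fs n x) (fun x => b x * f x).
Proof.
move=> mb bM lf_ lf cf.
apply: (@squeeze0 _ (fun n => M ^+ 2 * n2 (fun x => fs n x - f x))).
  move=> n; rewrite n2_ge0/=.
  have -> : (fun x => b x * fs n x - b x * f x) = (fun x => b x * (fs n x - f x)).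
    by apply/funext => x; rewrite mulrBr.
  by apply: n2_bounded => //; exact: L2B.
by rewrite -[X in _ --> X](mulr0 (M ^+ 2)); apply: cvgM => //; exact: cvg_cst.
Qed.

Lemma cvg2Z a fs f : (forall n, L2 (fs n)) -> L2 f -> cvg2 fs f ->
  cvg2 (fun n x => a * fs n x) (fun x => a * f x).
Proof. exact: (@cvg2_bounded `|a| (fun=> a)). Qed.

Lemma cvg2N fs f : (forall n, L2 (fs n)) -> L2 f -> cvg2 fs f ->
  cvg2 (fun n x => - fs n x) (fun x => - f x).
Proof.
move=> lf_ lf cf.
have : cvg2 (fun n x => -1 * fs n x) (fun x => -1 * f x) by exact: cvg2Z.
under eq_fun do under eq_fun do rewrite mulN1r.
by under [X in cvg2 _ X]eq_fun do rewrite mulN1r.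
Qed.

Lemma cvg2B fs gs f g : (forall n, L2 (fs n)) -> (forall n, L2 (gs n)) ->
  L2 f -> L2 g -> cvg2 fs f -> cvg2 gs g ->
  cvg2 (fun n x => fs n x - gs n x) (fun x => f x - g x).
Proof.
move=> lf_ lg_ lf lg cf cg; apply: cvg2D => //; last exact: cvg2N.
- by move=> n; exact: L2N.
- exact: L2N.
Qed.

Lemma sqrt_cvg0 (u : nat -> R) : (forall n, 0 <= u n) -> u @ \oo --> (0 : R) ->
  (fun n => Num.sqrt (u n)) @ \oo --> (0 : R).
Proof.
move=> u0 cu; rewrite -[X in _ --> X]sqrtr0; apply: cvg_comp cu _.
exact: sqrt_continuous.
Qed.

Lemma ip_cvg fs gs f g : (forall n, L2 (fs n)) -> (forall n, L2 (gs n)) ->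
  L2 f -> L2 g -> cvg2 fs f -> cvg2 gs g ->
  (fun n => ip (fs n) (gs n)) @ \oo --> ip f g.
Proof.
move=> lf_ lg_ lf lg cf cg.
have E n : ip (fs n) (gs n) = ip f g + (ip (fun x => fs n x - f x) g
    + ip f (fun x => gs n x - g x)
    + ip (fun x => fs n x - f x) (fun x => gs n x - g x)).
  rewrite !ipBr ?ipBl//; try exact: L2B.
  by ring.
apply: (eq_cvgn E); apply: (cvgn_eq (addr0 _)); apply: cvgD; first exact: cvg_cst.
have C (f1 f2 : nat -> T -> R) : (forall n, L2 (f1 n)) -> (forall n, L2 (f2 n)) ->
    (fun n => Num.sqrt (n2 (f1 n)) * Num.sqrt (n2 (f2 n))) @ \oo --> (0 : R) ->
    (fun n => ip (f1 n) (f2 n)) @ \oo --> (0 : R).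
  move=> l1 l2 h; apply/norm_cvg0P; apply: squeeze0 h => n.
  by rewrite normr_ge0/= cauchy_abs.
have sf := sqrt_cvg0 (fun n => n2_ge0 _) cf.
have sg := sqrt_cvg0 (fun n => n2_ge0 _) cg.
rewrite -[X in _ --> X](_ : 0 + 0 + 0 = 0 :> R); last by rewrite !addr0.
apply: cvgD; first apply: cvgD; apply: C => //; try (by move=> n; exact: L2B).
- rewrite -[X in _ --> X](mul0r (Num.sqrt (n2 g))).
  by apply: cvgM => //; exact: cvg_cst.
- rewrite -[X in _ --> X](mulr0 (Num.sqrt (n2 f))).
  by apply: cvgM => //; exact: cvg_cst.
- by rewrite -[X in _ --> X](mulr0 0); exact: cvgM.
Qed.

Lemma n2_cvg fs f : (forall n, L2 (fs n)) -> L2 f -> cvg2 fs f ->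
  (fun n => n2 (fs n)) @ \oo --> n2 f.
Proof. by move=> *; exact: ip_cvg. Qed.

Lemma L2_dct (fs : nat -> T -> R) f g : (forall n, measurable_fun setT (fs n)) ->
  measurable_fun setT f -> L2 g -> (forall n x, `|fs n x| <= `|g x|) ->
  {ae mu, forall x, fs ^~ x @ \oo --> f x} -> L2 f /\ cvg2 fs f.
Proof.
move=> mf_ mf lg fg ff.
(* Integrability of [f ^+ 2] comes first, since the function that dominates the squared errors
   involves [f] itself. *)
have [f2 _] : rint mu (fun x => f x ^+ 2) /\
    (fun n => \int[mu]_x (fs n x ^+ 2)) @ \oo --> \int[mu]_x (f x ^+ 2).
  apply: (dct mu _ _ (fun x => g x ^+ 2)).
  - by move=> n; exact: measurable_funX.
  - by case: lg.
  - by move=> n x; rewrite normrX -[leRHS]real_normK ?num_real// lerXn2r ?nnegrE.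
  - by apply: filterS ff => x h; rewrite expr2; under eq_fun do rewrite expr2; exact: cvgM.
  - exact: measurable_funX.
have lf : L2 f by split.
split => //; rewrite /cvg2; under eq_fun do rewrite n2E.
have -> : 0 = \int[mu]_x ((fun=> 0) x) :> R by rewrite Rintegral_cst// mul0r.
have [] // := @dct _ _ _ mu (fun n x => (fs n x - f x) ^+ 2) (fun=> 0)
  (fun x => 2 * g x ^+ 2 + 2 * f x ^+ 2).
- by move=> n; apply: measurable_funX; exact: measurable_funB.
- by apply: rintD; apply: rintZ => //; case: lg.
- move=> n x; rewrite ger0_norm ?sqr_ge0//.
  have : fs n x ^+ 2 <= g x ^+ 2.
    by rewrite -[leLHS]real_normK ?num_real// -[leRHS]real_normK ?num_real// lerXn2r ?nnegrE.
  have := sqr_ge0 (fs n x + f x); rewrite !expr2; nra.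
- apply: filterS ff => x h; rewrite -[X in _ --> X](_ : (f x - f x) ^+ 2 = 0); last first.
    by rewrite subrr expr0n.
  rewrite expr2; under eq_fun do rewrite expr2.
  by apply: cvgM; apply: cvgB => //; exact: cvg_cst.
Qed.

End L2.
Arguments ip {d T R} mu f g.
Arguments n2 {d T R} mu f.
Arguments L2 {d T R} mu f.
Arguments cvg2 {d T R} mu fs f.

Arguments L2_le {d T R} mu {f} g.
Arguments L2_bounded {d T R} mu M {b f}.
Arguments cvg2_bounded {d T R} mu M {b fs f}.
Arguments L2_dct {d T R} mu fs f g.
Arguments n2_triangle {d T R} mu g f h.

(** * Changes of variables with constant Jacobian *)

Section measure_scaling.
Context d (T : measurableType d) (R : realType).
Variable mu : {measure set T -> \bar R}.
Implicit Types (phi psi : T -> T) (f : T -> R) (c : R).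

(** Pushing [mu] forward along [phi] multiplies it by [c]. Translations and reflections have
    [c = 1], the dilation by [a] has [c = a^-1]. *)
Definition mpc c phi := [/\ 0 < c, measurable_fun setT phi &
  forall A, measurable A -> mu (phi @^-1` A) = (c%:E * mu A)%E].

Lemma mpc_comp c c' phi psi : mpc c phi -> mpc c' psi ->
  mpc (c' * c) (phi \o psi).
Proof.
move=> [c0 mphi hphi] [c'0 mpsi hpsi]; split.
- exact: mulr_gt0.
- exact: measurableT_comp.
- move=> A mA; rewrite comp_preimage hpsi.
    by rewrite hphi// EFinM muleA.
  by rewrite -[X in measurable X]setTI; exact: mphi.
Qed.

Lemma mpc_ge0_integral c phi (f : T -> \bar R) : mpc c phi ->
  measurable_fun setT f -> (forall x, 0 <= f x)%E ->
  (\int[mu]_x f (phi x) = c%:E * \int[mu]_x f x)%E.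
Proof.
move=> [c0 mphi hphi] mf f0.
have := @ge0_integral_mscale _ T R mu setT measurableT (NngNum (ltW c0)) f mf
  (fun x _ => f0 x).
move=> /= <-.
have := @ge0_integral_pushforward _ _ T T R phi mphi mu setT f measurableT mf
  (fun x _ => f0 x).
rewrite preimage_setT => <-.
by apply: eq_measure_integral => A mA _ /=; rewrite /pushforward hphi.
Qed.

Lemma mpc_rint c phi f : mpc c phi -> rint mu f -> rint mu (f \o phi).
Proof.
move=> /[dup] h [c0 mphi _] fi; apply: rint_lty.
  by apply: measurableT_comp mphi; exact: rint_measurable fi.
rewrite (mpc_ge0_integral h (f := fun x => `|f x|%:E))//; last first.
  by apply/measurable_EFinP; apply: measurableT_comp => //; exact: rint_measurable fi.
by rewrite lte_mul_pinfty ?lee_fin ?(ltW c0)//; exact: rint_ltyP fi.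
Qed.

Lemma mpc_Rintegral c phi f : mpc c phi -> rint mu f ->
  \int[mu]_x f (phi x) = c * \int[mu]_x f x.
Proof.
move=> h fi; have mf := rint_measurable fi; have [c0 mphi _] := h.
have fin := mpc_rint h fi.
apply: EFin_inj; rewrite EFinM -rint_fin//=.
rewrite -[X in (_ * X)%E]rint_fin//.
rewrite [LHS]integralE [in RHS]integralE muleBr//; last first.
  rewrite fin_num_adde_defl// fin_numN; exact: integrable_neg_fin_num.
congr (_ - _)%E.
- rewrite -(mpc_ge0_integral h) //.
    by apply: eq_integral => x _; rewrite !funeposE.
  by apply/measurable_funepos/measurable_EFinP.
- rewrite -(mpc_ge0_integral h) //.
    by apply: eq_integral => x _; rewrite !funenegE.
  by apply/measurable_funeneg/measurable_EFinP.
Qed.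

Lemma mpc_L2 c phi f : mpc c phi -> L2 mu f -> L2 mu (f \o phi).
Proof.
move=> /[dup] h [c0 mphi _] [mf f2]; split; first exact: measurableT_comp.
exact: (mpc_rint h f2).
Qed.

Lemma mpc_ip c phi f g : mpc c phi -> L2 mu f -> L2 mu g ->
  ip mu (f \o phi) (g \o phi) = c * ip mu f g.
Proof. by move=> h lf lg; apply: (mpc_Rintegral h); exact: L2M. Qed.

Lemma mpc_ae c phi (P : T -> Prop) : mpc c phi ->
  {ae mu, forall x, P x} -> {ae mu, forall x, P (phi x)}.
Proof.
move=> [c0 mphi hphi] [N [mN N0 PN]]; exists (phi @^-1` N); split.
- by rewrite -[X in measurable X]setTI; exact: mphi.
- by rewrite hphi// N0 mule0.
- by move=> x /= Px; exact: PN.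
Qed.

End measure_scaling.

Section product_scaling.
Context d1 d2 (T1 : measurableType d1) (T2 : measurableType d2) (R : realType).
Variable m1 : {sigma_finite_measure set T1 -> \bar R}.
Variable m2 : {sigma_finite_measure set T2 -> \bar R}.

(** The pushforward divided by [c1 * c2] agrees with the product measure on rectangles, and these
    determine a product measure. *)
Lemma mpc_prod c1 c2 (phi1 : T1 -> T1) (phi2 : T2 -> T2) :
  mpc m1 c1 phi1 -> mpc m2 c2 phi2 ->
  mpc (m1 \x m2)%E (c1 * c2) (fun z => (phi1 z.1, phi2 z.2)).
Proof.
move=> [c10 mp1 h1] [c20 mp2 h2].
set phi := fun z : T1 * T2 => (phi1 z.1, phi2 z.2).
have mphi : measurable_fun setT phi.
  by apply: measurable_fun_pair; [exact: (measurableT_comp mp1 measurable_fst)|exact: (measurableT_comp mp2 measurable_snd)].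
split => //; first exact: mulr_gt0.
move=> A mA.
have c0 : 0 <= (c1 * c2)^-1 by rewrite invr_ge0 mulr_ge0// ltW.
pose mfm := isMeasurableFun.Build _ _ _ _ _ mphi.
pose phip : {mfun _ >-> _} := HB.pack phi mfm.
have H := @product_measure_unique _ _ T1 T2 R m1 m2
  (mscale (NngNum c0) (pushforward (m1 \x m2)%E phip)).
have E : ((m1 \x m2) A = ((c1 * c2)^-1)%:E * (m1 \x m2) (phi @^-1` A))%E.
  apply: (H mphi) => //.
  move=> B C mB mC; rewrite /= /mscale /= /pushforward.
  have -> : phip @^-1` (B `*` C) = (phi1 @^-1` B) `*` (phi2 @^-1` C) by [].
  have mB' : measurable (phi1 @^-1` B) by rewrite -[X in measurable X]setTI; exact: mp1.
  have mC' : measurable (phi2 @^-1` C) by rewrite -[X in measurable X]setTI; exact: mp2.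
  rewrite product_measure1E// h1// h2//.
  rewrite (_ : (c1%:E * m1 B * (c2%:E * m2 C) = (c1 * c2)%:E * (m1 B * m2 C))%E);
    last by rewrite EFinM muleACA.
  rewrite muleA -EFinM mulVf ?mul1e//.
  by rewrite mulf_eq0 negb_or !gt_eqF.
transitivity ((c1 * c2)%:E * (((c1 * c2)^-1)%:E * (m1 \x m2) (phi @^-1` A)))%E; last first.
  by congr (_ * _)%E; exact/esym.
rewrite muleA -EFinM mulfV ?mul1e//.
by rewrite mulf_eq0 negb_or !gt_eqF.
Qed.

End product_scaling.

Section real_line.
Context {R : realType}.
Local Notation leb1 := (@lebesgue_measure R).

(** Lebesgue measure is determined by its values on half-open intervals; this is applied to the
    pushforward under [phi] divided by [c]. *)
Lemma preimage_eq_measure (c : R) (phi : measurableTypeR R -> measurableTypeR R) : 0 < c ->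
  measurable_fun setT phi ->
  (forall a b : R, a < b ->
    leb1 (phi @^-1` `]a, b]) = (c * (b - a))%:E) ->
  mpc leb1 c phi.
Proof.
move=> c0 mphi h; split => // A mA.
have c'0 : 0 <= c^-1 by rewrite invr_ge0 ltW.
pose mfm := isMeasurableFun.Build _ _ _ _ _ mphi.
pose phip : {mfun _ >-> _} := HB.pack phi mfm.
have H := @lebesgue_measure_unique R (mscale (NngNum c'0) (pushforward leb1 phip)).
have E : (leb1 A = (c^-1)%:E * leb1 (phi @^-1` A))%E.
  apply: (H mphi) => //.
  move=> _ [[a b]] _ <- /=; rewrite /mscale /= /pushforward.
  rewrite lebesgue_measure_itv/= lte_fin; have [ab|ba] := ltP a b.
    by rewrite [phip @^-1` _](_ : _ = phi @^-1` `]a, b])// h// -EFinM mulKf ?gt_eqF.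
  by rewrite set_itv_ge ?preimage_set0 ?measure0 ?mule0// bnd_simp -leNgt.
transitivity (c%:E * ((c^-1)%:E * leb1 (phi @^-1` A)))%E; last first.
  by congr (_ * _)%E; exact/esym.
by rewrite muleA -EFinM mulfV ?mul1e// gt_eqF.
Qed.

Lemma mpc_shift (a : R) : mpc leb1 1 (fun x : measurableTypeR R => x + a : measurableTypeR R).
Proof.
apply: preimage_eq_measure => //; first exact: measurable_funD.
move=> b c bc.
have -> : (fun x : R => x + a) @^-1` `]b, c] = `]b - a, c - a]%classic.
  by apply/seteqP; split=> x /=; rewrite !in_itv/= ltrBlDr lerBrDr.
rewrite lebesgue_measure_itv/= lte_fin ltrD2r bc mul1r -EFinD.
by congr EFin; ring.
Qed.

Lemma mpc_opp : mpc leb1 1 (fun x : measurableTypeR R => - x : measurableTypeR R).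
Proof.
apply: preimage_eq_measure => //; first exact: measurableT_comp.
move=> b c bc.
have -> : (fun x : R => - x) @^-1` `]b, c] = `[- c, - b[%classic.
  by apply/seteqP; split=> x /=; rewrite !in_itv/= ltrNr lerNl andbC.
rewrite lebesgue_measure_itv/= lte_fin ltrN2 bc mul1r -EFinD.
by congr EFin; ring.
Qed.

Lemma mpc_scale (a : R) : 0 < a ->
  mpc leb1 a^-1 (fun x : measurableTypeR R => a * x : measurableTypeR R).
Proof.
move=> a0; apply: preimage_eq_measure => //.
- by rewrite invr_gt0.
- exact: measurable_funM.
move=> b c bc.
have -> : (fun x : R => a * x) @^-1` `]b, c] = `]b / a, c / a]%classic.
  by apply/seteqP; split=> x /=; rewrite !in_itv/= ltr_pdivrMr// ler_pdivlMr// ![_ * a]mulrC.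
rewrite lebesgue_measure_itv/= lte_fin ltr_pM2r ?invr_gt0// bc -EFinD.
by congr EFin; ring.
Qed.

End real_line.

(** * Fubini's theorem for real-valued functions *)

Section fubini.
Context d1 d2 (T1 : measurableType d1) (T2 : measurableType d2) (R : realType).
Variable m1 : {sigma_finite_measure set T1 -> \bar R}.
Variable m2 : {sigma_finite_measure set T2 -> \bar R}.
Implicit Types (f : T1 * T2 -> R) (g : T1 -> R) (h : T2 -> R).

Lemma rint12 f : measurable_fun setT f ->
  (\int[m1]_x \int[m2]_y `|f (x, y)|%:E < +oo)%E -> rint (m1 \x m2)%E f.
Proof.
by move=> mf h; apply/(@integrable12ltyP _ _ T1 T2 R m1 m2 (EFin \o f)) => //; exact/measurable_EFinP.
Qed.

Lemma rint21 f : measurable_fun setT f ->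
  (\int[m2]_y \int[m1]_x `|f (x, y)|%:E < +oo)%E -> rint (m1 \x m2)%E f.
Proof.
by move=> mf h; apply/(@integrable21ltyP _ _ T1 T2 R m1 m2 (EFin \o f)) => //; exact/measurable_EFinP.
Qed.

Lemma rint_tensor g h : rint m1 g -> rint m2 h ->
  rint (m1 \x m2)%E (fun z => g z.1 * h z.2).
Proof.
move=> ig ih; have mg := rint_measurable ig; have mh := rint_measurable ih.
apply: rint12; first by apply: measurable_funM; apply: measurableT_comp.
have E x : (\int[m2]_y `|g x * h y|%:E = `|g x|%:E * \int[m2]_y `|h y|%:E)%E.
  under eq_integral do rewrite normrM EFinM.
  by rewrite ge0_integralZl//; apply/measurable_EFinP; exact: measurableT_comp.
under eq_integral do rewrite /= E.
rewrite ge0_integralZr//.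
- by apply: lte_mul_pinfty; [exact: integral_ge0|
    exact/(integrable_fin_num _ (f := fun x => `|g x|%:E))/rint_norm|exact: rint_ltyP].
- by apply/measurable_EFinP; exact: measurableT_comp.
- exact: integral_ge0.
Qed.

Lemma rint_ae1 f : rint (m1 \x m2)%E f ->
  {ae m1, forall x, rint m2 (fun y => f (x, y))}.
Proof.
by move=> fi; have := ae_integrable1 fi; apply: filterS.
Qed.

Lemma rint_ae2 f : rint (m1 \x m2)%E f ->
  {ae m2, forall y, rint m1 (fun x => f (x, y))}.
Proof.
by move=> fi; have := ae_integrable2 fi; apply: filterS.
Qed.

(** The inner real integral is meaningless where a section is not integrable. It agrees almost
    everywhere with the extended real inner integral, from which the bound and the value are
    transferred. *)
Lemma rint_fubini1 f : rint (m1 \x m2)%E f ->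
  rint m1 (fun x => \int[m2]_y f (x, y)) /\
  \int[m1]_x \int[m2]_y f (x, y) = \int[(m1 \x m2)%E]_z f z.
Proof.
move=> fi; have mF := measurable_fubini_F fi; have iF := integrable_fubini_F fi.
have mf : measurable_fun setT (fun x => \int[m2]_y f (x, y)).
  by apply: (measurableT_comp (f := fine)) mF.
have aeE : {ae m1, forall x, setT x ->
    fubini_F m2 (EFin \o f) x = (\int[m2]_y f (x, y))%:E}.
  by apply: filterS (rint_ae1 fi) => x h _; rewrite /fubini_F -rint_fin.
split.
  apply/integrableP; split; first exact/measurable_EFinP.
  case/integrableP: iF => _; apply: le_lt_trans.
  apply: ae_ge0_le_integral => //.
  - by apply/measurable_EFinP; exact: measurableT_comp.
  - exact: measurableT_comp.
  - by apply: filterS aeE => x /(_ I) /= -> _.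
rewrite /Rintegral -(integral12_prod_meas1 fi); congr fine.
apply/esym/ae_eq_integral => //; exact/measurable_EFinP.
Qed.

Lemma rint_fubini2 f : rint (m1 \x m2)%E f ->
  rint m2 (fun y => \int[m1]_x f (x, y)) /\
  \int[m2]_y \int[m1]_x f (x, y) = \int[(m1 \x m2)%E]_z f z.
Proof.
move=> fi; have mF := measurable_fubini_G fi; have mf0 := rint_measurable fi.
have mf1 : measurable_fun setT (abse \o (EFin \o f)).
  by apply: measurableT_comp => //; exact/measurable_EFinP.
have iF : m2.-integrable setT (fubini_G m1 (EFin \o f)).
  apply/integrableP; split => //.
  apply: le_lt_trans ((integrable21ltyP m1 m2 (measurable_int _ fi)).1 fi).
  apply: ge0_le_integral => //.
  - exact: measurableT_comp.
  - by apply: (measurable_fun_fubini_tonelli_G (abse \o (EFin \o f))) => //= x; exact: abse_ge0.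
  - move=> y _; apply: le_abse_integral => //.
    by apply/measurable_EFinP; exact: measurableT_comp.
have mf : measurable_fun setT (fun y => \int[m1]_x f (x, y)).
  by apply: (measurableT_comp (f := fine)) mF.
have aeE : {ae m2, forall y, setT y ->
    fubini_G m1 (EFin \o f) y = (\int[m1]_x f (x, y))%:E}.
  by apply: filterS (rint_ae2 fi) => x h _; rewrite /fubini_G -rint_fin.
split.
  apply/integrableP; split; first exact/measurable_EFinP.
  case/integrableP: iF => _; apply: le_lt_trans.
  apply: ae_ge0_le_integral => //.
  - by apply/measurable_EFinP; exact: measurableT_comp.
  - exact: measurableT_comp.
  - by apply: filterS aeE => x /(_ I) /= -> _.
rewrite /Rintegral -(integral21_prod_meas1 fi); congr fine.
apply/esym/ae_eq_integral => //; exact/measurable_EFinP.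
Qed.

Lemma Rfubini f : rint (m1 \x m2)%E f ->
  \int[m1]_x \int[m2]_y f (x, y) = \int[m2]_y \int[m1]_x f (x, y).
Proof. by move=> fi; rewrite (rint_fubini1 fi).2 (rint_fubini2 fi).2. Qed.

Lemma Rintegral_tensor g h : rint m1 g -> rint m2 h ->
  \int[(m1 \x m2)%E]_z (g z.1 * h z.2) = (\int[m1]_x g x) * (\int[m2]_y h y).
Proof.
move=> ig ih; rewrite -(rint_fubini1 (rint_tensor ig ih)).2/=.
under eq_Rintegral do rewrite RintegralZl//.
by rewrite RintegralZr.
Qed.

End fubini.

(** * Smooth functions of one variable and bump functions *)

Section smooth.
Context {R : realType}.
Implicit Types f g : R -> R.

Fixpoint Cn (n : nat) f : Prop :=
  if n is m.+1 then
    exists2 f', (forall x : R, is_derive x 1 f (f' x)) & Cn m f'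
  else continuous f.

Definition smooth f := forall n, Cn n f.

Lemma is_derive_continuous f (f' : R -> R) : (forall x : R, is_derive x 1 f (f' x)) ->
  continuous f.
Proof.
move=> h x; apply: differentiable_continuous; apply/derivable1_diffP.
by have [] := h x.
Qed.

Lemma CnS n f : Cn n.+1 f -> Cn n f.
Proof.
elim: n f => [f [f' h _]|n ih f [f' h C']]; first exact: is_derive_continuous h.
by exists f' => //; exact: ih.
Qed.

Lemma Cn_cst n (c : R) : Cn n (fun=> c).
Proof.
elim: n c => [c|n ih c] /=; first exact: cst_continuous.
by exists (fun=> 0); [move=> x; exact: is_derive_cst|exact: ih].
Qed.

Lemma CnD n f g : Cn n f -> Cn n g -> Cn n (fun x => f x + g x).
Proof.
elim: n f g => [f g cf cg x|n ih f g [f' hf cf] [g' hg cg]] /=.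
  by apply: cvgD; [exact: cf|exact: cg].
exists (fun x => f' x + g' x); last exact: ih.
by move=> x; have := hf x; have := hg x => ? ?; exact: is_deriveD.
Qed.

Lemma CnM n f g : Cn n f -> Cn n g -> Cn n (fun x => f x * g x).
Proof.
elim: n f g => [f g cf cg x|n ih f g].
  by apply: cvgM; [exact: cf|exact: cg].
move=> /[dup] /CnS c0f [f' hf cf] /[dup] /CnS c0g [g' hg cg].
exists (fun x => f x * g' x + g x * f' x).
  by move=> x; have := hf x; have := hg x => ? ?; exact: is_deriveM.
by apply: CnD; exact: ih.
Qed.

Lemma Cn_affine n f (a b : R) : Cn n f -> Cn n (fun x => f (a * x + b)).
Proof.
elim: n f => [f cf x|n ih f [f' hf cf]].
  apply: (@continuous_comp _ _ _ (fun x => a * x + b) f); last exact: cf.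
  apply: cvgD; last exact: cvg_cst.
  by apply: cvgM; [exact: cvg_cst|exact: cvg_id].
exists (fun x => f' (a * x + b) * a); last by apply: CnM; [exact: ih|exact: Cn_cst].
move=> x; apply: (@is_derive1_comp R f (fun x => a * x + b) x (f' (a * x + b)) a (hf _) _).
by apply: is_derive_eq; rewrite /GRing.scale/= mulr1 ?mulr0 !addr0.
Qed.

Lemma smoothD f g : smooth f -> smooth g -> smooth (fun x => f x + g x).
Proof. by move=> sf sg n; exact: CnD. Qed.
Lemma smoothM f g : smooth f -> smooth g -> smooth (fun x => f x * g x).
Proof. by move=> sf sg n; exact: CnM. Qed.
Lemma smooth_cst (c : R) : smooth (fun=> c).
Proof. by move=> n; exact: Cn_cst. Qed.
Lemma smooth_affine f (a b : R) : smooth f -> smooth (fun x => f (a * x + b)).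
Proof. by move=> sf n; exact: Cn_affine. Qed.
Lemma smoothX f k : smooth f -> smooth (fun x => f x ^+ k).
Proof.
move=> sf; elim: k => [|k ih]; first by under eq_fun do rewrite expr0; exact: smooth_cst.
by under eq_fun do rewrite exprS; exact: smoothM.
Qed.

Lemma smooth_continuous f : smooth f -> continuous f.
Proof. by move=> /(_ 0%N). Qed.

Lemma smooth_derive f : smooth f -> exists2 f', smooth f' & forall x : R, is_derive x 1 f (f' x).
Proof.
move=> sf; have [f' h _] := sf 1%N; exists f' => // n.
have [g hg cg] := sf n.+1.
rewrite (_ : f' = g)//; apply/funext => x.
by have [_ <-] := h x; have [_ <-] := hg x.
Qed.

Lemma smooth_primitive f f' : smooth f' -> (forall x : R, is_derive x 1 f (f' x)) ->
  smooth f.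
Proof. by move=> sf' h [|n]; [exact: is_derive_continuous h|exists f']. Qed.

(** The classical flat function [exp(-1/x)] together with its multiples by powers of [1/x]: the
    family is stable under differentiation up to linear combinations, which makes smoothness an
    induction. *)
Definition gexp k (x : R) := if 0 < x then x^-1 ^+ k * expR (- x^-1) else 0.

Lemma gexp_ge0 k x : 0 <= gexp k x.
Proof.
rewrite /gexp; case: ifPn => // x0.
by rewrite mulr_ge0// ?expR_ge0// exprn_ge0// invr_ge0 ltW.
Qed.

(** From [exp(y) >= y^(k+1) / (k+1)!] at [y = 1/x]. This linear bound controls the difference
    quotient at 0. *)
Lemma gexp_le k (x : R) : gexp k x <= k.+1`!%:R * `|x|.
Proof.
rewrite /gexp; case: ifPn => x0; last by rewrite mulr_ge0.
rewrite (gtr0_norm x0) expRN -ler_pdivrMr; last by [].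
have y0 : 0 < x^-1 by rewrite invr_gt0.
rewrite mulrAC -exprSr ler_pdivrMr ?expR_gt0// mulrC -ler_pdivrMr ?ltr0n ?fact_gt0//.
apply: le_trans (expR_ge1Dxn k (ltW y0)).
by rewrite lerDr.
Qed.

Lemma gexp_derive_pos k (x : R) : 0 < x ->
  is_derive x 1 (gexp k) (gexp k.+2 x - k%:R * gexp k.+1 x).
Proof.
move=> x0; have xn0 : x != 0 by rewrite gt_eqF.
have dV : is_derive x 1 (fun t : R => t^-1) (- x ^- 2).
  have := @is_deriveV R id x 1 1 xn0 (is_derive_id x 1).
  by rewrite /GRing.scale/= mulr1.
apply: (@near_eq_is_derive _ _ _ (fun t : R => (t^-1 ^+ k) * expR (- t^-1))).
  near=> t; rewrite /gexp ifT//; near: t; exact: lt_nbhsr.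
have d1 : is_derive x 1 (fun t : R => t^-1 ^+ k) (- (k%:R * x^-1 ^+ k.+1)).
  elim: k => [|k ih].
    rewrite mul0r oppr0; under eq_fun do rewrite expr0; exact: is_derive_cst.
  under eq_fun do rewrite exprS.
  have -> : - (k.+1%:R * x^-1 ^+ k.+2) =
      x^-1 *: (- (k%:R * x^-1 ^+ k.+1)) + x^-1 ^+ k *: (- x ^- 2).
    by rewrite -exprVn /GRing.scale/= -[in LHS]natr1 -[k.+2]addn2 exprD [in RHS]exprS; ring.
  exact: is_deriveM.
have d2 : is_derive x 1 (fun t : R => expR (- t^-1)) (expR (- x^-1) * x^-1 ^+ 2).
  by apply: is_derive_eq; rewrite opprK exprVn.
have -> : gexp k.+2 x - k%:R * gexp k.+1 x =
    (x^-1 ^+ k) *: (expR (- x^-1) * x^-1 ^+ 2) + expR (- x^-1) *: (- (k%:R * x^-1 ^+ k.+1)).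
  by rewrite /gexp x0 /GRing.scale/= -[in LHS]addn2 exprD; ring.
exact: is_deriveM.
Unshelve. all: by end_near. Qed.

Lemma gexp_derive k (x : R) : is_derive x 1 (gexp k) (gexp k.+2 x - k%:R * gexp k.+1 x).
Proof.
have [x0|x0|<-] := ltgtP 0 x; first exact: gexp_derive_pos.
  have -> : gexp k.+2 x - k%:R * gexp k.+1 x = 0.
    by rewrite /gexp !ifF ?mulr0 ?subrr// ltNge ltW.
  have d0 : is_derive x 1 (cst 0 : R -> R) 0 by exact: is_derive_cst.
  apply: near_eq_is_derive d0.
  near=> t; rewrite /gexp ifF//; apply/negbTE; rewrite -leNgt; near: t.
  exact: nbhs_le_gt || (by apply: filterS (lt_nbhsl x0) => t /ltW).
have -> : gexp k.+2 0 - k%:R * gexp k.+1 0 = 0 by rewrite /gexp ltxx mulr0 subrr.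
suff h : (fun h : R => h^-1 *: ((gexp k \o shift 0) (h *: 1) - gexp k 0)) @ 0^' --> (0 : R).
  by apply: DeriveDef; [apply/cvg_ex; exists 0|exact/cvg_lim].
apply/cvgr0Pnorm_lt => e e0.
near=> t.
have t0 : t != 0 by near: t; exact: nbhs_dnbhs_neq.
rewrite /= addr0 /GRing.scale/= mulr1 {2}/gexp ltxx subr0.
(* The difference quotient at 0 is the next member of the family, hence of order [|t|]. *)
have -> : t^-1 * gexp k t = gexp k.+1 t.
  by rewrite /gexp; case: ifP; rewrite ?mulr0// exprS mulrA.
rewrite ger0_norm ?gexp_ge0//; apply: le_lt_trans (gexp_le _ _) _.
rewrite mulrC -ltr_pdivlMr ?ltr0n ?fact_gt0//.
near: t; apply: dnbhs0_lt.
by rewrite divr_gt0// ltr0n fact_gt0.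
Unshelve. all: by end_near. Qed.

Lemma gexp_smooth k : smooth (gexp k).
Proof.
move=> n; elim: n k => [|n ih] k; first exact: is_derive_continuous (gexp_derive k).
exists (fun x => gexp k.+2 x - k%:R * gexp k.+1 x); first exact: gexp_derive.
under eq_fun do rewrite -mulNr.
by apply: CnD; [exact: ih|apply: CnM; [exact: Cn_cst|exact: ih]].
Qed.

Definition bump (a b : R) x := gexp 0 (x - a) * gexp 0 (b - x).

Lemma bump_smooth a b : smooth (bump a b).
Proof.
apply: smoothM.
  have := smooth_affine 1 (- a) (gexp_smooth 0).
  by under eq_fun do rewrite mul1r.
have := smooth_affine (-1) b (gexp_smooth 0).
by under eq_fun do rewrite mulN1r addrC.
Qed.

Lemma gexp0_lt1 x : gexp 0 x < 1.
Proof.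
rewrite /gexp; case: ifPn => // x0; rewrite expr0 mul1r.
by rewrite expR_lt1 oppr_lt0 invr_gt0.
Qed.

Lemma bump_ge0 a b x : 0 <= bump a b x.
Proof. by rewrite mulr_ge0// gexp_ge0. Qed.

Lemma bump_lt1 a b x : bump a b x < 1.
Proof.
rewrite /bump; have [->|] := eqVneq (gexp 0 (b - x)) 0; first by rewrite mulr0.
have := gexp0_lt1 (x - a); have := gexp0_lt1 (b - x).
have := gexp_ge0 0 (x - a); have := gexp_ge0 0 (b - x).
move=> *; nra.
Qed.

Lemma bump_gt0 a b x : a < x < b -> 0 < bump a b x.
Proof.
move=> /andP[ax xb]; rewrite /bump /gexp !subr_gt0 ax xb !expr0 !mul1r.
by rewrite mulr_gt0// expR_gt0.
Qed.

Lemma bump_eq0 a b x : ~~ (a < x < b) -> bump a b x = 0.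
Proof.
rewrite negb_and /bump /gexp !subr_gt0 => /orP[]/negbTE ->; first by rewrite mul0r.
by rewrite mulr0.
Qed.

(** As [0 < bump < 1] on the open interval and [bump = 0] elsewhere, these smooth functions with
    values in [[0, 1]] converge pointwise to the indicator of the interval. *)
Definition bumpn n a b x := 1 - (1 - bump a b x) ^+ n.

Lemma bumpn_smooth n a b : smooth (bumpn n a b).
Proof.
have h c f : smooth f -> smooth (fun x => c - f x).
  move=> sf; apply: smoothD; first exact: smooth_cst.
  by under eq_fun do rewrite -mulN1r; apply: smoothM => //; exact: smooth_cst.
apply: (h 1); apply: smoothX; apply: (h 1); exact: bump_smooth.
Qed.

Lemma bumpn_itv n a b x : 0 <= bumpn n a b x <= 1.
Proof.
have h1 : 0 <= 1 - bump a b x by rewrite subr_ge0 ltW// bump_lt1.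
have h2 : 1 - bump a b x <= 1 by rewrite gerBl bump_ge0.
rewrite /bumpn subr_ge0 gerBl exprn_ge0// andbT.
exact: exprn_ile1.
Qed.

Lemma bumpn_eq0 n a b x : ~~ (a < x < b) -> bumpn n a b x = 0.
Proof. by move=> h; rewrite /bumpn bump_eq0// subr0 expr1n subrr. Qed.

Lemma bumpn_cvg a b x : (fun n => bumpn n a b x) @ \oo --> (\1_(`]a, b[%classic : set R) x : R).
Proof.
rewrite indicE mem_setE in_itv/=; case: (boolP (a < x < b)) => h; last first.
  by under eq_fun do rewrite bumpn_eq0//; exact: cvg_cst.
rewrite -[X in _ --> X](subr0 1); apply: cvgB; first exact: cvg_cst.
apply: cvg_expr; rewrite ger0_norm ?subr_ge0 ?ltW ?bump_lt1//.
by rewrite gtrBl bump_gt0.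
Qed.

Definition bsmooth (f : R -> R) := smooth f /\ exists M : R, forall x, M < `|x| -> f x = 0.

Lemma bumpn_bsmooth n a b : bsmooth (bumpn n a b).
Proof.
split; first exact: bumpn_smooth.
exists (`|a| + `|b|) => x h; apply: bumpn_eq0; apply/negP => /andP[ax xb].
have := ler_norm b; have := ler_norm (- a); rewrite normrN.
have := normr_ge0 a; have := normr_ge0 b; move: h.
by rewrite ltr_normr => /orP[] *; lra.
Qed.

Lemma bsmooth_derive f : bsmooth f ->
  exists2 f', bsmooth f' & forall x : R, is_derive x 1 f (f' x).
Proof.
move=> [sf [M fM]]; have [f' sf' h] := smooth_derive sf.
exists f' => //; split => //; exists M => x Mx.
have [_ <-] := h x.
rewrite -(derive_cst (0 : R) x 1); apply: near_eq_derive.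
have : \forall t \near x, M < `|t|.
  exact: (cvgr_gt _ (@norm_continuous _ R x)).
by apply: filterS => t /fM.
Qed.

Lemma bsmooth_continuous f : bsmooth f -> continuous f.
Proof. by move=> [/smooth_continuous]. Qed.

Lemma bsmooth_measurable f : bsmooth f -> measurable_fun setT (f : measurableTypeR R -> measurableTypeR R).
Proof. by move=> /bsmooth_continuous; exact: continuous_measurable_fun. Qed.

Lemma bsmooth_bounded f : bsmooth f -> exists M : R, forall x, `|f x| <= M.
Proof.
move=> [/smooth_continuous cf [M fM]].
have cM : compact (`[- `|M|, `|M|]%classic : set R) by exact: segment_compact.
have := @continuous_compact _ _ f _ (continuous_subspaceT cf) cM.
move=> /compact_bounded [B [_ hB]].
exists (Num.max 0 (B + 1)) => x; have [Mx|xM] := ltP `|M| `|x|.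
  by rewrite fM ?normr0 ?le_max ?lexx// (le_lt_trans _ Mx)// ler_norm.
rewrite le_max; apply/orP; right; apply: (hB (B + 1)); first by rewrite ltrDl.
by exists x => //=; rewrite in_itv/= -ler_norml.
Qed.

End smooth.

(** * Tensor products as test functions on the plane *)

Section test_functions.
Context {R : realType}.
Implicit Types f g : R -> R.

Definition tensor f g := fun z : R * R => f z.1 * g z.2.

Lemma differentiable_fst (z : R * R) : differentiable (fst : R * R -> R) z.
Proof.
have fl : linear (fst : R * R -> R) by [].
pose f' := GRing.isLinear.Build _ _ _ _ (fst : R * R -> R) fl.
pose f : {linear (R * R)%type -> R} := HB.pack (fst : (R * R)%type -> R) f'.
by apply: (@linear_differentiable _ _ _ f) => x; exact: cvg_fst.
Qed.

Lemma differentiable_snd (z : R * R) : differentiable (snd : R * R -> R) z.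
Proof.
have fl : linear (snd : R * R -> R) by [].
pose f' := GRing.isLinear.Build _ _ _ _ (snd : R * R -> R) fl.
pose f : {linear (R * R)%type -> R} := HB.pack (snd : (R * R)%type -> R) f'.
by apply: (@linear_differentiable _ _ _ f) => x; exact: cvg_snd.
Qed.

Lemma tensor_continuous f g : continuous f -> continuous g -> continuous (tensor f g).
Proof.
move=> cf cg z; apply: cvgM.
  by apply: (@continuous_comp _ _ _ fst f); [exact: cvg_fst|exact: cf].
by apply: (@continuous_comp _ _ _ snd g); [exact: cvg_snd|exact: cg].
Qed.

Lemma tensor_differentiable f g (f' g' : R -> R) :
  (forall x : R, is_derive x 1 f (f' x)) -> (forall x : R, is_derive x 1 g (g' x)) ->
  forall z, differentiable (tensor f g) z.
Proof.
move=> hf hg z; apply: differentiableM.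
  apply: (@differentiable_comp _ _ _ _ fst f); first exact: differentiable_fst.
  by apply/derivable1_diffP; have [] := hf z.1.
apply: (@differentiable_comp _ _ _ _ snd g); first exact: differentiable_snd.
by apply/derivable1_diffP; have [] := hg z.2.
Qed.

Lemma tensor_derive_ex f g (f' : R -> R) : (forall x : R, is_derive x 1 f (f' x)) ->
  'D_ex (tensor f g) = tensor f' g.
Proof.
move=> hf; apply/funext => -[x y]; rewrite /tensor/=.
have : is_derive x 1 (fun t => f t * g y) (f' x * g y).
  by have := hf x => ?; apply: is_derive_eq => //; rewrite /GRing.scale/= ?mulr0 ?add0r mulrC.
move=> [_ <-]; rewrite /derive.
suff -> : (fun h : R => h^-1 *: (((fun z : R * R => f z.1 * g z.2) \o shift (x, y)) (h *: ex) - (fun z : R * R => f z.1 * g z.2) (x, y))) =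
  (fun h : R => h^-1 *: (((fun t => f t * g y) \o shift x) (h *: 1) - (fun t => f t * g y) x)) by [].
by apply/funext => h; rewrite /shift /ex /ey /= scaler0 add0r.
Qed.

Lemma tensor_derive_ey f g (g' : R -> R) : (forall x : R, is_derive x 1 g (g' x)) ->
  'D_ey (tensor f g) = tensor f g'.
Proof.
move=> hg; apply/funext => -[x y]; rewrite /tensor/=.
have : is_derive y 1 (fun t => f x * g t) (f x * g' y).
  by have := hg y => ?; apply: is_derive_eq => //; rewrite /GRing.scale/= mulr0 addr0.
move=> [_ <-]; rewrite /derive.
suff -> : (fun h : R => h^-1 *: (((fun z : R * R => f z.1 * g z.2) \o shift (x, y)) (h *: ey) - (fun z : R * R => f z.1 * g z.2) (x, y))) =
  (fun h : R => h^-1 *: (((fun t => f x * g t) \o shift y) (h *: 1) - (fun t => f x * g t) y)) by [].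
by apply/funext => h; rewrite /shift /ex /ey /= scaler0 add0r.
Qed.

Lemma tensor_Ck k f g : smooth f -> smooth g -> Ck k (tensor f g).
Proof.
elim: k f g => [|k ih] f g sf sg /=.
  by apply: tensor_continuous; exact: smooth_continuous.
have [f' sf' hf] := smooth_derive sf; have [g' sg' hg] := smooth_derive sg.
split; first exact: tensor_differentiable hf hg.
  by rewrite (tensor_derive_ex _ hf); exact: ih.
by rewrite (tensor_derive_ey _ hg); exact: ih.
Qed.

Lemma tensor_test f g : bsmooth f -> bsmooth g -> test_function (tensor f g).
Proof.
move=> [sf [M fM]] [sg [N gN]]; split; first by move=> k; exact: tensor_Ck.
have cK : compact ((`[- `|M|, `|M|]%classic : set R) `*` (`[- `|N|, `|N|]%classic : set R)).
  by apply: compact_setX; exact: segment_compact.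
apply: (subclosed_compact _ cK); first exact: closed_closure.
have cl := compact_closed (@norm_hausdorff _ (R * R)%type) cK.
rewrite [X in _ `<=` X]((closure_id _).1 cl); apply: closure_subset => -[x y] /= h; split => /=.
  rewrite in_itv/= -ler_norml leNgt; apply: contra h => Mx.
  by rewrite /tensor/= fM ?mul0r// (le_lt_trans _ Mx)// ler_norm.
rewrite in_itv/= -ler_norml leNgt; apply: contra h => Nx.
by rewrite /tensor/= gN ?mulr0// (le_lt_trans _ Nx)// ler_norm.
Qed.

End test_functions.

(** * Density of tensor products in L^2 *)

Section density.
Context {R : realType}.
Local Notation leb1 := (@lebesgue_measure R).
Local Notation mu2 := (@lebesgue_measure R \x @lebesgue_measure R)%E.
Implicit Types (a b c : R) (K : set R).

Lemma rint_indic_itv (b0 b1 : bool) a b :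
  rint leb1 (\1_[set` Interval (BSide b0 a) (BSide b1 b)] : R -> R).
Proof. exact: integrable_indic_itv. Qed.

Lemma L2_tensor_le (B : R) (h1 h2 f1 f2 : R -> R) : rint leb1 h1 -> rint leb1 h2 ->
  measurable_fun setT (f1 : measurableTypeR R -> R) ->
  measurable_fun setT (f2 : measurableTypeR R -> R) ->
  (forall x, `|f1 x| ^+ 2 <= h1 x) -> (forall x, `|f2 x| ^+ 2 <= h2 x) ->
  L2 mu2 (fun z => f1 z.1 * f2 z.2).
Proof.
move=> i1 i2 m1 m2 le1 le2.
have mf : measurable_fun setT (fun z : measurableTypeR R * measurableTypeR R => f1 z.1 * f2 z.2).
  by apply: measurable_funM; apply: measurableT_comp.
split => //; apply: (rint_le mu2 (fun z => h1 z.1 * h2 z.2)).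
- exact: measurable_funX.
- exact: rint_tensor.
- by move=> z; rewrite exprMn normrM !normrX ler_pM.
Qed.

Lemma indic_le1 K x : `|\1_K x : R| ^+ 2 <= \1_K x.
Proof. by rewrite indicE; case: (_ \in _); rewrite ?normr1 ?expr1n// normr0 expr0n. Qed.

Lemma L2_rect (b0 b1 b2 b3 : bool) a b c d :
  L2 mu2 (fun z => \1_[set` Interval (BSide b0 a) (BSide b1 b)] z.1 *
    \1_[set` Interval (BSide b2 c) (BSide b3 d)] z.2).
Proof.
apply: (L2_tensor_le 0 (rint_indic_itv b0 b1 a b) (rint_indic_itv b2 b3 c d)).
- exact: measurable_indic.
- exact: measurable_indic.
- by move=> x; exact: indic_le1.
- by move=> x; exact: indic_le1.
Qed.

Lemma bsmooth_le (f : R -> R) : bsmooth f ->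
  exists M N : R, forall x, `|f x| <= M * \1_(`[- N, N]%classic : set R) x.
Proof.
move=> /[dup] /bsmooth_bounded [M fM] [_ [N fN]]; exists M, N => x.
have E : (x \in `[- N, N]%classic) = (`|x| <= N) by rewrite mem_setE in_itv/= ler_norml.
rewrite indicE E; have [h|/fN ->] := leP `|x| N; last by rewrite normr0 mulr0.
exact: le_trans (fM x) (eq_ler (esym (mulr1 M))).
Qed.

Lemma bsmooth_rint (f : R -> R) : bsmooth f -> rint leb1 f.
Proof.
move=> bf; have [M [N h]] := bsmooth_le bf.
apply: (rint_le leb1 (fun x => M * \1_(`[- N, N]%classic : set R) x)) => //.
- exact: bsmooth_measurable.
- by apply: rintZ; exact: rint_indic_itv.
Qed.

Lemma bsmooth_tensor_le (f g : R -> R) : bsmooth f -> bsmooth g ->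
  exists M N N' : R, forall z : R * R, `|tensor f g z| <=
    M * (\1_(`[- N, N]%classic : set R) z.1 * \1_(`[- N', N']%classic : set R) z.2).
Proof.
move=> /bsmooth_le [M [N h]] /bsmooth_le [M' [N' h']].
exists (M * M'), N, N' => z; rewrite /tensor normrM mulrACA.
exact: ler_pM.
Qed.

Lemma tensor_measurable (f g : R -> R) : bsmooth f -> bsmooth g ->
  measurable_fun setT (tensor f g : measurableTypeR R * measurableTypeR R -> R).
Proof.
move=> bf bg; apply: measurable_funM; apply: measurableT_comp => //; exact: bsmooth_measurable.
Qed.

Lemma tensor_L2 (f g : R -> R) : bsmooth f -> bsmooth g -> L2 mu2 (tensor f g).
Proof.
move=> bf bg; have [M [N [N' h]]] := bsmooth_tensor_le bf bg.
apply: (L2_le mu2 (fun z => M * (\1_(`[- N, N]%classic : set R) z.1 * \1_(`[- N', N']%classic : set R) z.2))).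
- exact: tensor_measurable.
- by apply: L2Z; exact: L2_rect.
- by move=> z; rewrite (le_trans (h z))// ler_norm.
Qed.

Variable Z : (R * R -> R) -> Prop.
Hypothesis ZD : forall f g a, L2 mu2 f -> L2 mu2 g -> Z f -> Z g ->
  Z (fun z => f z + a * g z).
Hypothesis ZC : forall (fs : nat -> R * R -> R) f, (forall n, L2 mu2 (fs n)) ->
  L2 mu2 f -> (forall n, Z (fs n)) -> cvg2 mu2 fs f -> Z f.
Hypothesis ZT : forall f g, bsmooth f -> bsmooth g -> Z (tensor f g).

Let Z0 : Z (fun=> 0).
Proof.
have bb := bumpn_bsmooth 0 (0 : R) 1.
rewrite (_ : (fun=> _) = (fun z => tensor (bumpn 0 0 1) (bumpn 0 0 1) z
  + - 1 * tensor (bumpn 0 0 1) (bumpn 0 0 1) z)).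
  by apply: ZD; [exact: tensor_L2|exact: tensor_L2|exact: ZT|exact: ZT].
by apply/funext => z; rewrite mulN1r subrr.
Qed.

Let ZZ a f : L2 mu2 f -> Z f -> Z (fun z => a * f z).
Proof.
move=> lf zf; rewrite (_ : (fun z => _) = (fun z => 0 + a * f z)).
  by apply: ZD => //; exact: L20.
by apply/funext => z; rewrite add0r.
Qed.

(** The tensor products of [bumpn] converge to this indicator and are dominated by it. *)
Let Zoo a b c d : Z (fun z => \1_(`]a, b[%classic) z.1 * \1_(`]c, d[%classic) z.2).
Proof.
apply: (ZC (fs := fun n => tensor (bumpn n a b) (bumpn n c d))).
- by move=> n; apply: tensor_L2; exact: bumpn_bsmooth.
- exact: L2_rect.
- by move=> n; apply: ZT; exact: bumpn_bsmooth.
have B n (x y t : R) : `|bumpn n x y t| <= \1_(`]x, y[%classic) t.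
  rewrite indicE mem_setE in_itv/=; case: (boolP (x < t < y)) => [_|h]; last by rewrite bumpn_eq0// normr0.
  by have /andP[h1 h2] := bumpn_itv n x y t; rewrite ger0_norm.
apply: (L2_dct mu2 _ _ (fun z => \1_(`]a, b[%classic) z.1 * \1_(`]c, d[%classic) z.2) _ _ _ _ _).2.
- by move=> n; apply: tensor_measurable; exact: bumpn_bsmooth.
- by apply: L2_measurable; exact: L2_rect.
- exact: L2_rect.
- by move=> n z; rewrite /tensor normrM [leRHS]ger0_norm// ler_pM.
- by apply: aeW => z; apply: cvgM; exact: bumpn_cvg.
Qed.

Let oc_cvg a b x : (fun n => \1_(`]a, b + n.+1%:R^-1[%classic : set R) x : R) @ \oo -->
  (\1_(`]a, b]%classic : set R) x : R).
Proof.
rewrite [X in _ --> X]indicE mem_setE in_itv/=.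
have [ax|xa] := ltP a x; last first.
  apply: (@eq_cvgn _ _ (fun=> 0)); last exact: cvg_cst.
  by move=> n; rewrite indicE mem_setE in_itv/= ltNge xa.
have [xb|bx] := leP x b.
  apply: (@eq_cvgn _ _ (fun=> 1)); last exact: cvg_cst.
  by move=> n; rewrite indicE mem_setE in_itv/= ax/= (le_lt_trans xb)// ltrDl.
apply: cvg_near_cst.
have : \forall n \near \oo, (n.+1%:R^-1 : R) < x - b.
  by apply: (cvgr_lt _ (@cvg_harmonic R)); rewrite subr_gt0.
apply: filterS => n h; rewrite indicE mem_setE in_itv/= ax/= ltNge ltW//.
by rewrite -ltrBrDl.
Qed.

(** Half-open intervals form an intersection-stable class generating the Borel sets, as Dynkin's
    argument below requires; open intervals with right end [b + 1/(n+1)] decrease to them. *)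
Let Zoc a b c d : Z (fun z => \1_(`]a, b]%classic) z.1 * \1_(`]c, d]%classic) z.2).
Proof.
apply: (ZC (fs := fun n z => \1_(`]a, b + n.+1%:R^-1[%classic) z.1 * \1_(`]c, d + n.+1%:R^-1[%classic) z.2)).
- by move=> n; exact: L2_rect.
- exact: L2_rect.
- by move=> n; exact: Zoo.
have B n (x y t : R) : `|\1_(`]x, y + n.+1%:R^-1[%classic : set R) t : R| <= \1_(`]x, y + 1]%classic : set R) t.
  rewrite ger0_norm// !indicE !mem_setE !in_itv/= ler_nat; case: (x < t) => //=.
  have [h|//] := ltP t (y + _); rewrite (_ : t <= y + 1)//.
  by rewrite (le_trans (ltW h))// lerD2l invf_le1// ler1n.
apply: (L2_dct mu2 _ _ (fun z => \1_(`]a, b + 1]%classic) z.1 * \1_(`]c, d + 1]%classic) z.2) _ _ _ _ _).2.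
- by move=> n; apply: L2_measurable; exact: L2_rect.
- by apply: L2_measurable; exact: L2_rect.
- exact: L2_rect.
- by move=> n z; rewrite normrM [leRHS]ger0_norm// ler_pM.
- by apply: aeW => z; apply: cvgM; exact: oc_cvg.
Qed.

Let bounded_indic d (S : measurableType d) (A : set S) x : `|\1_A x : R| <= 1.
Proof. by rewrite indicE; case: (_ \in _); rewrite ?normr1// normr0. Qed.

(** For fixed [g], the sets [A] for which [Z] holds of [g] times the indicator of [A] along [p] form
    a Dynkin system: complements by linearity, disjoint unions as dominated limits of finite ones.
    With [p] a projection or the identity, the same argument serves each variable and then the
    plane. *)
Let dyn d (S : measurableType d) (p : R * R -> S) (G : set (set S)) (g : R * R -> R) :
  measurable_fun setT (p : measurableTypeR R * measurableTypeR R -> S) ->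
  @measurable _ S = <<s G >> -> setI_closed G -> L2 mu2 g -> Z g ->
  (forall A, G A -> Z (fun z => g z * \1_A (p z))) ->
  forall A, measurable A -> Z (fun z => g z * \1_A (p z)).
Proof.
move=> mp GE GI lg zg zG A; rewrite GE => mA.
have L B : measurable B -> L2 mu2 (fun z => g z * \1_B (p z)).
  move=> mB; under eq_fun do rewrite mulrC.
  apply: (L2_bounded mu2 1) => //; last by move=> z; exact: bounded_indic.
  by apply: measurableT_comp mp; exact: measurable_indic.
pose P := [set B : set S | Z (fun z => g z * \1_B (p z))].
apply: (@dynkin_induction _ S G P) => //.
- by rewrite /P/=; under eq_fun do rewrite indicT mulr1.
- move=> B mB zB; rewrite /P/=.
  rewrite (_ : (fun z => _) = (fun z => g z + (-1) * (g z * \1_B (p z)))).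
    by apply: ZD => //; exact: L.
  by apply/funext => z; rewrite indicC indicE; case: (_ \in _); rewrite /=; ring.
move=> F mF tF zF; rewrite /P/=.
pose U n := \big[setU/set0]_(i < n) F i.
have mU n : measurable (U n) by exact: bigsetU_measurable.
have mUF : measurable (\bigcup_k F k) by exact: bigcup_measurable.
apply: (ZC (fs := fun n z => g z * \1_(U n) (p z))).
- by move=> n; exact: L.
- exact: L.
- elim => [|n ih].
    rewrite (_ : (fun z => _) = fun=> 0)//; apply/funext => z.
    by rewrite /U big_ord0 indic0 mulr0.
  rewrite (_ : (fun z => _) = (fun z => g z * \1_(U n) (p z) + 1 * (g z * \1_(F n) (p z)))).
    by apply: ZD => //; [exact: L|exact: L|exact: zF].
  apply/funext => z; rewrite /U big_ord_recr/= mul1r -mulrDr; congr (_ * _).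
  rewrite !indicE in_setU.
  case: (boolP (p z \in \big[setU/set0]_(i < n) F i)) => //= h; last by rewrite add0r.
  rewrite (_ : (p z \in F n) = false) ?addr0//; apply/negbTE/negP => /set_mem hn.
  move: h => /set_mem; rewrite -bigcup_mkord => -[k /= kn hk].
  have := (trivIsetP.1 tF) k n I I; rewrite neq_ltn kn => /(_ isT).
  by apply/eqP/set0P; exists (p z).
apply: (L2_dct mu2 _ _ g _ _ _ _ _).2 => //.
- by move=> n; exact: L2_measurable (L _ (mU n)).
- exact: L2_measurable (L _ mUF).
- by move=> n z; rewrite normrM ler_piMr.
- apply: aeW => z; apply: cvgM; first exact: cvg_cst.
  rewrite [X in _ --> X]indicE; case: (boolP (p z \in _)) => h; last first.
    apply: (@eq_cvgn _ _ (fun=> 0)); last exact: cvg_cst.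
    move=> n; rewrite indicE (_ : _ \in _ = false)//; apply/negbTE; apply: contra h => /set_mem.
    by rewrite /U -bigcup_mkord => -[k _ hk]; apply/mem_set; exists k.
  move: h => /set_mem [k _ hk]; apply: cvg_near_cst.
  exists k.+1 => // n /= kn; rewrite indicE mem_set// /U -bigcup_mkord.
  by exists k.
Qed.

(** A bounded cut-off keeps the indicators of unbounded Borel sets in L^2; it is half-open so that
    its intersection with a generator is again one. *)
Let K n := (`]- n%:R, n%:R]%classic : set R).
Let box2 n (z : R * R) : R := \1_(K n) z.1 * \1_(K n) z.2.

Let L2_box n : L2 mu2 (box2 n). Proof. exact: L2_rect. Qed.

Let L2_boxM n (b : R * R -> R) :
  measurable_fun setT (b : measurableTypeR R * measurableTypeR R -> R) ->
  (forall z, `|b z| <= 1) -> L2 mu2 (fun z => box2 n z * b z).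
Proof.
move=> mb b1; under eq_fun do rewrite mulrC; exact: (L2_bounded mu2 1).
Qed.

Let Zbox1 n a b A : measurable (A : set (measurableTypeR R)) ->
  Z (fun z => \1_(K n) z.1 * \1_(`]a, b]%classic) z.2 * \1_A z.1).
Proof.
move=> mA; pose g (z : R * R) : R := \1_(K n) z.1 * \1_(`]a, b]%classic) z.2.
refine (@dyn _ (measurableTypeR R) fst (@ocitv R) g _ _ _ _ _ _ A mA) => //.
- exact: ocitvI.
- exact: L2_rect.
- exact: Zoc.
move=> B oB.
have [[c d] _ cdE] : ocitv (K n `&` B) by apply: ocitvI; [exact: is_ocitv|exact: oB].
rewrite (_ : (fun z => _) = (fun z => \1_(`]c, d]%classic) z.1 * \1_(`]a, b]%classic) z.2)).
  exact: Zoc.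
by move: cdE => /= cdE; apply/funext => z; rewrite cdE indicI /g/=; ring.
Qed.

Let Zbox2 n A B : measurable (A : set (measurableTypeR R)) ->
  measurable (B : set (measurableTypeR R)) ->
  Z (fun z => box2 n z * \1_A z.1 * \1_B z.2).
Proof.
move=> mA mB; pose g (z : R * R) : R := box2 n z * \1_A z.1.
refine (@dyn _ (measurableTypeR R) snd (@ocitv R) g _ _ _ _ _ _ B mB) => //.
- exact: ocitvI.
- apply: L2_boxM; last by move=> z; exact: bounded_indic.
  have mA' : measurable_fun setT (\1_A : measurableTypeR R -> R) by exact: measurable_indic.
  exact: (measurableT_comp mA' measurable_fst).
- exact: Zbox1.
move=> C oC.
have [[c d] _ cdE] : ocitv (K n `&` C) by apply: ocitvI; [exact: is_ocitv|exact: oC].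
rewrite (_ : (fun z => _) = (fun z => \1_(K n) z.1 * \1_(`]c, d]%classic) z.2 * \1_A z.1)).
  exact: Zbox1.
by move: cdE => /= cdE; apply/funext => z; rewrite cdE indicI /g/box2/=; ring.
Qed.

(** A third use of [dyn], on the plane, with measurable rectangles as generators; the first two
    replaced one interval at a time by a Borel set. *)
Let Zbox n C : measurable (C : set (measurableTypeR R * measurableTypeR R)) ->
  Z (fun z => box2 n z * \1_C z).
Proof.
move=> mC; apply: (@dyn _ (measurableTypeR R * measurableTypeR R)%type id
  [set A `*` B | A in measurable & B in measurable] (box2 n)) => //.
- exact: measurable_prod_measurableType.
- move=> _ _ [A mA [B mB <-]] [A' mA' [B' mB' <-]].
  exists (A `&` A'); first exact: measurableI.
  by exists (B `&` B'); [exact: measurableI|rewrite setXI].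
- exact: Zoc.
move=> _ [A mA [B mB <-]].
rewrite (_ : (fun z => _) = (fun z => box2 n z * \1_A z.1 * \1_B z.2)); first exact: Zbox2.
by apply/funext => z; rewrite -mulrA; congr (_ * _); rewrite !indicE in_setX natrM_bool || (rewrite !indicE in_setX; do 2 case: (_ \in _); rewrite /= ?mulr1 ?mulr0).
Qed.

Let Zsum (I : Type) (s : seq I) (h : I -> R * R -> R) :
  (forall i, L2 mu2 (h i)) -> (forall i, Z (h i)) ->
  Z (fun z => \sum_(i <- s) h i z) /\ L2 mu2 (fun z => \sum_(i <- s) h i z).
Proof.
move=> lh zh; elim: s => [|i s [ih1 ih2]].
  by under eq_fun do rewrite big_nil; split => //; exact: L20.
under eq_fun do rewrite big_cons; split; last exact: L2D.
under eq_fun do rewrite -[X in _ + X]mul1r; exact: ZD.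
Qed.

Import HBNNSimple.

Let box_cvg z : (fun n => box2 n z) @ \oo --> (1 : R).
Proof.
apply: cvg_near_cst; near=> n.
have h : (`|z.1| < n%:R) && (`|z.2| < n%:R).
  by apply/andP; split; near: n; apply: nbhs_infty_gtr.
have /andP[] := h; rewrite !ltr_norml => /andP[a1 a2] /andP[b1 b2].
by rewrite /box2 !indicE !mem_set ?mulr1// /K/= in_itv/= ?a1 ?b1/= ltW.
Unshelve. all: by end_near. Qed.

(** Simple functions increase to [f]; cut to a box they are finite combinations of the indicators
    already treated, and [f] dominates them. *)
Let Znn f : L2 mu2 f -> (forall z, 0 <= f z) -> Z f.
Proof.
move=> lf f0.
have mf : measurable_fun setT (EFin \o f : measurableTypeR R * measurableTypeR R -> \bar R).
  by apply/measurable_EFinP; exact: L2_measurable lf.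
pose h := nnsfun_approx measurableT mf.
have h0 n z : 0 <= h n z by [].
have hle n z : h n z <= f z.
  rewrite -lee_fin /h nnsfun_approxE; apply: le_approx => // x _; by rewrite lee_fin.
have hc z : (fun n => h n z) @ \oo --> f z.
  have f0' (x : measurableTypeR R * measurableTypeR R) : setT x -> (0 <= (EFin \o f) x)%E.
    by move=> _; rewrite lee_fin.
  by have /fine_cvg := @cvg_nnsfun_approx _ _ _ _ measurableT _ mf f0' z I.
have mh n : measurable_fun setT (h n : measurableTypeR R * measurableTypeR R -> R) by [].
have box01 n z : 0 <= box2 n z <= 1.
  by rewrite /box2 !indicE; do 2 case: (_ \in _); rewrite /= ?mulr1 ?mulr0 ?lexx ?ler01.
have mbox n : measurable_fun setT (box2 n : measurableTypeR R * measurableTypeR R -> R).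
  exact: L2_measurable (L2_box n).
have le n z : `|box2 n z * h n z| <= `|f z|.
  have /andP[b0 b1] := box01 n z.
  rewrite normrM (ger0_norm b0) !ger0_norm// (le_trans _ (hle n z))//.
  exact: ler_piMl.
have LF n : L2 mu2 (fun z => box2 n z * h n z).
  by apply: (L2_le mu2 f) => //; exact: measurable_funM.
apply: (ZC (fs := fun n z => box2 n z * h n z)) => //.
  move=> n.
  have E : (fun z => box2 n z * h n z) =
    fun z => \sum_(y <- fset_set (range (h n))) (y * (box2 n z * \1_((h n) @^-1` [set y]) z)).
    apply/funext => z; rewrite fimfunE fsbig_finite//= big_distrr/=.
    by apply: eq_bigr => y _; ring.
  rewrite E; apply: (Zsum _ _ _).1.
  - move=> y; apply: L2Z; apply: L2_boxM; last by move=> z; exact: bounded_indic.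
    exact: measurable_indic.
  - move=> y; apply: ZZ; last by apply: Zbox; exact: measurable_sfunP.
    apply: L2_boxM; last by move=> z; exact: bounded_indic.
    exact: measurable_indic.
apply: (L2_dct mu2 _ _ f _ _ _ _ _).2 => //.
- by move=> n; exact: measurable_funM.
- exact: L2_measurable lf.
- apply: aeW => z; rewrite -[X in _ --> X]mul1r.
  by apply: cvgM; [exact: box_cvg|exact: hc].
Qed.

(** Density in the form of an induction principle: a property stable under linear combinations and
    L^2 limits has to be checked only on tensor products of smooth compactly supported functions. *)
Lemma L2_density f : L2 mu2 f -> Z f.
Proof.
move=> lf.
have mf := L2_measurable lf.
have lp : L2 mu2 (fun z => Num.max (f z) 0).
  apply: (L2_le mu2 f) => //; first by apply: measurable_maxr.
  by move=> z; rewrite /Num.max; case: ifP => // _; rewrite normr0.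
have ln : L2 mu2 (fun z => Num.max (- f z) 0).
  apply: (L2_le mu2 f) => //; first by apply: measurable_maxr => //; exact: measurableT_comp.
  by move=> z; rewrite /Num.max; case: ifP => _; rewrite ?normr0 ?normrN.
rewrite (_ : f = (fun z => Num.max (f z) 0 + (-1) * Num.max (- f z) 0)).
  by apply: ZD => //; apply: Znn => // z; rewrite le_max lexx orbT.
apply/funext => z; rewrite mulN1r; have [h|h] := leP (f z) 0.
  by rewrite max_l ?opprK ?add0r// oppr_ge0.
by rewrite max_r ?subr0// oppr_le0 ltW.
Qed.

End density.

(** * Explicit integrals over the line *)

Section half_line.
Context {R : realType}.
Local Notation leb1 := (@lebesgue_measure R).
Implicit Types (F f : R -> R) (x s e : R).

(** The Heaviside function: a half line enters as a factor of the integrand rather than as a domain,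
    so that the lemmas about integrals over the whole line apply. *)
Definition hv x : R := (0 < x)%R%:R.

Lemma hv_measurable : measurable_fun setT (hv : measurableTypeR R -> R).
Proof.
rewrite (_ : hv = \1_(`]0, +oo[%classic : set R)); first exact: measurable_indic.
by apply/funext => x; rewrite indicE mem_setE in_itv/= andbT.
Qed.

Lemma hv_le1 x : `|hv x| <= 1.
Proof. by rewrite /hv; case: (0 < x); rewrite ?normr1// normr0. Qed.

Lemma ae_neq0 : {ae leb1, forall x, x != 0}.
Proof.
exists [set 0 : R]; split => //; first exact: lebesgue_measure_set1.
by move=> x /= /negP/negbNE/eqP.
Qed.

Lemma Rint_fold F : rint leb1 F ->
  \int[leb1]_x F x = \int[leb1]_x (hv x * (F x + F (- x))).
Proof.
move=> iF.
have mF := rint_measurable iF.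
have i1 : rint leb1 (fun x : R => hv x * F x).
  exact: (rint_bounded leb1 1 hv_measurable hv_le1).
have i2 : rint leb1 (fun x : R => hv x * F (- x)).
  apply: (rint_bounded leb1 1 hv_measurable hv_le1).
  exact: (mpc_rint mpc_opp iF).
have i3 := mpc_rint mpc_opp i2.
transitivity (\int[leb1]_x (hv x * F x + hv (- x) * F x)).
  apply: Rintegral_ae => //.
    by apply: measurable_funD; [exact: rint_measurable i1|];
      have := rint_measurable i3; rewrite /comp/=; under eq_fun do rewrite opprK.
  apply: aeS ae_neq0 => x x0; rewrite /hv oppr_gt0.
  by case: ltgtP x0 => // _ _; rewrite mul1r mul0r ?addr0 ?add0r.
rewrite RintegralD//; last first.
  by have := i3; rewrite /comp/=; under eq_fun do rewrite opprK.
under [RHS]eq_Rintegral do rewrite mulrDr.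
rewrite RintegralD//; congr (_ + _).
rewrite -[RHS]mul1r -(mpc_Rintegral mpc_opp i2).
by apply: eq_Rintegral => x _; rewrite opprK.
Qed.

Lemma FTC2 f F (a b : R) : a < b -> (forall x : R, is_derive x 1 F (f x)) ->
  continuous f -> \int[leb1]_(x in `[a, b]) f x = F b - F a.
Proof.
move=> ab dF cf; rewrite /Rintegral (@continuous_FTC2 _ f F)//.
- exact: continuous_subspaceT.
- have cF := is_derive_continuous dF.
  split.
  + by move=> x _; have [] := dF x.
  + by apply: cvg_at_right_filter; exact: cF.
  + by apply: cvg_at_left_filter; exact: cF.
- by move=> x _; rewrite derive1E; have [] := dF x.
Qed.

(** The fundamental theorem of calculus on [[0, n]], with [n -> oo] by dominated convergence. *)
Lemma FTC_half f F (l : R) : (forall x : R, is_derive x 1 F (f x)) -> continuous f ->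
  rint leb1 (fun x => hv x * f x) -> (fun n : nat => F n%:R) @ \oo --> l ->
  \int[leb1]_x (hv x * f x) = l - F 0.
Proof.
move=> dF cf iF cF.
pose I n x : R := \1_(`]0, n%:R]%classic) x.
have mI n : measurable_fun setT (I n : measurableTypeR R -> R) by exact: measurable_indic.
have mf : measurable_fun setT (f : measurableTypeR R -> R) by exact: continuous_measurable_fun.
have le n x : `|I n x * f x| <= `|hv x * f x|.
  rewrite !normrM ler_wpM2r// /I /hv indicE mem_setE in_itv/=.
  by case: (0 < x) => /=; rewrite ?normr1 ?normr0//; case: (x <= _); rewrite ?normr1 ?normr0.
have cv : {ae leb1, forall x, (fun n => I n x * f x) @ \oo --> hv x * f x}.
  apply: aeW => x; apply: cvgM; last exact: cvg_cst.
  rewrite /hv; have [x0|x0] := ltP 0 x; last first.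
    apply: (@eq_cvgn _ _ (fun=> 0)); last exact: cvg_cst.
    by move=> n; rewrite /I indicE mem_setE in_itv/= ltNge x0.
  apply: cvg_near_cst; near=> n.
  rewrite /I indicE mem_setE in_itv/= x0/= (_ : x <= n%:R)//.
  by near: n; apply: nbhs_infty_ger.
have [_ h] := dct leb1 _ _ _ (fun n => measurable_funM (mI n) mf) (rint_norm iF) le cv
  (rint_measurable iF).
have : (fun n => \int[leb1]_x (I n x * f x)) @ \oo --> l - F 0.
  (* The shift makes the interval [[0, n + 1]] nondegenerate, as [FTC2] asks. *)
  rewrite -cvg_shiftS.
  apply: (@eq_cvgn _ _ (fun n => F n.+1%:R - F 0)); last first.
    by apply: cvgB; [rewrite (cvg_shiftS (fun n => F n%:R))|exact: cvg_cst].
  move=> n; rewrite -(@FTC2 f F 0 n.+1%:R)// ?ltr0n//.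
  rewrite [RHS]/Rintegral -integral_itv_obnd_cbnd; last first.
    by apply/measurable_EFinP; exact: measurable_funTS.
  rewrite -/(Rintegral _ _ _) Rintegral_mkcond; apply: eq_Rintegral => x _.
  by rewrite patchE /I indicE; case: ifP => _; rewrite ?mul1r ?mul0r.
by move/cvg_lim => <- //; apply/esym/cvg_lim.
Unshelve. all: by end_near. Qed.

(** The mass [pi] is what normalises the Poisson kernel in Plancherel's identity; the same function
    also dominates exponentials and inverse Sobolev weights. *)
Lemma rint_oneDsqrV : rint leb1 (fun x => (1 + x ^+ 2)^-1) /\
  \int[leb1]_x (1 + x ^+ 2)^-1 = pi.
Proof.
have E := @integral0y_oneDsqr R.
have mf : measurable_fun setT (fun x : measurableTypeR R => (1 + x ^+ 2)^-1 : R).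
  by apply: continuous_measurable_fun; exact: continuous_oneDsqrV.
have p0 x : 0 <= (1 + x ^+ 2)^-1 :> R by rewrite invr_ge0 addr_ge0// sqr_ge0.
have h x : (hv x * (1 + x ^+ 2)^-1)%:E = ((fun x : R => ((1 + x ^+ 2)^-1)%:E) \_ (`]0, +oo[%classic : set R)) x :> \bar R.
  by rewrite patchE /hv mem_setE in_itv/= andbT; case: (0 < x); rewrite ?mul1r ?mul0r.
have Eh : (\int[leb1]_x (hv x * (1 + x ^+ 2)^-1)%:E = (pi / 2)%:E)%E.
  under eq_integral do rewrite h.
  rewrite -integral_mkcond integral_itv_obnd_cbnd//.
  by apply/measurable_EFinP; exact: measurable_funTS.
have ih : rint leb1 (fun x => hv x * (1 + x ^+ 2)^-1).
  apply: rint_lty; first by apply: measurable_funM => //; exact: hv_measurable.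
  under eq_integral do rewrite ger0_norm ?mulr_ge0// ?ler0n//.
  by rewrite Eh ltry.
have ih2 := mpc_rint mpc_opp ih.
have i : rint leb1 (fun x => (1 + x ^+ 2)^-1).
  apply: (rint_ae mf _ (rintD ih ih2)).
  apply: aeS ae_neq0 => x x0; rewrite /= /hv oppr_gt0 sqrrN.
  by case: ltgtP x0 => // _ _; rewrite mul1r mul0r ?addr0 ?add0r.
split => //; rewrite (Rint_fold i).
under eq_Rintegral do rewrite sqrrN -mulr2n -mulr_natl mulrCA.
by rewrite RintegralZl// {1}/Rintegral Eh/= mulrC divfK.
Qed.

Lemma rint_expN e : 0 < e -> rint leb1 (fun x => expR (- (e * `|x|))).
Proof.
move=> e0; have [i _] := rint_oneDsqrV.
have mf : measurable_fun setT (fun x : measurableTypeR R => expR (- (e * `|x|)) : R).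
  apply: measurableT_comp => //; apply: measurableT_comp => //.
  by apply: measurable_funM => //; exact: measurableT_comp.
(* With [exp(y) >= 1 + y^2 / 2] at [y = e |x|], this constant gives [1 + x^2 <= C exp(e |x|)]. *)
pose C := 1 + 2 / e ^+ 2.
have C0 : 0 < C by rewrite addr_gt0// divr_gt0// exprn_gt0.
apply: (rint_le leb1 (fun x => C * (1 + x ^+ 2)^-1) mf); first exact: rintZ.
move=> x; rewrite ger0_norm ?expR_ge0// expRN -[C]invrK -invfM.
have p1 : 0 < 1 + x ^+ 2 by rewrite ltr_wpDr// sqr_ge0.
rewrite lef_pV2 ?posrE ?expR_gt0 ?mulr_gt0 ?invr_gt0//.
apply: le_trans (expR_ge1Dxn 1 (mulr_ge0 (ltW e0) (normr_ge0 x))).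
rewrite ler_pdivrMl// exprMn real_normK ?num_real// /C.
rewrite (_ : 2`!%:R = 2 :> R)//.
rewrite [leRHS](_ : _ = 1 + x ^+ 2 + 2 / e ^+ 2 + e ^+ 2 * x ^+ 2 / 2); last first.
  by field; rewrite gt_eqF.
rewrite -[leRHS]addrA lerDl; apply: addr_ge0; apply: divr_ge0 => //; last first.
  by apply: mulr_ge0; exact: sqr_ge0.
exact: sqr_ge0.
Qed.

Lemma expN_cvg0 e : 0 < e -> (fun n : nat => expR (- (e * n%:R))) @ \oo --> (0 : R).
Proof.
move=> e0; apply: (@eq_cvgn _ _ (fun n => expR (- e) ^+ n)).
  by move=> n; rewrite -expRM_natl mulrN mulrC.
by apply: cvg_expr; rewrite ger0_norm ?expR_ge0// expR_lt1 oppr_lt0.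
Qed.

Section half_integrals.
Variables (e s : R).
Hypothesis e0 : 0 < e.

Let half_rint (g : R -> R) : measurable_fun setT (g : measurableTypeR R -> R) ->
  (forall x, `|g x| <= 1) -> rint leb1 (fun x => hv x * (expR (- (e * x)) * g x)).
Proof.
move=> mg g1; have i := rint_bounded leb1 1 hv_measurable hv_le1 (rint_bounded leb1 1 mg g1 (rint_expN e0)).
rewrite (_ : (fun x => _) = (fun x => hv x * (g x * expR (- (e * `|x|)))))//.
apply/funext => x; rewrite /hv; case: ltP => [x0|_]; last by rewrite !mul0r.
by rewrite gtr0_norm// !mul1r mulrC.
Qed.

Let half_cvg (g : R -> R) (M : R) : (forall x, `|g x| <= M) ->
  (fun n : nat => expR (- (e * n%:R)) * g n%:R) @ \oo --> (0 : R).
Proof.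
move=> gM; apply/norm_cvg0P; apply: (@squeeze0 _ _ (fun n : nat => expR (- (e * n%:R)) * M)).
  by move=> n; rewrite normr_ge0/= normrM ger0_norm ?expR_ge0// ler_wpM2l ?expR_ge0.
apply: (cvgn_eq (mul0r M)); apply: cvgM; last exact: cvg_cst.
exact: expN_cvg0.
Qed.

Let bound (a b x : R) : `|(a * sin x + b * cos x) / (e ^+ 2 + s ^+ 2)| <=
  (`|a| + `|b|) / (e ^+ 2 + s ^+ 2).
Proof.
have d0 : 0 < e ^+ 2 + s ^+ 2 by rewrite ltr_wpDr ?sqr_ge0// exprn_gt0.
rewrite normrM normfV (gtr0_norm d0) ler_wpM2r ?invr_ge0 ?(ltW d0)//.
rewrite (le_trans (ler_normD _ _))// !normrM lerD// ler_piMr// ler_norml.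
  by rewrite sin_geN1 sin_le1.
by rewrite cos_geN1 cos_le1.
Qed.

Let cos_le x : `|cos (s * x)| <= 1. Proof. by rewrite ler_norml cos_geN1 cos_le1. Qed.
Let sin_le x : `|sin (s * x)| <= 1. Proof. by rewrite ler_norml sin_geN1 sin_le1. Qed.
Let mcos : measurable_fun setT (fun x : measurableTypeR R => cos (s * x) : R).
Proof.
apply: continuous_measurable_fun => x; apply: continuous_comp; last exact: continuous_cos.
by apply: cvgM; [exact: cvg_cst|exact: cvg_id].
Qed.
Let msin : measurable_fun setT (fun x : measurableTypeR R => sin (s * x) : R).
Proof.
apply: continuous_measurable_fun => x; apply: continuous_comp; last exact: continuous_sin.
by apply: cvgM; [exact: cvg_cst|exact: cvg_id].
Qed.

Let D0 : e ^+ 2 + s ^+ 2 != 0.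
Proof. by rewrite gt_eqF// ltr_wpDr ?sqr_ge0// exprn_gt0. Qed.

Lemma half_cos : \int[leb1]_x (hv x * (expR (- (e * x)) * cos (s * x))) =
  e / (e ^+ 2 + s ^+ 2).
Proof.
pose F x := expR (- (e * x)) * ((s * sin (s * x) + (- e) * cos (s * x)) / (e ^+ 2 + s ^+ 2)).
transitivity (0 - F 0); last by rewrite /F !mulr0 sin0 cos0 oppr0 expR0; field.
apply: FTC_half.
- move=> x; rewrite /F; apply: is_derive_eq.
  by rewrite /GRing.scale/=; field.
- move=> x; apply: cvgM.
    apply: continuous_comp; last exact: continuous_expR.
    by apply: cvgN; apply: cvgM; [exact: cvg_cst|exact: cvg_id].
  apply: continuous_comp; last exact: continuous_cos.
  by apply: cvgM; [exact: cvg_cst|exact: cvg_id].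
- apply: half_rint.
    exact: mcos.
  exact: cos_le.
- exact: half_cvg (fun x => bound _ _ _).
Qed.

Lemma half_sin : \int[leb1]_x (hv x * (expR (- (e * x)) * sin (s * x))) =
  s / (e ^+ 2 + s ^+ 2).
Proof.
pose F x := expR (- (e * x)) * (((- e) * sin (s * x) + (- s) * cos (s * x)) / (e ^+ 2 + s ^+ 2)).
transitivity (0 - F 0); last by rewrite /F !mulr0 sin0 cos0 oppr0 expR0; field.
apply: FTC_half.
- move=> x; rewrite /F; apply: is_derive_eq.
  by rewrite /GRing.scale/=; field.
- move=> x; apply: cvgM.
    apply: continuous_comp; last exact: continuous_expR.
    by apply: cvgN; apply: cvgM; [exact: cvg_cst|exact: cvg_id].
  apply: continuous_comp; last exact: continuous_sin.
  by apply: cvgM; [exact: cvg_cst|exact: cvg_id].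
- apply: half_rint.
    exact: msin.
  exact: sin_le.
- exact: half_cvg (fun x => bound _ _ _).
Qed.

Lemma sgr_measurable : measurable_fun setT (Num.sg : measurableTypeR R -> R).
Proof.
rewrite (_ : Num.sg = (fun x => hv x - hv (- x))).
  have [_ mo _] := @mpc_opp R.
  exact: (measurable_funB hv_measurable (measurableT_comp hv_measurable mo)).
by apply/funext => x; rewrite /hv oppr_gt0; case: sgrP => x0; rewrite ?subrr ?subr0 ?sub0r.
Qed.

Lemma sgr_le1 x : `|Num.sg x| <= 1.
Proof. by case: sgrP => _; rewrite ?normr0 ?normrN1 ?normr1. Qed.

Lemma rint_exp_cos : rint leb1 (fun x => expR (- (e * `|x|)) * cos (s * x)).
Proof.
have := rint_bounded leb1 1 mcos cos_le (rint_expN e0).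
by congr rint; apply/funext => x; rewrite mulrC.
Qed.

Lemma rint_exp_sin : rint leb1 (fun x => expR (- (e * `|x|)) * sin (s * x)).
Proof.
have := rint_bounded leb1 1 msin sin_le (rint_expN e0).
by congr rint; apply/funext => x; rewrite mulrC.
Qed.

Lemma int_exp_cos : \int[leb1]_x (expR (- (e * `|x|)) * cos (s * x)) =
  2 * e / (e ^+ 2 + s ^+ 2).
Proof.
rewrite (Rint_fold rint_exp_cos) -mulrA -half_cos -RintegralZl//; last first.
  exact: half_rint.
apply: eq_Rintegral => x _; rewrite /hv; case: ltP => x0; last by rewrite !mul0r mulr0.
by rewrite normrN gtr0_norm// mulrN cosN; ring.
Qed.

Lemma int_exp_sin : \int[leb1]_x (expR (- (e * `|x|)) * sin (s * x)) = 0.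
Proof.
rewrite (Rint_fold rint_exp_sin).
under eq_Rintegral do rewrite normrN mulrN sinN mulrN subrr mulr0.
by rewrite Rintegral_cst// mul0r.
Qed.

(** For [e = 1] this is, up to sign and a factor 1/2, the transform of the odd kernel [p_x]. *)
Lemma int_sgexp_sin : \int[leb1]_x (Num.sg x * (expR (- (e * `|x|)) * sin (s * x))) =
  2 * s / (e ^+ 2 + s ^+ 2).
Proof.
rewrite (Rint_fold (rint_bounded leb1 1 sgr_measurable sgr_le1 rint_exp_sin)).
rewrite -mulrA -half_sin -RintegralZl//; last exact: half_rint.
apply: eq_Rintegral => x _; rewrite /hv; case: ltP => x0; last by rewrite !mul0r mulr0.
by rewrite normrN gtr0_norm// mulrN sinN sgrN gtr0_sg//; ring.
Qed.

Lemma int_sgexp_cos : \int[leb1]_x (Num.sg x * (expR (- (e * `|x|)) * cos (s * x))) = 0.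
Proof.
rewrite (Rint_fold (rint_bounded leb1 1 sgr_measurable sgr_le1 rint_exp_cos)).
under eq_Rintegral do rewrite normrN mulrN cosN sgrN mulNr subrr mulr0.
by rewrite Rintegral_cst// mul0r.
Qed.

End half_integrals.
End half_line.

Notation plane R := (measurableTypeR R * measurableTypeR R)%type.

(** * Continuity of translations in L^2 *)

Section translation.
Context {R : realType}.

Lemma cvgn_comp (b : R -> R) (u : nat -> R) (x : R) : continuous b ->
  u @ \oo --> x -> (fun n => b (u n)) @ \oo --> b x.
Proof. by move=> cb; exact: continuous_cvg (cb x). Qed.

Local Notation leb1 := (@lebesgue_measure R).
Local Notation mu2 := (@lebesgue_measure R \x @lebesgue_measure R)%E.
Implicit Types (f g : R * R -> R) (a z : R * R).

(** Interchange of limits by approximation: [e k] is an error uniform in [n], and [v k] vanishes in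
    the limit for each fixed [k]. *)
Lemma cvg0_approx (u e : nat -> R) (v : nat -> nat -> R) :
  (forall n, 0 <= u n) -> (forall k n, u n <= v k n + e k) ->
  (forall k, v k @ \oo --> (0 : R)) -> e @ \oo --> (0 : R) -> u @ \oo --> (0 : R).
Proof.
move=> u0 uv v0 e0; apply/cvgr0Pnorm_lt => d d0.
have d2 : 0 < d / 2 by rewrite divr_gt0.
have /cvgr0Pnorm_lt/(_ _ d2) [k _ /(_ k (leqnn _)) /= ek] := e0.
have /cvgr0Pnorm_lt/(_ _ d2) := v0 k; apply: filterS => n vn.
rewrite ger0_norm//; apply: le_lt_trans (uv k n) _.
by have := ler_norm (v k n); have := ler_norm (e k); lra.
Qed.

(** Orthogonality to [f] is stable under linear combinations and limits; by density it holds of [f]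
    itself, so [n2 f = 0]. *)
Lemma test_orthogonal f : L2 mu2 f ->
  (forall b c, bsmooth b -> bsmooth c -> ip mu2 f (tensor b c) = 0) ->
  {ae mu2, forall z, f z = 0}.
Proof.
move=> lf h; apply: (n2_eq0 lf).
apply: (@L2_density R (fun g => ip mu2 f g = 0)) => //.
- move=> g1 g2 a l1 l2 e1 e2.
  by rewrite ipDr ?ipZr ?e1 ?e2 ?mulr0 ?addr0//; exact: L2Z.
- move=> gs g lgs lg e cg.
  have := ip_cvg (fun=> lf) lgs lf lg (cvg2_cst mu2 f) cg.
  under eq_fun do rewrite e.
  by move/cvg_lim => <- //; rewrite lim_cst.
Qed.

Definition tr a f : R * R -> R := fun z => f (z.1 + a.1, z.2 + a.2).

Lemma mpc_tr a : mpc mu2 1 (fun z : plane R => (z.1 + a.1, z.2 + a.2) : plane R).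
Proof.
by rewrite -[X in mpc _ X](mulr1 (1 : R)); exact: (mpc_prod (mpc_shift a.1) (mpc_shift a.2)).
Qed.

Lemma tr_L2 a f : L2 mu2 f -> L2 mu2 (tr a f).
Proof. exact: (mpc_L2 (mpc_tr a)). Qed.

Lemma tr_rint a f : rint mu2 f -> rint mu2 (tr a f).
Proof. exact: (mpc_rint (mpc_tr a)). Qed.

Lemma tr_ip a f g : L2 mu2 f -> L2 mu2 g -> ip mu2 (tr a f) (tr a g) = ip mu2 f g.
Proof. by move=> lf lg; rewrite -[RHS]mul1r; exact: (mpc_ip (mpc_tr a)). Qed.

Lemma tr_n2 a f : L2 mu2 f -> n2 mu2 (tr a f) = n2 mu2 f.
Proof. by move=> lf; exact: tr_ip. Qed.

Lemma tr_Rintegral a f : rint mu2 f -> \int[mu2]_z (tr a f z) = \int[mu2]_z f z.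
Proof. by move=> fi; rewrite -[RHS]mul1r; exact: (mpc_Rintegral (mpc_tr a)). Qed.

Lemma tr_ae a (P : R * R -> Prop) : {ae mu2, forall z, P z} ->
  {ae mu2, forall z, P (z.1 + a.1, z.2 + a.2)}.
Proof. exact: (mpc_ae (mpc_tr a)). Qed.

Lemma tr_tr a b f : tr a (tr b f) = tr (a.1 + b.1, a.2 + b.2) f.
Proof. by apply/funext => z; rewrite /tr/= !addrA. Qed.

Lemma tr0 f : tr (0, 0) f = f.
Proof. by apply/funext => -[x y]; rewrite /tr/= !addr0. Qed.

(** Translations are isometries, so the property passes to limits and density reduces it to
    continuous functions of compact support. *)
Lemma tr_cvg (as_ : nat -> R * R) (B : R) f : L2 mu2 f ->
  (forall n, `|(as_ n).1| <= B) -> (forall n, `|(as_ n).2| <= B) ->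
  (fun n => (as_ n).1) @ \oo --> (0 : R) -> (fun n => (as_ n).2) @ \oo --> (0 : R) ->
  cvg2 mu2 (fun n => tr (as_ n) f) f.
Proof.
move=> lf B1 B2 c1 c2; move: f lf.
apply: L2_density.
- move=> f g a lf lg cf cg.
  apply: (cvg2D (fun n => tr_L2 _ lf) (fun n => L2Z a (tr_L2 _ lg)) lf (L2Z a lg) cf).
  exact: (cvg2Z a (fun n => tr_L2 _ lg) lg cg).
- move=> fs f lfs lf cfs cf.
  (* Two triangle inequalities, each with a factor 2: the translated error counts [2], the error
     itself [2 * 2], and the translation of [fs k] also [2 * 2]. *)
  apply: (@cvg0_approx _ (fun k => 6 * n2 mu2 (fun z => fs k z - f z))
    (fun k n => 4 * n2 mu2 (fun z => tr (as_ n) (fs k) z - fs k z))).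
  + by move=> n; exact: n2_ge0.
  + move=> k n.
    have h1 := n2_triangle mu2 (tr (as_ n) (fs k)) (tr (as_ n) f) f
      (tr_L2 _ lf) (tr_L2 _ (lfs k)) lf.
    have h2 := n2_triangle mu2 (fs k) (tr (as_ n) (fs k)) f
      (tr_L2 _ (lfs k)) (lfs k) lf.
    have h3 := tr_n2 (as_ n) (L2B (lfs k) lf).
    rewrite /tr/= n2BC in h3; move: h1 h2; rewrite {1}/tr/= h3; lra.
  + move=> k; apply: (cvgn_eq (mulr0 4)); apply: cvgM; [exact: cvg_cst|exact: cfs].
  + by apply: (cvgn_eq (mulr0 6)); apply: cvgM; [exact: cvg_cst|exact: cf].
move=> b c bb bc.
have [M [N [N' le]]] := bsmooth_tensor_le bb bc.
have M0 : 0 <= `|M| by [].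
(* Enlarging the supporting box by the bound [B] on the shifts dominates all translates at once. *)
pose g (z : R * R) : R := `|M| * (\1_(`[- (N + B), N + B]%classic : set R) z.1 *
  \1_(`[- (N' + B), N' + B]%classic : set R) z.2).
have shift (L x y : R) : `|y| <= B -> (\1_(`[- L, L]%classic : set R) (x + y) : R) <=
    \1_(`[- (L + B), L + B]%classic : set R) x.
  rewrite ler_norml !indicE !mem_setE !in_itv/= ler_nat => /andP[y1 y2].
  have [/andP[x1 x2]|//] := boolP (- L <= x + y <= L).
  by rewrite (_ : _ <= x <= _)//; apply/andP; split; lra.
apply: (L2_dct mu2 (fun n => tr (as_ n) (tensor b c)) (tensor b c) g _ _ _ _ _).2.
- by move=> n; apply: L2_measurable; apply: tr_L2; exact: tensor_L2.
- exact: tensor_measurable.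
- by apply: L2Z; exact: L2_rect.
- move=> n z; rewrite (le_trans (le _))// [leRHS]ger0_norm ?mulr_ge0//.
  rewrite (le_trans (ler_wpM2r _ (ler_norm M)))// ?mulr_ge0//.
  by rewrite ler_wpM2l// ler_pM//; exact: shift.
- apply: aeW => -[x y]; apply: cvgM.
    apply: (cvgn_comp (bsmooth_continuous bb)).
    by apply: (cvgn_eq (addr0 x)); apply: cvgD => //; exact: cvg_cst.
  apply: (cvgn_comp (bsmooth_continuous bc)).
  by apply: (cvgn_eq (addr0 y)); apply: cvgD => //; exact: cvg_cst.
Qed.

End translation.

(** Serves where no dominating function is at hand: a uniform bound on the integrals gives
    integrability of the limit. *)
Lemma rint_fatou d (T : measurableType d) (R : realType) (mu : {measure set T -> \bar R})
    (fs : nat -> T -> R) (f : T -> R) (B : R) :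
  (forall n, rint mu (fs n)) -> (forall n x, 0 <= fs n x) ->
  (forall x, fs ^~ x @ \oo --> f x) -> measurable_fun setT f ->
  (forall n, \int[mu]_x fs n x <= B) -> rint mu f.
Proof.
move=> fsi fs0 fsf mf fsB.
have f0 x : 0 <= f x.
  by rewrite -(cvg_lim _ (fsf x))//; apply: limr_ge; [apply/cvg_ex; exists (f x)|exact: nearW].
apply: (rint_lty mf); under eq_integral do rewrite ger0_norm//.
apply: (@le_lt_trans _ _ B%:E); last exact: ltry.
have := @fatou _ _ _ mu _ measurableT (fun n x => (fs n x)%:E)
  (fun n => proj2 (measurable_EFinP _ _) (rint_measurable (fsi n))) (fun n x _ => fs0 n x).
have E x : limn_einf ((fun n x => (fs n x)%:E) ^~ x) = (f x)%:E.
  have c : (fun n => (fs n x)%:E) @ \oo --> (f x)%:E.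
    by apply/cvg_EFin; [exact: nearW|exact: fsf].
  by rewrite is_cvg_limn_einfE; [exact/cvg_lim|apply/cvg_ex; exists (f x)%:E].
under eq_integral do rewrite E.
move/le_trans; apply; rewrite limn_einf_lim; apply: lime_le.
  exact: is_cvg_einfs.
apply: nearW => n; apply: (@le_trans _ _ (\int[mu]_x (fs n x)%:E)%E).
  by apply: ereal_inf_lbound; exists n => /=.
by rewrite rint_fin// lee_fin.
Qed.

Section fubini_criterion.
Context d1 d2 (T1 : measurableType d1) (T2 : measurableType d2) (R : realType).
Variable m1 : {sigma_finite_measure set T1 -> \bar R}.
Variable m2 : {sigma_finite_measure set T2 -> \bar R}.

Lemma rint21_le (f : T1 * T2 -> R) (g : T2 -> R) : measurable_fun setT f -> rint m2 g ->
  (forall y, rint m1 (fun x => f (x, y))) ->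
  (forall y, \int[m1]_x `|f (x, y)| <= g y) -> rint (m1 \x m2)%E f.
Proof.
move=> mf gi fi fg; apply: rint21 => //.
under eq_integral do rewrite (rint_fin (rint_norm (fi _))).
apply: le_lt_trans (rint_ltyP gi).
apply: ge0_le_integral => //.
- by move=> y _; rewrite lee_fin Rintegral_ge0.
- under eq_fun do rewrite -(rint_fin (rint_norm (fi _))).
  apply: (@measurable_fun_fubini_tonelli_G _ _ _ _ _ m1 (fun z => `|f z|%:E)) => //.
  by apply/measurable_EFinP; exact: measurableT_comp.
- by apply/measurable_EFinP; apply: measurableT_comp => //; exact: rint_measurable gi.
- by move=> y _; rewrite lee_fin (le_trans (fg y))// ler_norm.
Qed.

End fubini_criterion.

(** * Fourier integrals and Plancherel's identity *)

Section fourier_integral.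
Context {R : realType}.
Local Notation leb1 := (@lebesgue_measure R).
Local Notation mu2 := (@lebesgue_measure R \x @lebesgue_measure R)%E.
Implicit Types (f g : R * R -> R) (a z zeta w : R * R) (e : R).

(* Repackaged because [\x] of sigma-finite measures is not inferred to be one. *)
Definition lebp : set (plane R) -> \bar R := mu2.
Lemma lebp_sigma_finite : sigma_finite setT lebp.
Proof.
have bx : forall n, measurable (`]- n%:R, n%:R]%classic : set (measurableTypeR R)) by [].
exists (fun n => `]- n%:R, n%:R]%classic `*` `]- n%:R, n%:R]%classic).
  apply/esym/seteqP; split => // -[x y] _.
  pose N := (Num.trunc (Num.max `|x| `|y|)).+1.
  have h : Num.max `|x| `|y| < N%:R by exact: truncnS_gt.
  have [hx hy] : `|x| < N%:R /\ `|y| < N%:R by move: h; rewrite gt_max => /andP[].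
  exists N => //; split => /=; rewrite in_itv/=;
    [move: hx|move: hy]; by rewrite ltr_norml => /andP[-> /ltW->].
move=> n; split; first exact: measurableX.
have -> A B : measurable A -> measurable B -> lebp (A `*` B) = (leb1 A * leb1 B)%E.
  by move=> mA mB; exact: product_measure1E.
  by rewrite !lebesgue_measure_itv/=; case: ifP => _; rewrite -?EFinB -?EFinM ?mul0e ?ltry.
- done.
- done.
Qed.
HB.instance Definition _ := Measure.on lebp.
HB.instance Definition _ := Measure_isSigmaFinite.Build _ _ _ lebp lebp_sigma_finite.

Definition dot z zeta : R := z.1 * zeta.1 + z.2 * zeta.2.
(** The unitary Fourier transform of a real integrable [f] is [Cf f - i Sf f]; real and imaginary
    parts are kept as separate real functions throughout. *)
Definition Cf f zeta : R := (2 * pi)^-1 * \int[mu2]_z (f z * cos (dot z zeta)).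
Definition Sf f zeta : R := (2 * pi)^-1 * \int[mu2]_z (f z * sin (dot z zeta)).

Lemma cos_abs_le1 (x : R) : `|cos x| <= 1.
Proof. by rewrite ler_norml cos_geN1 cos_le1. Qed.
Lemma sin_abs_le1 (x : R) : `|sin x| <= 1.
Proof. by rewrite ler_norml sin_geN1 sin_le1. Qed.

Lemma cos_measurable : measurable_fun setT (@cos R : measurableTypeR R -> R).
Proof. by apply: continuous_measurable_fun; exact: continuous_cos. Qed.
Lemma sin_measurable : measurable_fun setT (@sin R : measurableTypeR R -> R).
Proof. by apply: continuous_measurable_fun; exact: continuous_sin. Qed.

Lemma dot_measurable2 :
  measurable_fun setT (fun p : plane R * plane R => dot p.1 p.2 : measurableTypeR R).
Proof.
apply: measurable_funD; apply: measurable_funM.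
- exact: (measurableT_comp measurable_fst measurable_fst).
- exact: (measurableT_comp measurable_fst measurable_snd).
- exact: (measurableT_comp measurable_snd measurable_fst).
- exact: (measurableT_comp measurable_snd measurable_snd).
Qed.

Lemma dot_measurable zeta : measurable_fun setT (fun z : plane R => dot z zeta : measurableTypeR R).
Proof.
exact: (measurableT_comp dot_measurable2 (measurable_pair2 zeta)).
Qed.

Lemma rint_cos f zeta : rint mu2 f -> rint mu2 (fun z => f z * cos (dot z zeta)).
Proof.
move=> fi; under eq_fun do rewrite mulrC.
apply: (rint_bounded mu2 1) => //; last by move=> z; exact: cos_abs_le1.
exact: (measurableT_comp cos_measurable (dot_measurable zeta)).
Qed.

Lemma rint_sin f zeta : rint mu2 f -> rint mu2 (fun z => f z * sin (dot z zeta)).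
Proof.
move=> fi; under eq_fun do rewrite mulrC.
apply: (rint_bounded mu2 1) => //; last by move=> z; exact: sin_abs_le1.
exact: (measurableT_comp sin_measurable (dot_measurable zeta)).
Qed.

Lemma pi2_gt0 : 0 < (2 * pi : R)^-1.
Proof. by rewrite invr_gt0 mulr_gt0// pi_gt0. Qed.

Lemma CfD f g zeta (c : R) : rint mu2 f -> rint mu2 g ->
  Cf (fun z => f z + c * g z) zeta = Cf f zeta + c * Cf g zeta.
Proof.
move=> fi gi; rewrite /Cf; under eq_Rintegral do rewrite mulrDl -mulrA.
rewrite RintegralD//; [|exact: rint_cos|apply: rintZ; exact: rint_cos].
by rewrite RintegralZl//; [ring|exact: rint_cos].
Qed.

Lemma SfD f g zeta (c : R) : rint mu2 f -> rint mu2 g ->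
  Sf (fun z => f z + c * g z) zeta = Sf f zeta + c * Sf g zeta.
Proof.
move=> fi gi; rewrite /Sf; under eq_Rintegral do rewrite mulrDl -mulrA.
rewrite RintegralD//; [|exact: rint_sin|apply: rintZ; exact: rint_sin].
by rewrite RintegralZl//; [ring|exact: rint_sin].
Qed.

Lemma Cf_le f zeta : rint mu2 f -> `|Cf f zeta| <= (2 * pi)^-1 * \int[mu2]_z `|f z|.
Proof.
move=> fi; rewrite /Cf normrM (gtr0_norm pi2_gt0) ler_wpM2l ?(ltW pi2_gt0)//.
apply: le_trans (le_normr_Rintegral _ _) _ => //; first exact: rint_cos.
apply: le_Rintegral => //; [exact/rint_norm/rint_cos|exact: rint_norm|].
by move=> z _; rewrite normrM ler_piMr// cos_abs_le1.
Qed.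

Lemma Sf_le f zeta : rint mu2 f -> `|Sf f zeta| <= (2 * pi)^-1 * \int[mu2]_z `|f z|.
Proof.
move=> fi; rewrite /Sf normrM (gtr0_norm pi2_gt0) ler_wpM2l ?(ltW pi2_gt0)//.
apply: le_trans (le_normr_Rintegral _ _) _ => //; first exact: rint_sin.
apply: le_Rintegral => //; [exact/rint_norm/rint_sin|exact: rint_norm|].
by move=> z _; rewrite normrM ler_piMr// sin_abs_le1.
Qed.

(** An integrable factor in frequency that makes Fubini's theorem applicable; it tends to 1 as
    [e -> 0], and its transform is a product of Poisson kernels. *)
Definition damp (e : R) zeta : R := expR (- (e * `|zeta.1|)) * expR (- (e * `|zeta.2|)).

Lemma damp_gt0 e zeta : 0 < damp e zeta.
Proof. by rewrite mulr_gt0// expR_gt0. Qed.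

Lemma rint_damp e : 0 < e -> rint mu2 (damp e).
Proof. by move=> e0; exact: (rint_tensor (rint_expN e0) (rint_expN e0)). Qed.

Lemma damp_measurable e : 0 < e -> measurable_fun setT (damp e : plane R -> measurableTypeR R).
Proof. by move=> e0; exact: rint_measurable (rint_damp e0). Qed.

Lemma rint_joint e f (t : R -> R) : 0 < e -> rint mu2 f ->
  measurable_fun setT (t : measurableTypeR R -> measurableTypeR R) -> (forall x, `|t x| <= 1) ->
  rint (lebp \x lebp)%E (fun p : plane R * plane R => damp e p.1 * f p.2 * t (dot p.2 p.1)).
Proof.
move=> e0 fi mt t1; have h := rint_tensor (m1 := lebp) (m2 := lebp) (rint_damp e0) fi.
under eq_fun do rewrite mulrC; apply: (rint_bounded _ 1) => //.
apply: (measurableT_comp mt).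
exact: (measurableT_comp dot_measurable2 (@measurable_swap _ _ (plane R) (plane R))).
Qed.

(** Fubini gives measurability once the frequency variable carries an integrable weight; [damp 1] is
    positive and is divided out afterwards. *)
Lemma Cf_measurable f : rint mu2 f -> measurable_fun setT (Cf f : plane R -> measurableTypeR R).
Proof.
move=> fi; have := rint_joint ltr01 fi cos_measurable cos_abs_le1.
move=> /rint_fubini1 [/rint_measurable + _] => /=.
have E zeta : \int[mu2]_z (damp 1 zeta * f z * cos (dot z zeta)) =
    damp 1 zeta * \int[mu2]_z (f z * cos (dot z zeta)).
  by under eq_Rintegral do rewrite -mulrA; rewrite RintegralZl//; exact: rint_cos.
under eq_fun do rewrite E.
move=> h; have mV : measurable_fun setT (fun zeta : plane R => (damp 1 zeta)^-1 : measurableTypeR R).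
  have -> : (fun zeta => (damp 1 zeta)^-1) =
      (fun zeta => expR (1 * `|zeta.1|) * expR (1 * `|zeta.2|)).
    by apply/funext => zeta; rewrite /damp invfM -!expRN !opprK.
  apply: measurable_funM; apply: measurableT_comp => //; apply: measurable_funM => //;
    exact: measurableT_comp.
have := measurable_funM (measurable_cst ((2 * pi)^-1 : R)) (measurable_funM mV h).
apply: eq_measurable_fun => zeta _ /=.
by rewrite mulKf// gt_eqF// damp_gt0.
Qed.

Lemma Sf_measurable f : rint mu2 f -> measurable_fun setT (Sf f : plane R -> measurableTypeR R).
Proof.
move=> fi; have := rint_joint ltr01 fi sin_measurable sin_abs_le1.
move=> /rint_fubini1 [/rint_measurable + _] => /=.
have E zeta : \int[mu2]_z (damp 1 zeta * f z * sin (dot z zeta)) =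
    damp 1 zeta * \int[mu2]_z (f z * sin (dot z zeta)).
  by under eq_Rintegral do rewrite -mulrA; rewrite RintegralZl//; exact: rint_sin.
under eq_fun do rewrite E.
move=> h; have mV : measurable_fun setT (fun zeta : plane R => (damp 1 zeta)^-1 : measurableTypeR R).
  have -> : (fun zeta => (damp 1 zeta)^-1) =
      (fun zeta => expR (1 * `|zeta.1|) * expR (1 * `|zeta.2|)).
    by apply/funext => zeta; rewrite /damp invfM -!expRN !opprK.
  apply: measurable_funM; apply: measurableT_comp => //; apply: measurable_funM => //;
    exact: measurableT_comp.
have := measurable_funM (measurable_cst ((2 * pi)^-1 : R)) (measurable_funM mV h).
apply: eq_measurable_fun => zeta _ /=.
by rewrite mulKf// gt_eqF// damp_gt0.
Qed.

(** The Poisson kernel, unnormalised: the cosine transform of [exp(- e |x|)]. *)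
Definition poisson (e s : R) : R := 2 * e / (e ^+ 2 + s ^+ 2).

Lemma int_damp_cos e w : 0 < e ->
  \int[mu2]_zeta (damp e zeta * cos (dot w zeta)) = poisson e w.1 * poisson e w.2.
Proof.
move=> e0.
pose u i (x : R) := expR (- (e * `|x|)) * cos (i * x).
pose v i (x : R) := expR (- (e * `|x|)) * sin (i * x).
have iu i : rint leb1 (u i) by exact: rint_exp_cos.
have iv i : rint leb1 (v i) by exact: rint_exp_sin.
transitivity (\int[mu2]_zeta (u w.1 zeta.1 * u w.2 zeta.2 - v w.1 zeta.1 * v w.2 zeta.2)).
  by apply: eq_Rintegral => zeta _; rewrite /dot cosD /damp /u /v; ring.
rewrite RintegralB//; [|exact: rint_tensor|exact: rint_tensor].
rewrite !Rintegral_tensor// /u /v !int_exp_cos// !int_exp_sin//.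
by rewrite mulr0 subr0.
Qed.

Section plancherel.
Variable f : R * R -> R.
Hypotheses (f1 : rint mu2 f) (f2 : L2 mu2 f).

(** The damped squared norm of the transform. Fubini turns it into an average of the autocorrelation
    of [f] over shifts of size [e], which tends to [n2 f] by continuity of translations; removing
    the damping on the other side gives Plancherel's identity. *)
Let J e := \int[mu2]_zeta (damp e zeta * (Cf f zeta ^+ 2 + Sf f zeta ^+ 2)).

Let mC := Cf_measurable f1.
Let mS := Sf_measurable f1.

Let M := (2 * pi)^-1 * \int[mu2]_z `|f z|.
Let p0 : (2 * pi : R) != 0. Proof. by rewrite gt_eqF// mulr_gt0// pi_gt0. Qed.

Let idamp e g B : 0 < e -> measurable_fun setT (g : plane R -> measurableTypeR R) ->
  (forall z, `|g z| <= B) -> rint mu2 (fun zeta => damp e zeta * g zeta).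
Proof.
by move=> e0 mg gB; under eq_fun do rewrite mulrC; exact: (rint_bounded mu2 B mg gB (rint_damp e0)).
Qed.

Let inner_le z zeta : `|Cf f zeta * cos (dot z zeta) + Sf f zeta * sin (dot z zeta)| <= M + M.
Proof.
rewrite (le_trans (ler_normD _ _))// lerD// normrM -[leRHS]mulr1 ler_pM//.
- exact: Cf_le.
- exact: cos_abs_le1.
- exact: Sf_le.
- exact: sin_abs_le1.
Qed.

Let inner_measurable z : measurable_fun setT (fun zeta : plane R =>
  Cf f zeta * cos (dot z zeta) + Sf f zeta * sin (dot z zeta) : measurableTypeR R).
Proof.
have md := measurableT_comp dot_measurable2 (measurable_pair1 z).
by apply: measurable_funD; apply: measurable_funM => //;
  [exact: (measurableT_comp cos_measurable md)|exact: (measurableT_comp sin_measurable md)].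
Qed.

(** Writing out the transforms of [f], the formula for [cos (x - y)] leaves the integral of [damp e]
    against a single cosine, that is, a product of Poisson kernels at [z - w]. *)
Let inner e z : 0 < e ->
  \int[mu2]_zeta (damp e zeta * (Cf f zeta * cos (dot z zeta) + Sf f zeta * sin (dot z zeta))) =
  (2 * pi)^-1 * \int[mu2]_w (f w * (poisson e (z.1 - w.1) * poisson e (z.2 - w.2))).
Proof.
move=> e0.
have i : rint (lebp \x lebp)%E (fun p : plane R * plane R =>
    damp e p.1 * f p.2 * cos (dot (z.1 - p.2.1, z.2 - p.2.2) p.1)).
  under eq_fun do rewrite mulrC; apply: (rint_bounded _ 1) => //.
  - apply: (measurableT_comp cos_measurable).
    have m1 : measurable_fun setT (fun p : plane R * plane R =>
        ((z.1 - p.2.1, z.2 - p.2.2), p.1) : plane R * plane R).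
      apply: measurable_fun_pair; last exact: measurable_fst.
      apply: measurable_fun_pair; apply: measurable_funB => //.
        exact: (measurableT_comp measurable_fst measurable_snd).
      exact: (measurableT_comp measurable_snd measurable_snd).
    exact: (measurableT_comp dot_measurable2 m1).
  - by move=> p; exact: cos_abs_le1.
  - exact: (rint_tensor (m1 := lebp) (m2 := lebp) (rint_damp e0) f1).
have L zeta : \int[mu2]_w (damp e zeta * f w * cos (dot (z.1 - w.1, z.2 - w.2) zeta)) =
    2 * pi * (damp e zeta * (Cf f zeta * cos (dot z zeta) + Sf f zeta * sin (dot z zeta))).
  transitivity (damp e zeta * \int[mu2]_w (cos (dot z zeta) * (f w * cos (dot w zeta)) +
      sin (dot z zeta) * (f w * sin (dot w zeta)))).
    rewrite -RintegralZl//; last by apply: rintD; apply: rintZ; [exact: rint_cos|exact: rint_sin].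
    apply: eq_Rintegral => w _.
    have -> : dot (z.1 - w.1, z.2 - w.2) zeta = dot z zeta - dot w zeta by rewrite /dot/=; ring.
    by rewrite cosB; ring.
  rewrite RintegralD//; last 2 first.
  - by apply: rintZ; exact: rint_cos.
  - by apply: rintZ; exact: rint_sin.
  rewrite RintegralZl//; last exact: rint_cos.
  rewrite RintegralZl//; last exact: rint_sin.
  by rewrite /Cf /Sf; move: (2 * pi) p0 => p p00; field.
have Nw w : \int[mu2]_zeta (damp e zeta * f w * cos (dot (z.1 - w.1, z.2 - w.2) zeta)) =
    f w * (poisson e (z.1 - w.1) * poisson e (z.2 - w.2)).
  rewrite -(int_damp_cos (z.1 - w.1, z.2 - w.2) e0) -RintegralZl//.
    by apply: eq_Rintegral => zeta _; ring.
  under eq_fun do rewrite mulrC; apply: (rint_bounded mu2 1); last exact: rint_damp.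
    apply: (measurableT_comp cos_measurable).
    exact: (measurableT_comp dot_measurable2 (measurable_pair1 (z.1 - w.1, z.2 - w.2))).
  by move=> zeta; exact: cos_abs_le1.
have := Rfubini i => /=.
under eq_Rintegral do rewrite L.
under [X in _ = X -> _]eq_Rintegral do rewrite Nw.
move=> <-.
rewrite RintegralZl//; last exact: (idamp e0 (inner_measurable z) (inner_le z)).
by rewrite mulKf.
Qed.

Let J1 e : 0 < e -> J e = ((2 * pi)^-1) ^+ 2 * \int[mu2]_z (f z *
  \int[mu2]_w (f w * (poisson e (z.1 - w.1) * poisson e (z.2 - w.2)))).
Proof.
move=> e0.
have i : rint (lebp \x lebp)%E (fun p : plane R * plane R =>
   (Cf f p.1 * cos (dot p.2 p.1) + Sf f p.1 * sin (dot p.2 p.1)) * (damp e p.1 * f p.2)).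
  apply: (rint_bounded _ (M + M)); last exact: (rint_tensor (m1 := lebp) (m2 := lebp) (rint_damp e0) f1).
    have md : measurable_fun setT (fun p : plane R * plane R => dot p.2 p.1 : measurableTypeR R).
      exact: (measurableT_comp dot_measurable2 (@measurable_swap _ _ (plane R) (plane R))).
    apply: measurable_funD; apply: measurable_funM.
    - exact: (measurableT_comp mC measurable_fst).
    - exact: (measurableT_comp cos_measurable md).
    - exact: (measurableT_comp mS measurable_fst).
    - exact: (measurableT_comp sin_measurable md).
  by move=> p; exact: inner_le.
have L zeta : \int[mu2]_z ((Cf f zeta * cos (dot z zeta) + Sf f zeta * sin (dot z zeta)) *
    (damp e zeta * f z)) = 2 * pi * (damp e zeta * (Cf f zeta ^+ 2 + Sf f zeta ^+ 2)).
  transitivity (\int[mu2]_z (damp e zeta * Cf f zeta * (f z * cos (dot z zeta)) +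
      damp e zeta * Sf f zeta * (f z * sin (dot z zeta)))).
    by apply: eq_Rintegral => z _; ring.
  rewrite RintegralD//; last 2 first.
  - by apply: rintZ; exact: rint_cos.
  - by apply: rintZ; exact: rint_sin.
  rewrite RintegralZl//; last exact: rint_cos.
  rewrite RintegralZl//; last exact: rint_sin.
  have EC : \int[mu2]_z (f z * cos (dot z zeta)) = 2 * pi * Cf f zeta by rewrite /Cf mulVKf.
  have ES : \int[mu2]_z (f z * sin (dot z zeta)) = 2 * pi * Sf f zeta by rewrite /Sf mulVKf.
  by rewrite EC ES; ring.
have N z : \int[mu2]_zeta ((Cf f zeta * cos (dot z zeta) + Sf f zeta * sin (dot z zeta)) *
    (damp e zeta * f z)) = (2 * pi)^-1 * (f z *
  \int[mu2]_w (f w * (poisson e (z.1 - w.1) * poisson e (z.2 - w.2)))).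
  rewrite mulrCA -(inner z e0) -RintegralZl//; last first.
    exact: (idamp e0 (inner_measurable z) (inner_le z)).
  by apply: eq_Rintegral => zeta _; ring.
have := Rfubini i => /=.
under eq_Rintegral do rewrite L.
under [X in _ = X -> _]eq_Rintegral do rewrite N.
have [_ []] := (rint_fubini1 i, rint_fubini2 i); move=> /= + _.
under eq_fun do rewrite N; move=> h.
rewrite !RintegralZl//; last 2 first.
- have := rintZ (2 * pi) h; congr rint; apply/funext => z.
  by rewrite mulVKf.
- have [+ _] := rint_fubini1 i => /=; under eq_fun do rewrite L.
  move/(rintZ (2 * pi)^-1); congr rint; apply/funext => z.
  by rewrite mulKf.
by rewrite -/(J e) => /(congr1 ( *%R (2 * pi)^-1)); rewrite mulKf// mulrA -expr2.
Qed.

(** The Poisson kernel at scale 1, without its constant: rescaling moves all dependence on [e] from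
    the kernel to the shift. *)
Let k (x : R) : R := (1 + x ^+ 2)^-1.

Let poisson_scale e x : 0 < e -> poisson e (e * x) = 2 * e^-1 * k x.
Proof.
move=> e0; rewrite /poisson /k; have h : 1 + x ^+ 2 != 0 by rewrite gt_eqF// ltr_pwDl// sqr_ge0.
have h' : e ^+ 2 + (e * x) ^+ 2 != 0.
  by rewrite exprMn -{1}(mulr1 (e ^+ 2)) -mulrDr mulf_neq0// expf_neq0// gt_eqF.
by field; rewrite h h' gt_eqF.
Qed.

Let poisson_bound e x : 0 < e -> `|poisson e x| <= 2 / e.
Proof.
move=> e0; have h : 0 < e ^+ 2 + x ^+ 2 by rewrite ltr_pwDl ?exprn_gt0 ?sqr_ge0.
rewrite ger0_norm /poisson; last by rewrite divr_ge0 ?mulr_ge0 ?ltW.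
rewrite ler_pdivrMr// [2 / e * _]mulrDr expr2 mulrA divfK ?gt_eqF// lerDl.
by rewrite mulr_ge0 ?sqr_ge0// divr_ge0 ?ltW.
Qed.

Let poisson_measurable e : 0 < e -> measurable_fun setT (poisson e : measurableTypeR R -> measurableTypeR R).
Proof.
move=> e0; apply: measurable_funM => //; apply: continuous_measurable_fun.
move=> x; apply: cvgV; first by rewrite gt_eqF// ltr_pwDl ?exprn_gt0 ?sqr_ge0.
by apply: cvgD; [exact: cvg_cst|apply: exprn_continuous].
Qed.

Let affine e z : 0 < e -> mpc mu2 (e^-1 * e^-1)
  (fun w : plane R => (- (e * w.1) + z.1, - (e * w.2) + z.2) : plane R).
Proof.
move=> e0.
have aff (a : R) : mpc leb1 e^-1 (fun x : measurableTypeR R => - (e * x) + a : measurableTypeR R).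
  have := mpc_comp (mpc_comp (mpc_shift a) (@mpc_opp R)) (mpc_scale e0).
  by rewrite !mulr1.
exact: (mpc_prod (aff z.1) (aff z.2)).
Qed.

Let k_le1 x : 0 <= k x <= 1.
Proof.
have h : 1 <= 1 + x ^+ 2 by rewrite lerDl sqr_ge0.
by rewrite invr_ge0 (le_trans ler01 h)/= invf_le1// (lt_le_trans ltr01 h).
Qed.

Let kk_ge0 w : 0 <= k w.1 * k w.2.
Proof. by rewrite mulr_ge0//; [have /andP[] := k_le1 w.1|have /andP[] := k_le1 w.2]. Qed.

Let kk_le1 w : `|k w.1 * k w.2| <= 1.
Proof.
rewrite ger0_norm ?kk_ge0//; have /andP[? ?] := k_le1 w.1; have /andP[? ?] := k_le1 w.2.
by rewrite mulr_ile1.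
Qed.

Let ikk : rint mu2 (fun w => k w.1 * k w.2).
Proof. by have [h _] := @rint_oneDsqrV R; exact: (rint_tensor h h). Qed.

Let ktr e z : 0 < e -> rint mu2 (fun w => k w.1 * k w.2 * tr (- (e * w.1), - (e * w.2)) f z).
Proof.
move=> e0; apply: (rint_bounded mu2 1 (rint_measurable ikk) kk_le1).
have := mpc_rint (affine z e0) f1; congr rint; apply/funext => w /=.
by rewrite /tr/= ![- _ + _]addrC.
Qed.

(** The substitution [w -> z - e w] contributes [e^2], which cancels the [e^-2] of the two rescaled
    kernels and leaves [2 * 2]. *)
Let J2 e z : 0 < e ->
  \int[mu2]_w (f w * (poisson e (z.1 - w.1) * poisson e (z.2 - w.2))) =
  4 * \int[mu2]_w (k w.1 * k w.2 * tr (- (e * w.1), - (e * w.2)) f z).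
Proof.
move=> e0.
pose g (w : R * R) := f w * (poisson e (z.1 - w.1) * poisson e (z.2 - w.2)).
have gi : rint mu2 g.
  rewrite /g; under eq_fun do rewrite mulrC; apply: (rint_bounded mu2 (2 / e * (2 / e))) => //.
    apply: measurable_funM; apply: (measurableT_comp (poisson_measurable e0));
      apply: measurable_funB => //.
  by move=> w; rewrite normrM ler_pM// poisson_bound.
have := mpc_Rintegral (affine z e0) gi.
move=> h.
have -> : \int[mu2]_w g w = e ^+ 2 * (e^-1 / e * \int[mu2]_w g w).
  by field; rewrite gt_eqF.
rewrite -h -!RintegralZl//; last 2 first.
- exact: ktr.
- exact: (mpc_rint (affine z e0) gi).
apply: eq_Rintegral => w _; rewrite /g /tr/=.
have E (a x : R) : a - (- (e * x) + a) = e * x by ring.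
rewrite !E !poisson_scale// [- _ + z.1]addrC [- _ + z.2]addrC.
by field; rewrite gt_eqF.
Qed.

(** The autocorrelation of [f]: bounded by its value [n2 f] at 0, and continuous there because
    translations are. *)
Let A v := ip mu2 f (tr v f).

Let A_le v : `|A v| <= n2 mu2 f.
Proof.
rewrite (le_trans (cauchy_abs f2 (tr_L2 v f2)))// tr_n2//.
by rewrite -sqrtrM ?n2_ge0// -expr2 sqrtr_sqr ger0_norm ?n2_ge0.
Qed.

Let joint e : 0 < e -> rint (lebp \x lebp)%E (fun p : plane R * plane R =>
  f p.1 * (k p.2.1 * k p.2.2 * tr (- (e * p.2.1), - (e * p.2.2)) f p.1)).
Proof.
move=> e0; have mf := rint_measurable f1; have mk := rint_measurable ikk.
apply: (@rint21_le _ _ _ _ _ lebp lebp _ (fun w => n2 mu2 f * (k w.1 * k w.2))).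
- apply: measurable_funM; first exact: (measurableT_comp mf measurable_fst).
  apply: measurable_funM; first exact: (measurableT_comp mk measurable_snd).
  have m : measurable_fun setT (fun p : plane R * plane R =>
      (p.1.1 - e * p.2.1, p.1.2 - e * p.2.2) : plane R).
    apply: measurable_fun_pair; apply: measurable_funB.
    + exact: (measurableT_comp measurable_fst measurable_fst).
    + by apply: measurable_funM => //; exact: (measurableT_comp measurable_fst measurable_snd).
    + exact: (measurableT_comp measurable_snd measurable_fst).
    + by apply: measurable_funM => //; exact: (measurableT_comp measurable_snd measurable_snd).
  exact: (measurableT_comp mf m).
- exact: rintZ.
- by move=> w; exact: (L2M f2 (L2Z (k w.1 * k w.2) (tr_L2 (- (e * w.1), - (e * w.2)) f2))).
move=> w /=; set v := (- _, - _).
have lf : L2 mu2 (fun z => `|f z|).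
  by apply: (L2_le mu2 f) => // [|z]; [exact: measurableT_comp|rewrite normr_id].
have -> : \int[lebp]_z `|f z * (k w.1 * k w.2 * tr v f z)| =
    k w.1 * k w.2 * ip mu2 (fun z => `|f z|) (tr v (fun z => `|f z|)).
  rewrite -ipZr//; last exact: tr_L2.
  by apply: eq_Rintegral => z _; rewrite normrM [X in _ * X]normrM (ger0_norm (kk_ge0 w)).
rewrite mulrC ler_wpM2r//.
have := cauchy_abs lf (tr_L2 v lf); rewrite tr_n2// -sqrtrM ?n2_ge0// -expr2 sqrtr_sqr.
move=> h; apply: (le_trans (ler_norm _)); apply: (le_trans h).
rewrite ger0_norm ?n2_ge0// !n2E; apply: eq_ler; apply: eq_Rintegral => z _.
by rewrite real_normK// num_real.
Qed.

Let inner_A e w : \int[mu2]_z (f z * (k w.1 * k w.2 * tr (- (e * w.1), - (e * w.2)) f z)) =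
  k w.1 * k w.2 * A (- (e * w.1), - (e * w.2)).
Proof. by rewrite -(ipZr _ (tr_L2 _ f2) f2). Qed.

(** The constant is [(2 pi)^-2 * 4], the inverse of the mass [pi^2] of the kernel, so [J e] is a
    genuine average of [A]. *)
Let J3 e : 0 < e -> rint mu2 (fun w => k w.1 * k w.2 * A (- (e * w.1), - (e * w.2))) /\
  J e = (pi ^- 2) * \int[mu2]_w (k w.1 * k w.2 * A (- (e * w.1), - (e * w.2))).
Proof.
move=> e0; have i := joint e0.
have L z : f z * \int[mu2]_w (f w * (poisson e (z.1 - w.1) * poisson e (z.2 - w.2))) =
    4 * \int[mu2]_w (f z * (k w.1 * k w.2 * tr (- (e * w.1), - (e * w.2)) f z)).
  by rewrite (J2 z e0) RintegralZl//; [ring|exact: ktr].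
have [h1 _] := rint_fubini1 i; have [h2 _] := rint_fubini2 i.
have := Rfubini i; move: h1 h2 => /= h1.
under eq_fun do rewrite inner_A.
move=> h2 E; split => //.
rewrite (J1 e0); under eq_Rintegral do rewrite L.
rewrite RintegralZl// E; move: (\int[_]_(_ in _) _) => I.
by rewrite expr2 -invfM mulrA; move: (pi : R) (pi_gt0 R) => p /gt_eqF/negbT p00; field.
Qed.

Let kk : \int[mu2]_w (k w.1 * k w.2) = pi ^+ 2.
Proof. by have [h E] := @rint_oneDsqrV R; rewrite (Rintegral_tensor h h) !E. Qed.

Let kk_n2 : pi ^- 2 * (\int[mu2]_w (k w.1 * k w.2 * n2 mu2 f)) = n2 mu2 f.
Proof. by rewrite RintegralZr// kk mulrA mulVf ?mul1r// expf_neq0// gt_eqF// pi_gt0. Qed.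

Let ikk_n2 : rint mu2 (fun w => k w.1 * k w.2 * n2 mu2 f).
Proof. by under eq_fun do rewrite mulrC; exact: rintZ. Qed.

Let J_le e : 0 < e -> J e <= n2 mu2 f.
Proof.
move=> e0; have [i ->] := J3 e0; rewrite -[leRHS]kk_n2 ler_pM2l ?invr_gt0 ?exprn_gt0 ?pi_gt0//.
apply: le_Rintegral => // w _; rewrite ler_wpM2l//.
exact: le_trans (ler_norm _) (A_le _).
Qed.

Let J_cvg : (fun n => J n.+1%:R^-1) @ \oo --> n2 mu2 f.
Proof.
have e0 n : 0 < n.+1%:R^-1 :> R by [].
apply: (eq_cvgn (fun n => (J3 (e0 n)).2)).
apply: (cvgn_eq kk_n2).
apply: cvgM; first exact: cvg_cst.
apply: (dct mu2 (fun n w => k w.1 * k w.2 * A (- (n.+1%:R^-1 * w.1), - (n.+1%:R^-1 * w.2)))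
  _ (fun w => k w.1 * k w.2 * n2 mu2 f) _ _ _ _ _).2.
- by move=> n; exact: rint_measurable (J3 (e0 n)).1.
- by under eq_fun do rewrite mulrC; exact: rintZ.
- by move=> n w; rewrite normrM (ger0_norm (kk_ge0 _)) ler_wpM2l.
- apply: aeW => w; apply: cvgM; first exact: cvg_cst.
  have c (x : R) : (fun n => - (n.+1%:R^-1 * x)) @ \oo --> (0 : R).
    apply: (@cvgn_eq _ (- (0 * x))); first by rewrite mul0r oppr0.
    by apply: cvgN; apply: cvgM; [exact: cvg_harmonic|exact: cvg_cst].
  have b (x : R) n : `|- (n.+1%:R^-1 * x)| <= `|x|.
    by rewrite normrN normrM ler_piMl// ger0_norm// invf_le1// ler1n.
  apply: (ip_cvg (fun=> f2) _ f2 f2 (cvg2_cst mu2 f)); first by move=> n; exact: tr_L2.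
  apply: (@tr_cvg _ _ (`|w.1| + `|w.2|)) => //= [n|n].
  + by rewrite (le_trans (b _ _))// lerDl.
  + by rewrite (le_trans (b _ _))// lerDr.
- exact: rint_measurable ikk_n2.
Qed.

Let CS_ge0 zeta : 0 <= Cf f zeta ^+ 2 + Sf f zeta ^+ 2.
Proof. by rewrite addr_ge0 ?sqr_ge0. Qed.

Let mCS : measurable_fun setT (fun zeta : plane R => Cf f zeta ^+ 2 + Sf f zeta ^+ 2 : measurableTypeR R).
Proof. by apply: measurable_funD; exact: measurable_funX. Qed.

Let damp_CS (n : nat) zeta : 0 <= damp n.+1%:R^-1 zeta * (Cf f zeta ^+ 2 + Sf f zeta ^+ 2) <=
  Cf f zeta ^+ 2 + Sf f zeta ^+ 2.
Proof.
rewrite mulr_ge0 ?(ltW (damp_gt0 _ _))//= ler_piMl// -[leRHS]mulr1.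
by rewrite ler_pM ?expR_ge0// -expR0 ler_expR oppr_le0 mulr_ge0.
Qed.

Let damp_CS_cvg zeta : (fun n => damp n.+1%:R^-1 zeta * (Cf f zeta ^+ 2 + Sf f zeta ^+ 2)) @ \oo -->
  Cf f zeta ^+ 2 + Sf f zeta ^+ 2.
Proof.
have h (t : R) : (fun n : nat => expR (- (n.+1%:R^-1 * t))) @ \oo --> (1 : R).
  rewrite -[X in _ --> X](@expR0 R); apply: continuous_cvg; first exact: continuous_expR.
  rewrite -[X in _ --> X]oppr0.
  apply: cvgN; rewrite -[X in _ --> X](mul0r t); apply: cvgM; last exact: cvg_cst.
  exact: cvg_harmonic.
apply: (cvgn_eq (mul1r _)); apply: cvgM; last exact: cvg_cst.
by apply: (cvgn_eq (mul1r 1)); apply: cvgM.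
Qed.

(** The uniform bound on [J] and Fatou's lemma give integrability as the damping disappears. *)
Let rint_CS : rint mu2 (fun zeta => Cf f zeta ^+ 2 + Sf f zeta ^+ 2).
Proof.
apply: (@rint_fatou _ _ _ mu2 (fun n zeta => damp n.+1%:R^-1 zeta * (Cf f zeta ^+ 2 + Sf f zeta ^+ 2))
  _ (n2 mu2 f)) => //.
- move=> n; apply: (idamp (B := M ^+ 2 + M ^+ 2)) => // zeta.
  have hC := Cf_le zeta f1; have hS := Sf_le zeta f1; rewrite -/M in hC hS.
  have M0 : 0 <= M := le_trans (normr_ge0 _) hC.
  rewrite (ger0_norm (CS_ge0 zeta)) -[Cf f zeta ^+ 2]real_normK ?num_real//.
  rewrite -[Sf f zeta ^+ 2]real_normK ?num_real//.
  by apply: lerD; rewrite ler_pXn2r.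
- by move=> n x; have /andP[] := damp_CS n x.
- by move=> n; exact: J_le.
Qed.

(** Being integrable, [Cf^2 + Sf^2] dominates its damped versions, so [J] tends to its integral; the
    other limit of [J] is [n2 f]. *)
Lemma plancherel_rint : [/\ L2 mu2 (Cf f), L2 mu2 (Sf f) & n2 mu2 (Cf f) + n2 mu2 (Sf f) = n2 mu2 f].
Proof.
have lC : L2 mu2 (Cf f).
  split=> //; apply: (rint_le mu2 (fun zeta => Cf f zeta ^+ 2 + Sf f zeta ^+ 2)) => //.
    exact: measurable_funX.
  by move=> z; rewrite ger0_norm ?sqr_ge0// lerDl sqr_ge0.
have lS : L2 mu2 (Sf f).
  split=> //; apply: (rint_le mu2 (fun zeta => Cf f zeta ^+ 2 + Sf f zeta ^+ 2)) => //.
    exact: measurable_funX.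
  by move=> z; rewrite ger0_norm ?sqr_ge0// lerDr sqr_ge0.
split=> //; rewrite !n2E -RintegralD//; [|exact: lC.2|exact: lS.2].
have mF n : measurable_fun setT (fun zeta : plane R =>
    damp n.+1%:R^-1 zeta * (Cf f zeta ^+ 2 + Sf f zeta ^+ 2) : measurableTypeR R).
  by apply: measurable_funM => //; exact: damp_measurable.
have le n x : `|damp n.+1%:R^-1 x * (Cf f x ^+ 2 + Sf f x ^+ 2)| <= Cf f x ^+ 2 + Sf f x ^+ 2.
  by have /andP[h1 h2] := damp_CS n x; rewrite ger0_norm.
have ac : {ae mu2, forall zeta, (fun n => damp n.+1%:R^-1 zeta * (Cf f zeta ^+ 2 + Sf f zeta ^+ 2))
    @ \oo --> Cf f zeta ^+ 2 + Sf f zeta ^+ 2} by apply: aeW.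
by rewrite -n2E; exact: (cvg_unique _ (dct mu2 _ _ _ mF rint_CS le ac mCS).2 J_cvg).
Qed.

End plancherel.
End fourier_integral.

(** * The Fourier transform on L^2 *)

Section fourier_L2.
Context {R : realType}.
Local Notation leb1 := (@lebesgue_measure R).
Local Notation mu2 := (@lebesgue_measure R \x @lebesgue_measure R)%E.
Implicit Types (u v f g A B : R * R -> R) (a z zeta w : R * R) (c : R).

Lemma boxE n : box n = `[- n%:R, n%:R]%classic `*` `[- n%:R, n%:R]%classic :> set (R * R).
Proof. by apply/seteqP; split => -[x y]; rewrite /box /setX /= !in_itv/= !ler_norml. Qed.

Lemma box_measurable n : measurable (box n : set (plane R)).
Proof. by rewrite boxE; exact: measurableX. Qed.

Lemma box_indic n z : \1_(box n) z =
  \1_(`[- n%:R, n%:R]%classic : set R) z.1 * \1_(`[- n%:R, n%:R]%classic : set R) z.2 :> R.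
Proof. by rewrite boxE !indicE -natrM mulnb in_setX. Qed.

Lemma indic_norm_le1 (T : Type) (D : set T) (x : T) : `|\1_D x : R| <= 1.
Proof. by rewrite indicE normr_nat; case: (_ \in _). Qed.

Lemma L2_box_indic n : L2 mu2 (\1_(box n) : R * R -> R).
Proof. have -> := funext (box_indic n); exact: L2_rect. Qed.

Lemma L2_box f n : L2 mu2 f ->
  L2 mu2 (fun z => \1_(box n) z * f z) /\ rint mu2 (fun z => \1_(box n) z * f z).
Proof.
move=> lf; split; last exact: (L2M (L2_box_indic n) lf).
apply: (L2_bounded mu2 1 (L2_measurable (L2_box_indic n)) _ lf) => z.
exact: indic_norm_le1.
Qed.

Lemma box_cvg f : L2 mu2 f -> cvg2 mu2 (fun n z => \1_(box n) z * f z) f.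
Proof.
move=> lf; apply: (L2_dct mu2 _ f f _ (L2_measurable lf) lf _ _).2.
- by move=> n; exact: (L2_measurable (L2_box n lf).1).
- by move=> n x; rewrite normrM ler_piMl// indic_norm_le1.
apply: aeW => z; apply: cvg_near_cst.
pose N := (Num.trunc (Num.max `|z.1| `|z.2|)).+1.
have h : Num.max `|z.1| `|z.2| < N%:R by exact: truncnS_gt.
exists N => // n /= Nn; rewrite indicE mem_set ?mul1r//.
have hn : Num.max `|z.1| `|z.2| <= n%:R by rewrite (le_trans (ltW h))// ler_nat.
by move: hn; rewrite ge_max => /andP[].
Qed.

Lemma cvg2_eq (fs gs : nat -> R * R -> R) f :
  (forall n z, fs n z = gs n z) -> cvg2 mu2 gs f -> cvg2 mu2 fs f.
Proof. by move=> e; have -> : fs = gs by do 2 apply/funext => ?; rewrite e. Qed.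

(* [A] and [B] are the real and imaginary parts of the Fourier transform of [u] *)
Definition is_ft u A B := [/\ L2 mu2 u, L2 mu2 A, L2 mu2 B & exists gs,
  [/\ forall n, rint mu2 (gs n) /\ L2 mu2 (gs n), cvg2 mu2 gs u,
      cvg2 mu2 (fun n => Cf (gs n)) A & cvg2 mu2 (fun n z => - Sf (gs n) z) B]].

Lemma ft_L2 u A B : is_ft u A B -> L2 mu2 u. Proof. by case. Qed.
Lemma ft_L2r u A B : is_ft u A B -> L2 mu2 A. Proof. by case. Qed.
Lemma ft_L2i u A B : is_ft u A B -> L2 mu2 B. Proof. by case. Qed.

Lemma Cf_L2 g : rint mu2 g -> L2 mu2 g -> L2 mu2 (Cf g).
Proof. by move=> g1 g2; have [] := plancherel_rint g1 g2. Qed.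

Lemma Sf_L2 g : rint mu2 g -> L2 mu2 g -> L2 mu2 (Sf g).
Proof. by move=> g1 g2; have [] := plancherel_rint g1 g2. Qed.

Lemma ft_rint g : rint mu2 g -> L2 mu2 g -> is_ft g (Cf g) (fun z => - Sf g z).
Proof.
move=> g1 g2; split => //; [exact: Cf_L2|exact/L2N/Sf_L2|].
by exists (fun=> g); split => //; exact: cvg2_cst.
Qed.

Lemma ftD c u A B v A' B' : is_ft u A B -> is_ft v A' B' ->
  is_ft (fun z => u z + c * v z) (fun z => A z + c * A' z) (fun z => B z + c * B' z).
Proof.
move=> [lu lA lB [fs [hf cu cA cB]]] [lv lA' lB' [gs [hg cv cA' cB']]].
have h n := (hf n).1; have h' n := (hf n).2; have k n := (hg n).1; have k' n := (hg n).2.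
split; [exact/L2D/L2Z|exact/L2D/L2Z|exact/L2D/L2Z|].
exists (fun n z => fs n z + c * gs n z); split.
- by move=> n; split; [exact/rintD/rintZ|exact/L2D/L2Z].
- by apply: cvg2D => // [n||]; [exact: L2Z|exact: L2Z|exact: cvg2Z].
- apply: (cvg2_eq (fun n zeta => CfD zeta c (h n) (k n))).
  by apply: cvg2D => // [n|n||]; [exact: Cf_L2|exact/L2Z/Cf_L2|exact: L2Z|
    apply: cvg2Z => // n; exact: Cf_L2].
- apply: (@cvg2_eq _ (fun n z => - Sf (fs n) z + c * - Sf (gs n) z)).
    by move=> n zeta; rewrite SfD// opprD mulrN.
  by apply: cvg2D => // [n|n||]; [exact/L2N/Sf_L2|exact/L2Z/L2N/Sf_L2|exact: L2Z|
    apply: cvg2Z => // n; exact/L2N/Sf_L2].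
Qed.

Lemma ft_n2 u A B : is_ft u A B -> n2 mu2 u = n2 mu2 A + n2 mu2 B.
Proof.
move=> [lu lA lB [fs [hf cu cA cB]]].
have h n := (hf n).1; have h' n := (hf n).2.
have c1 := n2_cvg h' lu cu.
have c2 := n2_cvg (fun n => Cf_L2 (h n) (h' n)) lA cA.
have c3 := n2_cvg (fun n => L2N (Sf_L2 (h n) (h' n))) lB cB.
apply: (cvg_unique _ c1) => //; apply: eq_cvgn (cvgD c2 c3) => n.
by rewrite fctE n2N; have [_ _ ->] := plancherel_rint (h n) (h' n).
Qed.

(** Polarisation of [ft_n2] along [u + v]. For real [u] and [v] Parseval's formula reduces to its
    real part. *)
Lemma ft_ip u A B v A' B' : is_ft u A B -> is_ft v A' B' ->
  ip mu2 u v = ip mu2 A A' + ip mu2 B B'.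
Proof.
move=> hu hv.
have := ft_n2 (ftD 1 hu hv); rewrite !n2D ?(ft_n2 hu); last 6 first.
all: try by (apply: L2Z || idtac); (exact: (ft_L2 hu)||exact: (ft_L2r hu)||exact: (ft_L2i hu)
  ||exact: (ft_L2 hv)||exact: (ft_L2r hv)||exact: (ft_L2i hv)).
rewrite !ipZr ?n2Z ?(ft_n2 hv); last 9 first.
all: try by (exact: (ft_L2 hu)||exact: (ft_L2r hu)||exact: (ft_L2i hu)
  ||exact: (ft_L2 hv)||exact: (ft_L2r hv)||exact: (ft_L2i hv)).
lra.
Qed.

Lemma ft_ae u v A A' B B' : is_ft u A B ->
  measurable_fun setT (v : plane R -> R) -> measurable_fun setT (A' : plane R -> R) ->
  measurable_fun setT (B' : plane R -> R) ->
  {ae mu2, forall z, u z = v z} -> {ae mu2, forall z, A z = A' z} ->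
  {ae mu2, forall z, B z = B' z} -> is_ft v A' B'.
Proof.
have key (fs : nat -> R * R -> R) f f' : (forall n, L2 mu2 (fs n)) -> L2 mu2 f -> L2 mu2 f' ->
    {ae mu2, forall z, f z = f' z} -> cvg2 mu2 fs f -> cvg2 mu2 fs f'.
  move=> lfs lf lf' e; apply: eq_cvgn => n; apply: n2_ae.
  - exact/L2_measurable/L2B.
  - exact/L2_measurable/L2B.
  - by apply: aeS e => z ->.
move=> [lu lA lB [fs [hf cu cA cB]]] mv mA mB eu eA eB.
have h n := (hf n).1; have h' n := (hf n).2.
have lv := L2_ae mv eu lu; have lA' := L2_ae mA eA lA; have lB' := L2_ae mB eB lB.
split => //; exists fs; split => //.
- exact: key eu cu.
- by apply: key eA cA => // n; exact: Cf_L2.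
- by apply: key eB cB => // n; exact/L2N/Sf_L2.
Qed.

Lemma ft_zero u A B : is_ft u A B -> {ae mu2, forall z, u z = 0} ->
  {ae mu2, forall z, A z = 0} /\ {ae mu2, forall z, B z = 0}.
Proof.
move=> h u0; have := ft_n2 h.
have -> : n2 mu2 u = 0.
  by rewrite -(n2_0 mu2); apply: n2_ae => //; exact/L2_measurable/(ft_L2 h).
have := n2_ge0 mu2 A; have := n2_ge0 mu2 B => b0 a0 e.
move/esym/eqP: e; rewrite paddr_eq0// => /andP[/eqP eA /eqP eB].
by split; apply: n2_eq0 => //; [exact: ft_L2r h|exact: ft_L2i h].
Qed.

Lemma ft_unique u v A B A' B' : is_ft u A B -> is_ft v A' B' -> {ae mu2, forall z, u z = v z} ->
  {ae mu2, forall z, A z = A' z} /\ {ae mu2, forall z, B z = B' z}.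
Proof.
move=> h h' e; have [|eA eB] := ft_zero (ftD (-1) h h').
  by apply: aeS e => z ->; ring.
by split; [apply: aeS eA|apply: aeS eB] => z /eqP; rewrite mulN1r subr_eq0 => /eqP.
Qed.

(** An L^2-Lipschitz operator that multiplies the Fourier integrals by the bounded symbol
    [mr + i mi] does so on all of L^2, by passing to the limit along the approximating sequence.
    Translations and convolutions are the two instances. *)
Lemma ft_multiplier (K : (R * R -> R) -> R * R -> R) (mr mi : R * R -> R) c M :
  measurable_fun setT (mr : plane R -> R) -> measurable_fun setT (mi : plane R -> R) ->
  (forall z, `|mr z| <= c) -> (forall z, `|mi z| <= c) ->
  (forall f, L2 mu2 f -> L2 mu2 (K f)) ->
  (forall f g, L2 mu2 f -> L2 mu2 g ->
    n2 mu2 (fun z => K f z - K g z) <= M * n2 mu2 (fun z => f z - g z)) ->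
  (forall g, rint mu2 g -> L2 mu2 g -> [/\ rint mu2 (K g),
    forall zeta, Cf (K g) zeta = mr zeta * Cf g zeta + mi zeta * Sf g zeta &
    forall zeta, Sf (K g) zeta = mr zeta * Sf g zeta - mi zeta * Cf g zeta]) ->
  forall u A B, is_ft u A B ->
  is_ft (K u) (fun z => mr z * A z - mi z * B z) (fun z => mr z * B z + mi z * A z).
Proof.
move=> mmr mmi rb ib KL KM Kg u A B [lu lA lB [fs [hf cu cA cB]]].
have h n := (hf n).1; have h' n := (hf n).2.
have lC n := Cf_L2 (h n) (h' n); have lS n := L2N (Sf_L2 (h n) (h' n)).
have br f (lf : L2 mu2 f) := L2_bounded mu2 c mmr rb lf.
have bi f (lf : L2 mu2 f) := L2_bounded mu2 c mmi ib lf.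
split; [exact: KL|exact: (L2B (br _ lA) (bi _ lB))|exact: (L2D (br _ lB) (bi _ lA))|].
exists (fun n => K (fs n)); split.
- by move=> n; split; [have [] := Kg _ (h n) (h' n)|exact: KL].
- apply: squeeze0 (cvgn_eq (mulr0 M) (cvgM (cvg_cst M) cu)) => n.
  by rewrite n2_ge0/=; exact: KM.
- apply: (@cvg2_eq _ (fun n z => mr z * Cf (fs n) z - mi z * - Sf (fs n) z)).
    by move=> n z; have [_ -> _] := Kg _ (h n) (h' n); rewrite mulrN opprK.
  exact: (cvg2B (fun n => br _ (lC n)) (fun n => bi _ (lS n)) (br _ lA) (bi _ lB)
    (cvg2_bounded mu2 c mmr rb lC lA cA) (cvg2_bounded mu2 c mmi ib lS lB cB)).
- apply: (@cvg2_eq _ (fun n z => mr z * - Sf (fs n) z + mi z * Cf (fs n) z)).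
    by move=> n z; have [_ _ ->] := Kg _ (h n) (h' n); ring.
  exact: (cvg2D (fun n => br _ (lS n)) (fun n => bi _ (lC n)) (br _ lB) (bi _ lA)
    (cvg2_bounded mu2 c mmr rb lS lB cB) (cvg2_bounded mu2 c mmi ib lC lA cA)).
Qed.

Lemma Cf_tr a g zeta : rint mu2 g ->
  Cf (tr a g) zeta = cos (dot a zeta) * Cf g zeta + sin (dot a zeta) * Sf g zeta.
Proof.
move=> g1; rewrite /Cf /Sf.
(* [cos y = cos ((y + a) - a)] exhibits the integrand as the translate of a combination of [g cos]
   and [g sin]. *)
transitivity ((2 * pi)^-1 * \int[mu2]_z (tr a (fun z => cos (dot a zeta) * (g z * cos (dot z zeta)) +
    sin (dot a zeta) * (g z * sin (dot z zeta))) z)).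
  congr (_ * _); apply: eq_Rintegral => z _; rewrite /tr.
  have -> : dot (z.1 + a.1, z.2 + a.2) zeta = dot z zeta + dot a zeta by rewrite /dot/=; ring.
  rewrite cosD sinD; have := cos2Dsin2 (dot a zeta); move: (cos _) (sin _) => C S CS.
  rewrite -[X in g _ * X]mul1r -CS; ring.
rewrite tr_Rintegral; last by apply: rintD; apply: rintZ; [exact: rint_cos|exact: rint_sin].
rewrite RintegralD//; last 2 first.
- by apply: rintZ; exact: rint_cos.
- by apply: rintZ; exact: rint_sin.
rewrite RintegralZl//; last exact: rint_cos.
by rewrite RintegralZl//; [ring|exact: rint_sin].
Qed.

Lemma Sf_tr a g zeta : rint mu2 g ->
  Sf (tr a g) zeta = cos (dot a zeta) * Sf g zeta - sin (dot a zeta) * Cf g zeta.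
Proof.
move=> g1; rewrite /Cf /Sf.
transitivity ((2 * pi)^-1 * \int[mu2]_z (tr a (fun z => cos (dot a zeta) * (g z * sin (dot z zeta)) +
    - sin (dot a zeta) * (g z * cos (dot z zeta))) z)).
  congr (_ * _); apply: eq_Rintegral => z _; rewrite /tr.
  have -> : dot (z.1 + a.1, z.2 + a.2) zeta = dot z zeta + dot a zeta by rewrite /dot/=; ring.
  rewrite cosD sinD; have := cos2Dsin2 (dot a zeta); move: (cos _) (sin _) => C S CS.
  rewrite -[X in g _ * X]mul1r -CS; ring.
rewrite tr_Rintegral; last by apply: rintD; apply: rintZ; [exact: rint_sin|exact: rint_cos].
rewrite RintegralD//; last 2 first.
- by apply: rintZ; exact: rint_sin.
- by apply: rintZ; exact: rint_cos.
rewrite RintegralZl//; last exact: rint_sin.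
by rewrite RintegralZl//; [ring|exact: rint_cos].
Qed.

Lemma ft_tr a u A B : is_ft u A B ->
  is_ft (tr a u) (fun z => cos (dot a z) * A z - sin (dot a z) * B z)
    (fun z => cos (dot a z) * B z + sin (dot a z) * A z).
Proof.
have md := measurableT_comp dot_measurable2 (measurable_pair1 a).
apply: (@ft_multiplier (tr a) (fun z => cos (dot a z)) (fun z => sin (dot a z)) 1 1).
- exact: (measurableT_comp cos_measurable md).
- exact: (measurableT_comp sin_measurable md).
- by move=> z; exact: cos_abs_le1.
- by move=> z; exact: sin_abs_le1.
- by move=> f; exact: tr_L2.
- by move=> f g lf lg; rewrite mul1r -(tr_n2 a (L2B lf lg)).
move=> g g1 g2; split; first exact: tr_rint.
- by move=> zeta; exact: Cf_tr.
- by move=> zeta; exact: Sf_tr.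
Qed.

End fourier_L2.

(** * Agreement with the transform defined by truncation *)

Section fourier_bridge.
Context {R : realType}.
Local Notation leb1 := (@lebesgue_measure R).
Local Notation mu2 := (@lebesgue_measure R \x @lebesgue_measure R)%E.
Local Notation normc := ComplexField.Normc.normc.
Implicit Types (u v f g A B : R * R -> R) (U : R * R -> R[i]) (a z zeta w : R * R) (c : R).

Lemma ftB u A B v A' B' : is_ft u A B -> is_ft v A' B' ->
  is_ft (fun z => u z - v z) (fun z => A z - A' z) (fun z => B z - B' z).
Proof.
have E f g : (fun z => f z + -1 * g z) = (fun z => f z - g z).
  by apply/funext => z; rewrite mulN1r.
by move=> h h'; have := ftD (-1) h h'; rewrite !E.
Qed.

Lemma ftZ c u A B : is_ft u A B ->
  is_ft (fun z => c * u z) (fun z => c * A z) (fun z => c * B z).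
Proof.
have E f : (fun z => f z + (c - 1) * f z) = (fun z => c * f z).
  by apply/funext => z; ring.
by move=> h; have := ftD (c - 1) h h; rewrite !E.
Qed.

Lemma L2normE f : L2norm f = ((\int[mu2]_z (f z ^+ 2)%:E) `^ 2^-1)%E.
Proof.
rewrite /L2norm unlock; congr (_ `^ _)%E; apply: eq_integral => z _ /=.
by rewrite -[2]/(2%:R) powR_mulrn// real_normK ?num_real.
Qed.

Lemma L2norm_n2 f : L2 mu2 f -> L2norm f = (Num.sqrt (n2 mu2 f))%:E.
Proof.
move=> lf; rewrite L2normE n2E (rint_fin lf.2) poweR_EFin powR12_sqrt// Rintegral_ge0// => z _.
exact: sqr_ge0.
Qed.

Lemma L2norm_fin f : measurable_fun setT (f : plane R -> R) -> (L2norm f < +oo)%E -> L2 mu2 f.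
Proof.
move=> mf; rewrite L2normE => h; split=> //; apply: rint_lty; first exact: measurable_funX.
under eq_integral do rewrite ger0_norm ?sqr_ge0//.
by apply: (lty_poweRy _ h); rewrite invr_neq0.
Qed.

Lemma isL2P f : isL2 f <-> L2 mu2 f.
Proof.
split.
  move=> /andP[]; rewrite !inE/= => mf ff; exact: L2norm_fin.
move=> lf; apply/andP; rewrite !inE/=; split; first exact: L2_measurable lf.
by rewrite /finite_norm -/(L2norm f) L2norm_n2// ltry.
Qed.

Lemma L2norm_cvg0 (fs : nat -> R * R -> R) : (forall n, L2 mu2 (fs n)) ->
  L2norm (fs n) @[n --> \oo] --> 0%E <-> (fun n => n2 mu2 (fs n)) @ \oo --> (0 : R).
Proof.
move=> l; have E n : L2norm (fs n) = (Num.sqrt (n2 mu2 (fs n)))%:E by rewrite L2norm_n2.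
under eq_fun do rewrite E.
split => [/fine_cvgP[_] h|h].
  apply: eq_cvgn (cvgn_eq (mulr0 0) (cvgM h h)) => n.
  by rewrite fctE /= -expr2 sqr_sqrtr// n2_ge0.
apply/fine_cvgP; split; first exact: nearW.
by apply: sqrt_cvg0 => // n; exact: n2_ge0.
Qed.

Lemma Rintegral_indic (D : set (plane R)) (f : plane R -> R) : measurable D ->
  \int[mu2]_(z in D) f z = \int[mu2]_z (\1_D z * f z).
Proof.
move=> mD; rewrite Rintegral_mkcond; apply: eq_Rintegral => z _.
by rewrite patch_indic mulrC.
Qed.

Lemma trunc_fourierE u n zeta : trunc_fourier u n zeta =
  Cf (fun z => \1_(box n) z * u z) zeta +i* (- Sf (fun z => \1_(box n) z * u z) zeta).
Proof.
have h (t : plane R -> R) : \int[mu2]_(z in box n) (u z * t z) =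
    \int[mu2]_z (\1_(box n) z * u z * t z).
  by rewrite (Rintegral_indic _ (box_measurable n)); apply: eq_Rintegral => z _; rewrite mulrA.
by congr (_ * _ +i* - (_ * _)); exact: h.
Qed.

Lemma normc_sqr (x : R[i]) : normc x ^+ 2 = complex.Re x ^+ 2 + complex.Im x ^+ 2.
Proof. by case: x => a b; rewrite /normc sqr_sqrtr// addr_ge0 ?sqr_ge0. Qed.

Lemma normc_ge0 (x : R[i]) : 0 <= normc x.
Proof. by case: x => a b; exact: sqrtr_ge0. Qed.

Lemma normc_L2 (A B : R * R -> R) : L2 mu2 A -> L2 mu2 B ->
  L2 mu2 (fun z => normc (A z +i* B z)) /\
  n2 mu2 (fun z => normc (A z +i* B z)) = n2 mu2 A + n2 mu2 B.
Proof.
move=> lA lB; have E z : normc (A z +i* B z) ^+ 2 = A z ^+ 2 + B z ^+ 2 by rewrite normc_sqr.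
split; last by rewrite !n2E; under eq_Rintegral do rewrite E; rewrite RintegralD//; [exact: lA.2|exact: lB.2].
split; last by under eq_fun do rewrite E; exact: (rintD lA.2 lB.2).
apply: (measurableT_comp (continuous_measurable_fun (@sqrt_continuous R))).
by apply: measurable_funD; apply: measurable_funX; [exact: L2_measurable lA|exact: L2_measurable lB].
Qed.

(** The definition prescribes the truncations of [u] to boxes, whereas [is_ft] accepts any
    approximating sequence. By Plancherel applied to a truncation minus [u], the transforms of the
    truncations converge as fast as the truncations themselves, so both notions agree. *)
Lemma is_fourierP u U :
  is_fourier u U <-> is_ft u (@complex.Re R \o U) (@complex.Im R \o U).
Proof.
have E n zeta : normc (U zeta - trunc_fourier u n zeta) =
    normc ((complex.Re (U zeta) - Cf (fun z => \1_(box n) z * u z) zeta) +i*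
      (complex.Im (U zeta) - - Sf (fun z => \1_(box n) z * u z) zeta)).
  by rewrite trunc_fourierE; case: (U zeta).
have key A B n : L2 mu2 u -> L2 mu2 A -> L2 mu2 B ->
    L2 mu2 (fun z => normc ((A z - Cf (fun z => \1_(box n) z * u z) z) +i*
      (B z - - Sf (fun z => \1_(box n) z * u z) z))) /\ 
    n2 mu2 (fun z => normc ((A z - Cf (fun z => \1_(box n) z * u z) z) +i*
      (B z - - Sf (fun z => \1_(box n) z * u z) z))) =
    n2 mu2 (fun z => Cf (fun z => \1_(box n) z * u z) z - A z) +
    n2 mu2 (fun z => - Sf (fun z => \1_(box n) z * u z) z - B z).
  move=> lu lA lB; have [l2 l1] := L2_box n lu.
  have [l e] := normc_L2 (L2B lA (Cf_L2 l1 l2)) (L2B lB (L2N (Sf_L2 l1 l2))).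
  by split => //; rewrite e n2BC [X in _ + X]n2BC.
split.
- move=> [/isL2P lu /isL2P lA /isL2P lB h]; split=> //; exists (fun n z => \1_(box n) z * u z).
  have {}h : (fun n => n2 mu2 (fun z => Cf (fun z => \1_(box n) z * u z) z - complex.Re (U z)) +
      n2 mu2 (fun z => - Sf (fun z => \1_(box n) z * u z) z - complex.Im (U z))) @ \oo --> (0 : R).
    apply: eq_cvgn (fun n => esym (key (@complex.Re R \o U) (@complex.Im R \o U) n lu lA lB).2) _.
    apply/L2norm_cvg0; first by move=> n; exact: (key _ _ n lu lA lB).1.
    by move: h; under eq_fun do (under [X in L2norm X]eq_fun do rewrite E).
  split => [n|||]; first by have [] := L2_box n lu.
  - exact: box_cvg.
  - by apply: squeeze0 h => n; rewrite n2_ge0 lerDl n2_ge0.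
  - by apply: squeeze0 h => n; rewrite n2_ge0 lerDr n2_ge0.
- move=> h; have lu := ft_L2 h; have lA := ft_L2r h; have lB := ft_L2i h.
  split; [exact/isL2P|exact/isL2P|exact/isL2P|]; under eq_fun do (under [X in L2norm X]eq_fun do rewrite E).
  apply/L2norm_cvg0; first by move=> n; exact: (key _ _ n lu lA lB).1.
  apply: eq_cvgn (box_cvg lu) => n; rewrite (key _ _ n lu lA lB).2.
  have [l2 l1] := L2_box n lu.
  by rewrite (ft_n2 (ftB (ft_rint l1 l2) h)).
Qed.

End fourier_bridge.

(** Measurability alone is assumed of [f]: the inner integral is the difference of those of the
    positive and negative parts, each measurable by Tonelli. *)
Lemma Rintegral_measurable1 d1 d2 (T1 : measurableType d1) (T2 : measurableType d2) (R : realType)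
    (m2 : {sigma_finite_measure set T2 -> \bar R}) (f : T1 * T2 -> R) :
  measurable_fun setT f -> measurable_fun setT (fun x => \int[m2]_y f (x, y)).
Proof.
move=> mf; apply: (measurableT_comp (f := fine)) => //.
under eq_fun do rewrite integralE.
have mF : measurable_fun setT (EFin \o f) by exact/measurable_EFinP.
apply: emeasurable_funB.
- have := @measurable_fun_fubini_tonelli_F _ _ _ _ _ m2 _ (measurable_funepos mF).
  have -> : (fun x => (\int[m2]_y (fun y0 => (f (x, y0))%:E)^\+ y)%E) =
    (fun x => (\int[m2]_y (EFin \o f)^\+ (x, y))%E) by rewrite unlock.
  by apply => x; exact: funepos_ge0.
- have := @measurable_fun_fubini_tonelli_F _ _ _ _ _ m2 _ (measurable_funeneg mF).
  have -> : (fun x => (\int[m2]_y (fun y0 => (f (x, y0))%:E)^\- y)%E) =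
    (fun x => (\int[m2]_y (EFin \o f)^\- (x, y))%E) by rewrite unlock.
  by apply => x; exact: funeneg_ge0.
Qed.

Lemma rint_le_ae d (T : measurableType d) (R : realType) (mu : {measure set T -> \bar R})
    (f g : T -> R) : measurable_fun setT f -> rint mu g ->
  {ae mu, forall x, `|f x| <= g x} -> rint mu f /\ \int[mu]_x `|f x| <= \int[mu]_x g x.
Proof.
move=> mf gi fg; have mg := rint_measurable gi.
have fi : rint mu f.
  apply: (rint_lty mf); apply: le_lt_trans (rint_ltyP gi).
  apply: ae_ge0_le_integral => //.
  - by apply/measurable_EFinP; exact: measurableT_comp.
  - by apply/measurable_EFinP; exact: measurableT_comp.
  - by apply: aeS fg => x h _; rewrite lee_fin (le_trans h)// ler_norm.
split => //; rewrite -lee_fin -!rint_fin//; last exact: rint_norm.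
have <- : (\int[mu]_x (Num.max (g x) 0)%:E = \int[mu]_x (g x)%:E)%E.
  apply: ae_eq_integral => //.
  - by apply/measurable_EFinP; exact: measurable_maxr.
  - exact/measurable_EFinP.
  - by apply: aeS fg => x h _; rewrite max_l// (le_trans _ h).
apply: ae_ge0_le_integral => //.
- by apply/measurable_EFinP; exact: measurableT_comp.
- by move=> x _; rewrite lee_fin le_max lexx orbT.
- by apply/measurable_EFinP; exact: measurable_maxr.
- by apply: aeS fg => x h _; rewrite lee_fin le_max h.
Qed.

(** * Convolution along a direction *)

Section convolution.
Context {R : realType}.
Local Notation leb1 := (@lebesgue_measure R).
Local Notation mu2 := (@lebesgue_measure R \x @lebesgue_measure R)%E.
Implicit Types (u v f g A B : R * R -> R) (e a z zeta w : R * R) (k : R -> R) (c t : R).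

(** One-dimensional convolution along the vector [e]. It covers the kernels [p] and [p_x] of the
    equation as well as the averages over a step that express finite differences. *)
Definition conv e k f z : R := \int[leb1]_t (k t * tr (- (t * e.1), - (t * e.2)) f z).

Lemma joint_measurable e k f : measurable_fun setT (k : measurableTypeR R -> R) ->
  measurable_fun setT (f : plane R -> R) ->
  measurable_fun setT (fun p : plane R * measurableTypeR R =>
    k p.2 * tr (- (p.2 * e.1), - (p.2 * e.2)) f p.1).
Proof.
move=> mk mf; apply: measurable_funM; first exact: (measurableT_comp mk measurable_snd).
have m : measurable_fun setT (fun p : plane R * measurableTypeR R =>
    (p.1.1 - p.2 * e.1, p.1.2 - p.2 * e.2) : plane R).
  apply: measurable_fun_pair; apply: measurable_funB.
  - exact: (measurableT_comp measurable_fst measurable_fst).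
  - by apply: measurable_funM => //; exact: measurable_snd.
  - exact: (measurableT_comp measurable_snd measurable_fst).
  - by apply: measurable_funM => //; exact: measurable_snd.
exact: (measurableT_comp mf m).
Qed.

Section fixed_kernel.
Variables (e : R * R) (k : R -> R).
Hypothesis k1 : rint leb1 k.
Let mk := rint_measurable k1.
Local Notation s t := (- (t * e.1), - (t * e.2)).
Let K := \int[leb1]_t `|k t|.

Lemma conv_measurable f : measurable_fun setT (f : plane R -> R) ->
  measurable_fun setT (conv e k f : plane R -> R).
Proof. by move=> mf; exact: (Rintegral_measurable1 _ (joint_measurable e mk mf)). Qed.

Lemma rint_joint_sqr f : L2 mu2 f ->
  rint (lebp \x leb1)%E (fun p : plane R * measurableTypeR R =>
    `|k p.2| * tr (s p.2) f p.1 ^+ 2).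
Proof.
move=> lf.
have mf2 : measurable_fun setT (fun z : plane R => f z ^+ 2) by exact: (rint_measurable lf.2).
apply: (@rint21_le _ _ _ _ _ lebp leb1 _ (fun t => n2 mu2 f * `|k t|)).
- have mk' : measurable_fun setT (fun t : measurableTypeR R => `|k t|) by exact: measurableT_comp.
  exact: (joint_measurable e mk' mf2).
- by apply: rintZ; exact: rint_norm.
- by move=> t; exact: (rintZ `|k t| (tr_L2 (s t) lf).2).
move=> t; rewrite mulrC -(tr_n2 (s t) lf) n2E -RintegralZl//; last exact: (tr_L2 (s t) lf).2.
apply: eq_ler; apply: eq_Rintegral => z _.
by rewrite ger0_norm// mulr_ge0// sqr_ge0.
Qed.

(** Cauchy-Schwarz with [|k|] split into two square roots. The right-hand integral is finite for
    almost every [z] by Fubini. *)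
Lemma conv_section f : L2 mu2 f -> {ae mu2, forall z, rint leb1 (fun t => k t * tr (s t) f z) /\
  conv e k f z ^+ 2 <= K * \int[leb1]_t (`|k t| * tr (s t) f z ^+ 2)}.
Proof.
move=> lf; have mf := L2_measurable lf.
apply: aeS (rint_ae1 (rint_joint_sqr lf)) => z /= h.
have mt : measurable_fun setT (fun t : measurableTypeR R => k t * tr (s t) f z).
  exact: (measurableT_comp (joint_measurable e mk mf) (measurable_pair1 z)).
have i : rint leb1 (fun t => k t * tr (s t) f z).
  (* Uses [|k f| <= |k| + |k| f^2]. *)
  apply: (rint_le leb1 _ mt (rintD (rint_norm k1) h)) => t.
  rewrite normrM -[X in _ <= X + _]mulr1 -mulrDr ler_wpM2l//.
  rewrite -[in leRHS]real_normK ?num_real//.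
  by have := normr_ge0 (tr (s t) f z); move: `|_| => y y0; nra.
split => //.
have mt2 : measurable_fun setT (fun t : measurableTypeR R => tr (s t) f z).
  have mx := joint_measurable e (measurable_cst (1 : R)) mf.
  have := measurableT_comp mx (measurable_pair1 z).
  by apply: eq_measurable_fun => t _ /=; rewrite mul1r.
have msq : measurable_fun setT (fun t : measurableTypeR R => Num.sqrt `|k t|).
  apply: (measurableT_comp (continuous_measurable_fun (@sqrt_continuous R))).
  exact: measurableT_comp.
have l1 : L2 leb1 (fun t => Num.sqrt `|k t|).
  by split=> //; under eq_fun do rewrite sqr_sqrtr//; exact: rint_norm.
have l2 : L2 leb1 (fun t => Num.sqrt `|k t| * `|tr (s t) f z|).
  split; first by apply: measurable_funM => //; exact: measurableT_comp.
  by under eq_fun do rewrite exprMn sqr_sqrtr// real_normK ?num_real//.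
have := cauchy l1 l2; rewrite !n2E.
under [X in _ <= X * _ -> _]eq_Rintegral do rewrite sqr_sqrtr//.
under [X in _ <= _ * X -> _]eq_Rintegral do rewrite exprMn sqr_sqrtr// real_normK ?num_real//.
apply: le_trans; rewrite -[leLHS]real_normK ?num_real//.
have E : ip leb1 (fun t => Num.sqrt `|k t|) (fun t => Num.sqrt `|k t| * `|tr (s t) f z|) =
    \int[leb1]_t `|k t * tr (s t) f z|.
  by apply: eq_Rintegral => t _; rewrite mulrA -expr2 sqr_sqrtr// normrM.
rewrite E ler_pXn2r ?nnegrE ?Rintegral_ge0//.
exact: le_normr_Rintegral.
Qed.

(** Young's inequality: the pointwise bound of [conv_section] is integrated in [z], and translations
    preserve [n2]. *)
Lemma conv_L2 f : L2 mu2 f -> L2 mu2 (conv e k f) /\ n2 mu2 (conv e k f) <= K ^+ 2 * n2 mu2 f.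
Proof.
move=> lf; have mc := conv_measurable (L2_measurable lf).
have [h1 h2] := rint_fubini1 (rint_joint_sqr lf).
have E : \int[lebp]_z \int[leb1]_t (`|k t| * tr (s t) f z ^+ 2) = K * n2 mu2 f.
  have := Rfubini (rint_joint_sqr lf) => /= ->.
  rewrite -RintegralZr//; last exact: rint_norm.
  apply: eq_Rintegral => t _; rewrite RintegralZl//; last exact: (tr_L2 (s t) lf).2.
  by rewrite -(tr_n2 (s t) lf) n2E.
have [||h3 h4] := rint_le_ae (mu := mu2) (f := fun z => conv e k f z ^+ 2)
   (g := fun z => K * \int[leb1]_t (`|k t| * tr (s t) f z ^+ 2)) _ (rintZ K h1).
- exact: measurable_funX.
- by apply: aeS (conv_section lf) => z [_]; rewrite ger0_norm ?sqr_ge0.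
split; first by split.
rewrite n2E expr2 -mulrA -E -RintegralZl//; apply: le_trans h4.
by apply: eq_ler; apply: eq_Rintegral => z _; rewrite ger0_norm ?sqr_ge0.
Qed.

Lemma convB f g : L2 mu2 f -> L2 mu2 g ->
  {ae mu2, forall z, conv e k f z - conv e k g z = conv e k (fun z => f z - g z) z}.
Proof.
move=> lf lg; apply: aeS2 (conv_section lf) (conv_section lg) => z [hf _] [hg _].
by rewrite /conv -RintegralB//; apply: eq_Rintegral => t _; rewrite -mulrBr.
Qed.

Lemma conv_lipschitz f g : L2 mu2 f -> L2 mu2 g ->
  n2 mu2 (fun z => conv e k f z - conv e k g z) <= K ^+ 2 * n2 mu2 (fun z => f z - g z).
Proof.
move=> lf lg; apply: le_trans (conv_L2 (L2B lf lg)).2.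
have lc := (conv_L2 (L2B lf lg)).1.
apply: eq_ler; apply: n2_ae; last exact: convB.
- by apply: L2_measurable (L2B (conv_L2 lf).1 (conv_L2 lg).1).
- exact: L2_measurable lc.
Qed.

Lemma conv_ae f g : L2 mu2 f -> L2 mu2 g -> {ae mu2, forall z, f z = g z} ->
  {ae mu2, forall z, conv e k f z = conv e k g z}.
Proof.
move=> lf lg fg; apply: (n2B_eq0 (conv_L2 lf).1 (conv_L2 lg).1).
apply/eqP; rewrite eq_le n2_ge0 andbT (le_trans (conv_lipschitz lf lg))//.
rewrite (_ : n2 _ _ = 0) ?mulr0// -(n2_0 mu2); apply: n2_ae => //.
  exact: L2_measurable (L2B lf lg).
by apply: aeS fg => z ->; rewrite subrr.
Qed.

Lemma conv_ip f g : L2 mu2 f -> L2 mu2 g ->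
  rint leb1 (fun t => k t * ip mu2 (tr (s t) f) g) /\
  ip mu2 (conv e k f) g = \int[leb1]_t (k t * ip mu2 (tr (s t) f) g).
Proof.
move=> lf lg; have mf := L2_measurable lf; have mg := L2_measurable lg.
have i : rint (lebp \x leb1)%E (fun p : plane R * measurableTypeR R =>
    g p.1 * (k p.2 * tr (s p.2) f p.1)).
  apply: (@rint21_le _ _ _ _ _ lebp leb1 _ (fun t => (n2 mu2 f + n2 mu2 g) * `|k t|)).
  - apply: measurable_funM; first exact: (measurableT_comp mg measurable_fst).
    exact: joint_measurable.
  - by apply: rintZ; exact: rint_norm.
  - by move=> t; exact: (L2M lg (L2Z (k t) (tr_L2 (s t) lf))).
  move=> t /=; rewrite -(tr_n2 (s t) lf) !n2E.
  have l := (tr_L2 (s t) lf).2; have l' := lg.2.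
  rewrite -RintegralD// -RintegralZr//; last exact: rintD.
  apply: le_Rintegral => //.
  - exact/rint_norm/(L2M lg (L2Z (k t) (tr_L2 (s t) lf))).
  - under eq_fun do rewrite mulrC; exact/rintZ/rintD.
  move=> z _; rewrite !normrM mulrCA mulrC ler_wpM2r//.
  rewrite -[X in _ <= X + _]real_normK ?num_real// -[X in _ <= _ + X]real_normK ?num_real//.
  have := normr_ge0 (g z); have := normr_ge0 (tr (s t) f z).
  by move: `|g z| `|tr _ _ _| => x y; nra.
have E t : \int[mu2]_z (g z * (k t * tr (s t) f z)) = k t * ip mu2 (tr (s t) f) g.
  rewrite -ipZl//; last exact: tr_L2.
  by apply: eq_Rintegral => z _; ring.
split; first by have := (rint_fubini2 i).1; under eq_fun do rewrite /= E.
transitivity (\int[mu2]_z \int[leb1]_t (g z * (k t * tr (s t) f z))).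
  apply: Rintegral_ae.
  - by apply: measurable_funM => //; exact: conv_measurable.
  - exact: rint_measurable (rint_fubini1 i).1.
  - by apply: aeS (conv_section lf) => z [h _]; rewrite /conv mulrC -RintegralZl.
by have /= -> := Rfubini i; apply: eq_Rintegral => t _.
Qed.

(** The symbol of the convolution is [kc - i ks], the transform of [k] without normalising factor,
    taken at [dot e zeta]. *)
Definition kc zeta : R := \int[leb1]_t (k t * cos (dot e zeta * t)).
Definition ks zeta : R := \int[leb1]_t (k t * sin (dot e zeta * t)).

Lemma rint_kc (c : R) : rint leb1 (fun t => k t * cos (c * t)).
Proof.
under eq_fun do rewrite mulrC; apply: (rint_bounded leb1 1) => //.
  by apply: (measurableT_comp cos_measurable); exact: measurable_funM.
by move=> x; exact: cos_abs_le1.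
Qed.

Lemma rint_ks (c : R) : rint leb1 (fun t => k t * sin (c * t)).
Proof.
under eq_fun do rewrite mulrC; apply: (rint_bounded leb1 1) => //.
  by apply: (measurableT_comp sin_measurable); exact: measurable_funM.
by move=> x; exact: sin_abs_le1.
Qed.

Lemma kc_le zeta : `|kc zeta| <= K.
Proof.
rewrite (le_trans (le_normr_Rintegral _ (rint_kc _)))//.
apply: le_Rintegral => //; [exact/rint_norm/rint_kc|exact: rint_norm|].
by move=> x _; rewrite normrM ler_piMr// cos_abs_le1.
Qed.

Lemma ks_le zeta : `|ks zeta| <= K.
Proof.
rewrite (le_trans (le_normr_Rintegral _ (rint_ks _)))//.
apply: le_Rintegral => //; [exact/rint_norm/rint_ks|exact: rint_norm|].
by move=> x _; rewrite normrM ler_piMr// sin_abs_le1.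
Qed.

Lemma kc_measurable : measurable_fun setT (kc : plane R -> R).
Proof.
have md := measurableT_comp dot_measurable2 (measurable_pair1 e).
apply: (Rintegral_measurable1 leb1 (f := fun p : plane R * measurableTypeR R => k p.2 * cos (dot e p.1 * p.2))).
apply: measurable_funM; first exact: (measurableT_comp mk measurable_snd).
apply: (measurableT_comp cos_measurable); apply: measurable_funM; last exact: measurable_snd.
exact: (measurableT_comp md measurable_fst).
Qed.

Lemma ks_measurable : measurable_fun setT (ks : plane R -> R).
Proof.
have md := measurableT_comp dot_measurable2 (measurable_pair1 e).
apply: (Rintegral_measurable1 leb1 (f := fun p : plane R * measurableTypeR R => k p.2 * sin (dot e p.1 * p.2))).
apply: measurable_funM; first exact: (measurableT_comp mk measurable_snd).
apply: (measurableT_comp sin_measurable); apply: measurable_funM; last exact: measurable_snd.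
exact: (measurableT_comp md measurable_fst).
Qed.

Lemma conv_transform (q : plane R -> R) M g : measurable_fun setT q -> (forall z, `|q z| <= M) ->
  rint mu2 g -> rint mu2 (conv e k g) /\
  \int[mu2]_z (conv e k g z * q z) = \int[leb1]_t (k t * \int[mu2]_z (tr (s t) g z * q z)).
Proof.
move=> mq qM g1; have mg := rint_measurable g1.
have i : rint (lebp \x leb1)%E (fun p : plane R * measurableTypeR R =>
    k p.2 * tr (s p.2) g p.1).
  apply: (@rint21_le _ _ _ _ _ lebp leb1 _ (fun t => (\int[mu2]_z `|g z|) * `|k t|)).
  - exact: joint_measurable.
  - by apply: rintZ; exact: rint_norm.
  - by move=> t; exact: (rintZ (k t) (tr_rint (s t) g1)).
  move=> t /=; under eq_Rintegral do rewrite normrM.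
  rewrite RintegralZl//; last exact/rint_norm/tr_rint.
  rewrite mulrC; apply: eq_ler; congr (_ * _).
  exact: (tr_Rintegral (s t) (rint_norm g1)).
have j : rint (lebp \x leb1)%E (fun p : plane R * measurableTypeR R =>
    q p.1 * (k p.2 * tr (s p.2) g p.1)).
  by apply: (rint_bounded _ M) => //; exact: (measurableT_comp mq measurable_fst).
split; first exact: (rint_fubini1 i).1.
have := Rfubini j => /= E.
transitivity (\int[mu2]_z \int[leb1]_t (q z * (k t * tr (s t) g z))).
  apply: Rintegral_ae.
  - by apply: measurable_funM => //; exact: conv_measurable.
  - exact: rint_measurable (rint_fubini1 j).1.
  - by apply: aeS (rint_ae1 i) => z h; rewrite /conv mulrC -RintegralZl.
rewrite E; apply: eq_Rintegral => t _; rewrite -RintegralZl//.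
  by apply: eq_Rintegral => z _; ring.
under eq_fun do rewrite mulrC; apply: (rint_bounded mu2 M) => //; exact: tr_rint.
Qed.

Lemma Cf_conv g zeta : rint mu2 g ->
  Cf (conv e k g) zeta = kc zeta * Cf g zeta - ks zeta * Sf g zeta.
Proof.
move=> g1; have p0 : (2 * pi : R) != 0 by rewrite gt_eqF// mulr_gt0// pi_gt0.
have := conv_transform (measurableT_comp cos_measurable (dot_measurable zeta))
  (fun z => cos_abs_le1 _) g1.
move=> [_ E]; apply: (mulfI p0); rewrite {1}/Cf mulVKf// E.
have st t : k t * \int[mu2]_z (tr (s t) g z * cos (dot z zeta)) =
    (2 * pi * Cf g zeta) * (k t * cos (dot e zeta * t)) -
    (2 * pi * Sf g zeta) * (k t * sin (dot e zeta * t)).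
  have -> : \int[mu2]_z (tr (s t) g z * cos (dot z zeta)) = 2 * pi * Cf (tr (s t) g) zeta.
    by rewrite /Cf mulVKf.
  have := Cf_tr (s t) zeta g1.
  have -> : dot (s t) zeta = - (dot e zeta * t) by rewrite /dot/=; ring.
  by rewrite cosN sinN => ->; ring.
under eq_Rintegral do rewrite st.
rewrite RintegralB//; last 2 first.
- by apply: rintZ; exact: rint_kc.
- by apply: rintZ; exact: rint_ks.
rewrite RintegralZl//; last exact: rint_kc.
by rewrite RintegralZl//; [rewrite /kc /ks; ring|exact: rint_ks].
Qed.

Lemma Sf_conv g zeta : rint mu2 g ->
  Sf (conv e k g) zeta = kc zeta * Sf g zeta + ks zeta * Cf g zeta.
Proof.
move=> g1; have p0 : (2 * pi : R) != 0 by rewrite gt_eqF// mulr_gt0// pi_gt0.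
have := conv_transform (measurableT_comp sin_measurable (dot_measurable zeta))
  (fun z => sin_abs_le1 _) g1.
move=> [_ E]; apply: (mulfI p0); rewrite {1}/Sf mulVKf// E.
have st t : k t * \int[mu2]_z (tr (s t) g z * sin (dot z zeta)) =
    (2 * pi * Sf g zeta) * (k t * cos (dot e zeta * t)) +
    (2 * pi * Cf g zeta) * (k t * sin (dot e zeta * t)).
  have -> : \int[mu2]_z (tr (s t) g z * sin (dot z zeta)) = 2 * pi * Sf (tr (s t) g) zeta.
    by rewrite /Sf mulVKf.
  have := Sf_tr (s t) zeta g1.
  have -> : dot (s t) zeta = - (dot e zeta * t) by rewrite /dot/=; ring.
  by rewrite cosN sinN => ->; ring.
under eq_Rintegral do rewrite st.
rewrite RintegralD//; last 2 first.
- by apply: rintZ; exact: rint_kc.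
- by apply: rintZ; exact: rint_ks.
rewrite RintegralZl//; last exact: rint_kc.
by rewrite RintegralZl//; [rewrite /kc /ks; ring|exact: rint_ks].
Qed.

Lemma ft_conv u A B : is_ft u A B -> is_ft (conv e k u)
  (fun z => kc z * A z + ks z * B z) (fun z => kc z * B z - ks z * A z).
Proof.
move=> h; have mks := ks_measurable.
have nks : measurable_fun setT (fun z : plane R => - ks z) by exact: measurable_funN.
have := @ft_multiplier R (conv e k) kc (fun z => - ks z) K (K ^+ 2) kc_measurable
  nks kc_le _ (fun f lf => (conv_L2 lf).1) conv_lipschitz _ u A B h.
have E1 : (fun z => kc z * A z - - ks z * B z) = (fun z => kc z * A z + ks z * B z).
  by apply/funext => z; ring.
have E2 : (fun z => kc z * B z + - ks z * A z) = (fun z => kc z * B z - ks z * A z).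
  by apply/funext => z; ring.
rewrite E1 E2; apply; first by move=> z; rewrite normrN ks_le.
move=> g g1 g2; split.
- by have [] := conv_transform (measurable_cst (1 : R)) (fun=> eq_ler (normr1 R)) g1.
- by move=> zeta; rewrite Cf_conv//; ring.
- by move=> zeta; rewrite Sf_conv//; ring.
Qed.

End fixed_kernel.
End convolution.

Lemma ae_and d (T : measurableType d) (R : realType) (mu : {measure set T -> \bar R})
    (P Q : T -> Prop) : {ae mu, forall x, P x} -> {ae mu, forall x, Q x} ->
  {ae mu, forall x, P x /\ Q x}.
Proof. exact: aeS2. Qed.

(** * Weak derivatives as Fourier multipliers *)

Section weak_derivative.
Context {R : realType}.
Local Notation leb1 := (@lebesgue_measure R).
Local Notation mu2 := (@lebesgue_measure R \x @lebesgue_measure R)%E.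
Implicit Types (u v w f g A B : R * R -> R) (e a z zeta : R * R) (b c : R -> R) (h t x d : R).

Lemma Rintegral_indic1 (D : set (measurableTypeR R)) (f : R -> R) :
  \int[leb1]_(x in D) f x = \int[leb1]_x (\1_D x * f x).
Proof.
by rewrite Rintegral_mkcond; apply: eq_Rintegral => x _; rewrite patch_indic mulrC.
Qed.

Lemma bsmooth_primitive b : bsmooth b ->
  exists B : R -> R, forall x : R, is_derive x 1 B (b x).
Proof.
move=> bb; have bi := bsmooth_rint bb.
exists (fun x => \int[leb1]_(t in [set` `]-oo, x]]) b t) => x.
have xx1 : x < x + 1 by rewrite ltrDl.
have bi' : leb1.-integrable [set` `]-oo, x + 1]] (EFin \o b).
  by apply: integrableS bi => //.
have [||d <-] := @continuous_FTC1 R b -oo%O x (x + 1) xx1 bi'.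
- by rewrite ltNyr.
- exact: bsmooth_continuous.
by apply: DeriveDef; [exact: d|rewrite derive1E].
Qed.

Lemma is_derive_affine (B : R -> R) (B' a c x : R) : is_derive (a * x + c) 1 B B' ->
  is_derive x 1 (fun x => B (a * x + c)) (B' * a).
Proof.
move=> dB; apply: (@is_derive1_comp R B (fun x => a * x + c) x B' a dB _).
by apply: is_derive_eq; rewrite /GRing.scale/= mulr1 ?mulr0 !addr0.
Qed.

(** A test function whose derivative is the finite difference [b x - b (x - h)]: testing a weak
    derivative against it yields an exact difference identity. *)
Definition window h b x := \int[leb1]_t (\1_(`[0, h]%classic) t * b (x - t)).

Lemma window_bsmooth h b : 0 < h -> bsmooth b ->
  bsmooth (window h b) /\ forall x, is_derive x 1 (window h b) (b x - b (x - h)).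
Proof.
move=> h0 bb; have [B dB] := bsmooth_primitive bb.
have cb x : continuous (fun t => b (-1 * t + x)).
  by apply: smooth_continuous; exact: smooth_affine bb.1.
have E x : window h b x = B x - B (-h + x).
  rewrite /window -Rintegral_indic1.
  transitivity (\int[leb1]_(t in `[0, h]) b (-1 * t + x)).
    by apply: eq_Rintegral => t _; rewrite mulN1r addrC.
  have dF (t : R) : is_derive t 1 (fun t => - B (-1 * t + x)) (b (-1 * t + x)).
    have := is_deriveN (is_derive_affine (dB (-1 * t + x))).
    by rewrite mulrN1 opprK.
  rewrite (FTC2 h0 dF (cb x)) mulr0 add0r mulN1r; ring.
have d (x : R) : is_derive x 1 (window h b) (b x - b (x - h)).
  have -> : window h b = (fun x => B x - B (1 * x - h)).
    by apply/funext => y; rewrite E mul1r [- h + y]addrC.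
  have := is_deriveB (dB x) (is_derive_affine (dB (1 * x - h))).
  by rewrite mulr1 mul1r.
split => //; split.
  apply: (smooth_primitive (f' := fun x => b x - b (x - h))) => //.
  apply: (smoothD bb.1); have := smoothM (smooth_cst (-1)) (smooth_affine 1 (- h) bb.1).
  by congr smooth; apply/funext => x; rewrite mul1r mulN1r.
have [_ [M hM]] := bb; exists (M + h) => x xM.
rewrite /window; under eq_Rintegral => t _.
  rewrite (_ : _ * _ = 0); first by over.
  rewrite indicE; have [|] := boolP (t \in _); rewrite ?mul0r//.
  rewrite inE/= in_itv/= => /andP[t0 th]; rewrite hM ?mulr0//.
  have := ler_normD (x - t) t; rewrite subrK (ger0_norm t0); lra.
by rewrite Rintegral_cst// mul0r.
Qed.

Lemma tensor_window_ex h b c z : bsmooth b ->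
  conv ex \1_(`[0, h]%classic) (tensor b c) z = tensor (window h b) c z.
Proof.
move=> bb; rewrite /tensor /window /conv -RintegralZr//.
  by apply: eq_Rintegral => t _; rewrite /tr/= mulr1 mulr0 oppr0 addr0 mulrA.
have [M bM] := bsmooth_bounded bb.
under eq_fun do rewrite mulrC; apply: (rint_bounded leb1 M) => //; last exact: rint_indic_itv.
by apply: (measurableT_comp (bsmooth_measurable bb)); exact: measurable_funB.
Qed.

Lemma tensor_window_ey h b c z : bsmooth c ->
  conv ey \1_(`[0, h]%classic) (tensor b c) z = tensor b (window h c) z.
Proof.
move=> bc; rewrite /tensor /window /conv -RintegralZl//.
  by apply: eq_Rintegral => t _; rewrite /tr/= mulr1 mulr0 oppr0 addr0 mulrCA.
have [M bM] := bsmooth_bounded bc.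
under eq_fun do rewrite mulrC; apply: (rint_bounded leb1 M) => //; last exact: rint_indic_itv.
by apply: (measurableT_comp (bsmooth_measurable bc)); exact: measurable_funB.
Qed.

Lemma conv_window_adj e h f g : L2 mu2 f -> L2 mu2 g ->
  ip mu2 (conv e \1_(`[- h, 0]%classic) f) g = ip mu2 f (conv e \1_(`[0, h]%classic) g).
Proof.
move=> lf lg; rewrite [RHS]ipC.
have [_ ->] := conv_ip e (@rint_indic_itv R true false (- h) 0) lf lg.
have [i ->] := conv_ip e (@rint_indic_itv R true false 0 h) lg lf.
rewrite -[RHS]mul1r -(mpc_Rintegral (@mpc_opp R) i); apply: eq_Rintegral => t _ /=.
rewrite ipC -(tr_ip (t * e.1, t * e.2) lg (tr_L2 _ lf)) tr_tr/= !addrN !mulNr !opprK.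
congr (_ * _); first by rewrite !indicE !mem_setE !in_itv/= oppr_ge0 lerNl andbC.
by rewrite tr0.
Qed.

Definition axis e := e = ex \/ e = ey.

Lemma window_test e h b c : axis e -> 0 < h -> bsmooth b -> bsmooth c ->
  exists Phi, [/\ test_function Phi,
    forall z, 'D_e Phi z = tensor b c z - tr (- (h * e.1), - (h * e.2)) (tensor b c) z &
    Phi = conv e \1_(`[0, h]%classic) (tensor b c)].
Proof.
move=> [] -> h0 bb bc.
- have [bw dw] := window_bsmooth h0 bb.
  exists (tensor (window h b) c); split; first exact: tensor_test.
    move=> z; have -> := congr1 (fun F => F z) (tensor_derive_ex c dw).
    by rewrite /tr /tensor/= mulr1 mulr0 oppr0 addr0 mulrBl.
  by apply/funext => z; rewrite tensor_window_ex.
- have [bw dw] := window_bsmooth h0 bc.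
  exists (tensor b (window h c)); split; first exact: tensor_test.
    move=> z; have -> := congr1 (fun F => F z) (tensor_derive_ey b dw).
    by rewrite /tr /tensor/= mulr1 mulr0 oppr0 addr0 mulrBr.
  by apply/funext => z; rewrite tensor_window_ey.
Qed.

(** The fundamental theorem of calculus for weak derivatives. Both sides have the same inner product
    with every tensor product, by testing the weak derivative against [window]. Both are also L^2
    operations with bounded symbols, so transforms can be compared. *)
Lemma wderiv_shift e h u v : axis e -> 0 < h -> is_wderiv e u v ->
  {ae mu2, forall z, tr (h * e.1, h * e.2) u z - u z = conv e \1_(`[- h, 0]%classic) v z}.
Proof.
move=> he h0 [/isL2P lu /isL2P lv wd].
have k1 := @rint_indic_itv R true false (- h) 0.
have lc := (conv_L2 e k1 lv).1.
set a := (h * e.1, h * e.2).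
have lD := L2B (L2B (tr_L2 a lu) lu) lc.
have : {ae mu2, forall z, tr a u z - u z - conv e \1_(`[- h, 0]%classic) v z = 0}.
  apply: (test_orthogonal lD) => b c bb bc.
  have lp := tensor_L2 bb bc; have lta := tr_L2 (- (h * e.1), - (h * e.2)) lp.
  have [Phi [tPhi dPhi EPhi]] := window_test he h0 bb bc.
  rewrite (ipBl (L2B (tr_L2 a lu) lu) lc lp) (ipBl (tr_L2 a lu) lu lp).
  rewrite (conv_window_adj e h lv lp) -EPhi.
  have := wd _ tPhi; rewrite -/(ip mu2 v Phi); under eq_Rintegral do rewrite dPhi.
  rewrite -/(ip mu2 u _) (ipBr lp lta lu) => E.
  have -> : ip mu2 (tr a u) (tensor b c) = ip mu2 u (tr (- (h * e.1), - (h * e.2)) (tensor b c)).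
    by rewrite -(tr_ip a lu lta) tr_tr/= !addrN tr0.
  by move: E; lra.
by apply: aeS => z /eqP; rewrite subr_eq0 => /eqP.
Qed.

Lemma tr_conv e k a f : conv e k (tr a f) = tr a (conv e k f).
Proof.
apply/funext => z; apply: eq_Rintegral => t _.
by rewrite /tr/= -!addrA ![- _ + _]addrC.
Qed.

(** With [ks_window]: the symbol of the average over a step is [(exp(i h d) - 1) / (i d)].
    Multiplying by [d = dot e zeta] includes the case [d = 0]. *)
Lemma kc_window e h zeta : 0 < h ->
  dot e zeta * kc e \1_(`[- h, 0]%classic) zeta = sin (h * dot e zeta).
Proof.
move=> h0; have k1 := @rint_indic_itv R true false (- h) 0.
rewrite /kc; move: (dot e zeta) => d.
rewrite -RintegralZl//; last exact: rint_kc.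
have dF (t : R) : is_derive t 1 (fun t => sin (d * t + 0)) (cos (d * t + 0) * d).
  by have := is_derive_affine (is_derive_sin (d * t + 0)).
have h0' : - h < 0 by rewrite oppr_lt0.
under eq_Rintegral do rewrite mulrCA -[d * _]addr0.
transitivity (\int[leb1]_(t in `[- h, 0]) (cos (d * t + 0) * d)).
  by rewrite [RHS]Rintegral_indic1; apply: eq_Rintegral => t _; rewrite [d * cos _]mulrC.
rewrite (FTC2 h0' dF).
  by rewrite mulr0 !addr0 sin0 sub0r mulrN sinN opprK mulrC.
move=> t; apply: cvgM; last exact: cvg_cst.
by apply: (@continuous_comp _ _ _ (fun t => d * t + 0) cos); [apply: cvgD; [apply: cvgM; [exact: cvg_cst|exact: cvg_id]|exact: cvg_cst]|exact: continuous_cos].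
Qed.

Lemma ks_window e h zeta : 0 < h ->
  dot e zeta * ks e \1_(`[- h, 0]%classic) zeta = cos (h * dot e zeta) - 1.
Proof.
move=> h0; have k1 := @rint_indic_itv R true false (- h) 0.
rewrite /ks; move: (dot e zeta) => d.
rewrite -RintegralZl//; last exact: rint_ks.
have dF (t : R) : is_derive t 1 (fun t => - cos (d * t + 0)) (sin (d * t + 0) * d).
  have := is_deriveN (is_derive_affine (is_derive_cos (d * t + 0))).
  by rewrite mulNr opprK.
have h0' : - h < 0 by rewrite oppr_lt0.
transitivity (\int[leb1]_(t in `[- h, 0]) (sin (d * t + 0) * d)).
  by rewrite [RHS]Rintegral_indic1; apply: eq_Rintegral => t _; rewrite addr0 mulrCA [d * sin _]mulrC.
rewrite (FTC2 h0' dF).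
  by rewrite mulr0 !addr0 cos0 mulrN cosN opprK mulrC addrC.
move=> t; apply: cvgM; last exact: cvg_cst.
by apply: (@continuous_comp _ _ _ (fun t => d * t + 0) sin); [apply: cvgD; [apply: cvgM; [exact: cvg_cst|exact: cvg_id]|exact: cvg_cst]|exact: continuous_sin].
Qed.

(** For [d != 0] this is [sin (h d) / d] with [0 < h |d| < pi]; for [d = 0] it is [h]. *)
Lemma kc_window_neq0 e h zeta : 0 < h -> h * `|dot e zeta| < 1 ->
  kc e \1_(`[- h, 0]%classic) zeta != 0.
Proof.
move=> h0 hd; have [d0|d0] := eqVneq (dot e zeta) 0.
  have h0' : - h < 0 by rewrite oppr_lt0.
  rewrite /kc d0; under eq_Rintegral do rewrite mul0r cos0.
  rewrite -Rintegral_indic1 (@FTC2 _ (fun=> 1) id _ _ h0').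
  - by rewrite sub0r opprK gt_eqF.
  - exact: cst_continuous.
have k := kc_window e zeta h0; apply/eqP => k0; move: k; rewrite k0 mulr0 => /esym/eqP.
apply/negP; have p1 : 1 < pi :> R by have := pi_ge2 R; lra.
have [dp|dn] := ltP 0 (dot e zeta).
  rewrite gt_eqF// sin_gt0_pi// mulr_gt0//=.
  by rewrite gtr0_norm// in hd; rewrite (lt_trans hd).
have {}dn : dot e zeta < 0 by rewrite lt_neqAle d0.
rewrite -oppr_eq0 -sinN gt_eqF// sin_gt0_pi// -mulrN mulr_gt0 ?oppr_gt0//=.
by rewrite ltr0_norm// in hd; rewrite (lt_trans hd).
Qed.

(** The hypotheses are the two parts of [(x + i y)(a + i b) = 0], a nonzero factor being
    cancelled. *)
Lemma cmul_eq0 (x y a b : R) : x != 0 -> x * a - y * b = 0 -> x * b + y * a = 0 ->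
  a = 0 /\ b = 0.
Proof.
move=> x0 h1 h2.
have n : x ^+ 2 + y ^+ 2 != 0 by rewrite gt_eqF// ltr_pwDl ?sqr_ge0// exprn_even_gt0.
have ha : (x ^+ 2 + y ^+ 2) * a = 0.
  have -> : (x ^+ 2 + y ^+ 2) * a = x * (x * a - y * b) + y * (x * b + y * a) by ring.
  by rewrite h1 h2 !mulr0 addr0.
have hb : (x ^+ 2 + y ^+ 2) * b = 0.
  have -> : (x ^+ 2 + y ^+ 2) * b = x * (x * b + y * a) - y * (x * a - y * b) by ring.
  by rewrite h1 h2 !mulr0 subr0.
by move: ha hb => /eqP + /eqP; rewrite !mulf_eq0 (negbTE n) => /eqP -> /eqP ->.
Qed.

Lemma ft_shift e h u A B : is_ft u A B ->
  is_ft (fun z => tr (h * e.1, h * e.2) u z - u z)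
    (fun z => (cos (h * dot e z) - 1) * A z - sin (h * dot e z) * B z)
    (fun z => (cos (h * dot e z) - 1) * B z + sin (h * dot e z) * A z).
Proof.
move=> hu; have := ftB (ft_tr (h * e.1, h * e.2) hu) hu.
have E z : dot (h * e.1, h * e.2) z = h * dot e z by rewrite /dot/=; ring.
by congr is_ft; apply/funext => z; rewrite E; ring.
Qed.

(** Transforming [wderiv_shift] gives the relation times the symbol of the average. For
    [h = 1/(n+1)] that symbol can be divided out where [h |dot e z| < 1]; these regions exhaust the
    plane, and countably many null sets are discarded. *)
Lemma ft_wderiv e u v A B A' B' : axis e -> is_wderiv e u v ->
  is_ft u A B -> is_ft v A' B' ->
  {ae mu2, forall z, A' z = - dot e z * B z /\ B' z = dot e z * A z}.
Proof.
move=> he wd hu hv.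
have H (n : nat) : {ae mu2, forall z,
    kc e \1_(`[- n.+1%:R^-1, 0]%classic) z != 0 -> A' z = - dot e z * B z /\ B' z = dot e z * A z}.
  set h : R := n.+1%:R^-1; have h0 : 0 < h by rewrite invr_gt0.
  have k1 := @rint_indic_itv R true false (- h) 0.
  have [eA eB] := ft_unique (ft_shift e h hu) (ft_conv e k1 hv) (wderiv_shift he h0 wd).
  apply: aeS2 eA eB => z /= eA eB k0.
  have s := kc_window e z h0; have c := ks_window e z h0.
  have [] := @cmul_eq0 _ (- ks e \1_(`[- h, 0]%classic) z) (A' z + dot e z * B z) (B' z - dot e z * A z) k0.
  - by move: eA; rewrite -s -c; lra.
  - by move: eB; rewrite -s -c; lra.
  by move=> h1 h2; split; lra.
apply: aeS (ae_foralln H) => z hz.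
have [n hn] : exists n : nat, n.+1%:R^-1 * `|dot e z| < 1.
  by exists (Num.trunc `|dot e z|); rewrite mulrC ltr_pdivrMr// mul1r truncnS_gt.
by apply: (hz n); apply: kc_window_neq0 hn; rewrite invr_gt0.
Qed.

(** No transform of the intermediate [v] is given, so the difference identity is iterated: the
    second difference of [u] is the double average of [w]. *)
Lemma ft_wderiv2 e u v w A B A' B' : axis e -> is_wderiv e u v -> is_wderiv e v w ->
  is_ft u A B -> is_ft w A' B' ->
  {ae mu2, forall z, A' z = - dot e z ^+ 2 * A z /\ B' z = - dot e z ^+ 2 * B z}.
Proof.
move=> he wd wd2 hu hw.
have [/isL2P lu /isL2P lv _] := wd; have [_ /isL2P lw _] := wd2.
have H (n : nat) : {ae mu2, forall z,
    kc e \1_(`[- n.+1%:R^-1, 0]%classic) z != 0 ->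
    A' z = - dot e z ^+ 2 * A z /\ B' z = - dot e z ^+ 2 * B z}.
  set h : R := n.+1%:R^-1; have h0 : 0 < h by rewrite invr_gt0.
  have k1 := @rint_indic_itv R true false (- h) 0.
  set a := (h * e.1, h * e.2); set k := \1_(`[- h, 0]%classic) in k1 *.
  have s1 : {ae mu2, forall z, tr a u z - u z = conv e k v z} by exact: wderiv_shift.
  have s2 : {ae mu2, forall z, tr a v z - v z = conv e k w z} by exact: wderiv_shift.
  have lcw := (conv_L2 e k1 lw).1; have lcv := (conv_L2 e k1 lv).1.
  have s3 := conv_ae e k1 (L2B (tr_L2 a lv) lv) lcw s2.
  have s4 := convB e k1 (tr_L2 a lv) lv.
  have s5 : {ae mu2, forall z, tr a (fun z => tr a u z - u z) z - (tr a u z - u z) =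
      conv e k (conv e k w) z}.
    apply: aeS2 (ae_and s1 (tr_ae a s1)) (ae_and s3 s4) => z [e1 e2] [e3 e4].
    by rewrite -e3 -e4 e1 tr_conv {1}/tr e2.
  have [eA eB] := ft_unique (ft_shift e h (ft_shift e h hu)) (ft_conv e k1 (ft_conv e k1 hw)) s5.
  apply: aeS2 eA eB => z /= eA eB k0.
  have s := kc_window e z h0; have c := ks_window e z h0.
  (* The symbol now appears squared; it is cancelled one factor at a time. *)
  have [] := @cmul_eq0 _ (- ks e k z)
    (kc e k z * (A' z + dot e z ^+ 2 * A z) + ks e k z * (B' z + dot e z ^+ 2 * B z))
    (kc e k z * (B' z + dot e z ^+ 2 * B z) - ks e k z * (A' z + dot e z ^+ 2 * A z)) k0.
  - by move: eA; rewrite -s -c -/k; lra.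
  - by move: eB; rewrite -s -c -/k; lra.
  move=> h1 h2.
  have [] := @cmul_eq0 _ (- ks e k z) (A' z + dot e z ^+ 2 * A z) (B' z + dot e z ^+ 2 * B z) k0.
  - by move: h1; lra.
  - by move: h2; lra.
  by move=> h3 h4; split; lra.
apply: aeS (ae_foralln H) => z hz.
have [n hn] : exists n : nat, n.+1%:R^-1 * `|dot e z| < 1.
  by exists (Num.trunc `|dot e z|); rewrite mulrC ltr_pdivrMr// mul1r truncnS_gt.
by apply: (hz n); apply: kc_window_neq0 hn; rewrite invr_gt0.
Qed.

End weak_derivative.

(** * Sup bounds from integrable transforms *)

Section bounded_functions.
Context {R : realType}.
Local Notation leb1 := (@lebesgue_measure R).
Local Notation mu2 := (@lebesgue_measure R \x @lebesgue_measure R)%E.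
Implicit Types (u v w f g A B : R * R -> R) (e a z zeta : R * R) (h t x d K M : R).

Lemma hv_01 x : 0 <= hv x <= 1.
Proof. by rewrite /hv; case: (0 < x); rewrite ?lexx ?ler01. Qed.

(** By duality instead of Fourier inversion: Parseval and the sup bound on the transform of [g] give
    [ip u g <= K |g|_1]. Applied to the indicator of [{u > K}], this makes the nonnegative
    [(u - K) g] integrate to 0. *)
Lemma ft_ub u A B : is_ft u A B -> rint mu2 A -> rint mu2 B ->
  {ae mu2, forall z, u z <= (2 * pi)^-1 * (\int[mu2]_z `|A z| + \int[mu2]_z `|B z|)}.
Proof.
move=> hu iA iB; set K := (2 * pi)^-1 * _.
have lu := ft_L2 hu; have lA := ft_L2r hu; have lB := ft_L2i hu.
have dual g : rint mu2 g -> L2 mu2 g -> ip mu2 u g <= K * \int[mu2]_z `|g z|.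
  move=> g1 g2; rewrite (ft_ip hu (ft_rint g1 g2)).
  have bd (f q : R * R -> R) : L2 mu2 f -> rint mu2 f -> L2 mu2 q ->
      (forall z, `|q z| <= (2 * pi)^-1 * \int[mu2]_z `|g z|) ->
      ip mu2 f q <= ((2 * pi)^-1 * \int[mu2]_z `|g z|) * \int[mu2]_z `|f z|.
    move=> lf f1 lq qb; rewrite (le_trans (ler_norm _))//.
    rewrite (le_trans (le_normr_Rintegral _ (L2M lf lq)))//.
    rewrite -RintegralZl//; last exact: rint_norm.
    apply: le_Rintegral => //.
    - exact/rint_norm/L2M.
    - exact/rintZ/rint_norm.
    by move=> z _; rewrite normrM mulrC ler_wpM2r.
  have h1 := bd _ _ lA iA (Cf_L2 g1 g2) (fun z => Cf_le z g1).
  have h2 := bd _ _ lB iB (L2N (Sf_L2 g1 g2)).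
  have {}h2 : ip mu2 B (fun z : R * R => - Sf g z) <= (2 * pi)^-1 * \int[mu2]_z `|g z| * \int[mu2]_z `|B z|.
    by apply: h2 => z; rewrite normrN Sf_le.
  apply: le_trans (lerD h1 h2) _; rewrite /K; apply: eq_ler; ring.
have mphi : measurable_fun setT (fun z : plane R => hv (u z - K)).
  have mB : measurable_fun setT (fun z : plane R => u z - K : measurableTypeR R).
    by apply: measurable_funB => //; exact: L2_measurable lu.
  exact: (measurableT_comp (@hv_measurable R) mB).
have H (n : nat) : {ae mu2, forall z, box n z -> u z <= K}.
  (* The indicator of [{u > K}], cut to a box so as to be integrable. *)
  pose g (z : R * R) := hv (u z - K) * \1_(box n) z.
  have hb z : `|hv (u z - K)| <= 1 by have /andP[h1 h2] := hv_01 (u z - K); rewrite ger0_norm.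
  have ibox : rint mu2 (\1_(box n) : R * R -> R).
    have -> : (\1_(box n) : R * R -> R) = (fun z => \1_(box n) z * \1_(box n) z).
      by apply/funext => z; rewrite indicE -natrM mulnb andbb.
    exact: (L2M (L2_box_indic n) (L2_box_indic n)).
  have g1 : rint mu2 g := rint_bounded mu2 1 mphi hb ibox.
  have g2 : L2 mu2 g := L2_bounded mu2 1 mphi hb (L2_box_indic n).
  have g0 z : 0 <= g z by have /andP[h1 h2] := hv_01 (u z - K); rewrite mulr_ge0.
  have iug : rint mu2 (fun z => u z * g z - K * g z) by apply: rintB; [exact: L2M|exact: rintZ].
  have ug0 z : 0 <= u z * g z - K * g z.
    rewrite -mulrBl /g mulrA mulr_ge0// /hv; case: ltP => h; last by rewrite mulr0.
    by rewrite mulr1 ltW.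
  have I0 : \int[mu2]_z (u z * g z - K * g z) = 0.
    apply/eqP; rewrite eq_le; apply/andP; split; last by apply: Rintegral_ge0 => z _; exact: ug0.
    rewrite RintegralB//; [|exact: L2M|exact: rintZ].
    rewrite subr_le0 (le_trans (dual g g1 g2))// RintegralZl//; apply: eq_ler; congr (_ * _).
    by apply: eq_Rintegral => z _; rewrite ger0_norm.
  have z0 : {ae mu2, forall z, u z * g z - K * g z = 0} := @Rint_eq0 _ _ _ mu2 _ ug0 iug I0.
  apply: aeS z0 => z h bz; rewrite leNgt; apply/negP => Ku.
  move: h; rewrite -mulrBl /g /hv subr_gt0 Ku indicE mem_set// !mulr1 => /eqP.
  by rewrite subr_eq0 gt_eqF.
apply: aeS (ae_foralln H) => z hz.
pose N := (Num.trunc (Num.max `|z.1| `|z.2|)).+1.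
have h : Num.max `|z.1| `|z.2| <= N%:R by rewrite ltW// truncnS_gt.
by apply: (hz N); move: h; rewrite ge_max => /andP[].
Qed.

Lemma ft_bounded u A B : is_ft u A B -> rint mu2 A -> rint mu2 B ->
  exists2 K, 0 <= K & {ae mu2, forall z, `|u z| <= K}.
Proof.
move=> hu iA iB.
have h := ft_ub hu iA iB.
have h' := ft_ub (ftZ (-1) hu) (rintZ (-1) iA) (rintZ (-1) iB).
set K1 := (2 * pi)^-1 * _ in h; set K2 := (2 * pi)^-1 * _ in h'.
exists (`|K1| + `|K2|); first by rewrite addr_ge0.
apply: aeS2 h h' => z h1 h2; rewrite ler_norml.
have := ler_norm K1; have := ler_norm K2; have := normr_ge0 K1; have := normr_ge0 K2.
by move: `|K1| `|K2| => a b *; apply/andP; split; lra.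
Qed.

(** The lemmas on products in L^2 ask for bounds at every point; clipping to [[- K, K]] changes [f]
    only on a null set. *)
Lemma L2_truncate f K : L2 mu2 f -> 0 <= K -> {ae mu2, forall z, `|f z| <= K} ->
  exists g, [/\ L2 mu2 g, forall z, `|g z| <= K & {ae mu2, forall z, f z = g z}].
Proof.
move=> lf K0 fK; exists (fun z => Num.max (- K) (Num.min K (f z))).
have mg : measurable_fun setT (fun z : plane R => Num.max (- K) (Num.min K (f z))).
  apply: measurable_maxr => //; apply: measurable_minr => //; exact: L2_measurable lf.
have e : {ae mu2, forall z, f z = Num.max (- K) (Num.min K (f z))}.
  by apply: aeS fK => z; rewrite ler_norml => /andP[h1 h2]; rewrite min_r// max_r.
split => //; first exact: L2_ae e lf.
move=> z; rewrite ler_norml le_max lexx/= ge_max ge_min lexx/= andbT.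
by rewrite (le_trans _ K0)// oppr_le0.
Qed.

End bounded_functions.

(** * Difference quotients in [x] *)

Section difference_quotients.
Context {R : realType}.
Local Notation leb1 := (@lebesgue_measure R).
Local Notation mu2 := (@lebesgue_measure R \x @lebesgue_measure R)%E.
Implicit Types (u v w f g A B : R * R -> R) (e a z zeta : R * R) (h t x d K M : R) (n : nat).

Lemma cvg_quotient (f : R -> R) (x l : R) : is_derive x 1 f l ->
  (fun n => n.+1%:R * (f (x + n.+1%:R^-1) - f x)) @ \oo --> l.
Proof.
move=> [df <-]; move: df => /cvg_ex[l' hl'].
have -> : 'D_1 f x = l' by exact: cvg_lim.
have c0 : (fun n : nat => n.+1%:R^-1 : R) @ \oo --> (0 : R)^'.
  move=> P P0; have := @cvg_harmonic R _ P0 => -[N _ hN].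
  by exists N => // n /= Nn; apply: (hN n Nn); rewrite /= invr_eq0 pnatr_eq0.
apply: eq_cvgn (cvg_comp _ _ c0 hl') => n /=.
by rewrite invrK /GRing.scale/= mulr1 [x + _]addrC.
Qed.

Lemma window_mass h : 0 < h -> \int[leb1]_t `|\1_(`[- h, 0]%classic) t| = h.
Proof.
move=> h0; have h0' : - h < 0 by rewrite oppr_lt0.
transitivity (\int[leb1]_(t in (`[- h, 0]%classic : set (measurableTypeR R))) (1 : R)).
  by rewrite [RHS]Rintegral_indic1; apply: eq_Rintegral => t _; rewrite mulr1 ger0_norm.
rewrite (@FTC2 _ (fun=> 1) id _ _ h0'); first by rewrite sub0r opprK.
exact: cst_continuous.
Qed.

Lemma sin_abs_le h d : 0 < h -> `|sin (h * d)| <= `|d| * h.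
Proof.
(* The direction [(d, 0)] and the frequency [(1, 0)] make [dot] equal to [d]; the bound is then the
   mass [h] of the window. *)
move=> h0; have := kc_window (d, 0) (1, 0) h0; rewrite /dot/= mulr1 mul0r addr0 => <-.
rewrite normrM ler_wpM2l//; rewrite -[leRHS]window_mass//.
by apply: kc_le; exact: rint_indic_itv.
Qed.

Lemma cos_abs_le h d : 0 < h -> `|cos (h * d) - 1| <= `|d| * h.
Proof.
move=> h0; have := ks_window (d, 0) (1, 0) h0; rewrite /dot/= mulr1 mul0r addr0 => <-.
rewrite normrM ler_wpM2l//; rewrite -[leRHS]window_mass//.
by apply: ks_le; exact: rint_indic_itv.
Qed.

Lemma sin_quotient d : (fun n => n.+1%:R * sin (n.+1%:R^-1 * d)) @ \oo --> d.
Proof.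
have D : is_derive (0 : R) 1 (fun t => sin (d * t + 0)) (cos (d * 0 + 0) * d).
  exact: is_derive_affine (is_derive_sin (d * 0 + 0)).
apply: (cvgn_eq _ (eq_cvgn _ (cvg_quotient D))).
  by rewrite mulr0 addr0 cos0 mul1r.
by move=> n; rewrite add0r mulr0 !addr0 sin0 subr0 [d * _]mulrC.
Qed.

Lemma cos_quotient d : (fun n => n.+1%:R * (cos (n.+1%:R^-1 * d) - 1)) @ \oo --> (0 : R).
Proof.
have D : is_derive (0 : R) 1 (fun t => cos (d * t + 0)) (- sin (d * 0 + 0) * d).
  exact: is_derive_affine (is_derive_cos (d * 0 + 0)).
apply: (cvgn_eq _ (eq_cvgn _ (cvg_quotient D))).
  by rewrite mulr0 addr0 sin0 oppr0 mul0r.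
by move=> n; rewrite add0r mulr0 !addr0 cos0 [d * _]mulrC.
Qed.

Local Notation xi z := (z.1 : R).
Local Notation shift n := (n.+1%:R^-1 : R, 0 : R).
Local Notation shift' n := (- n.+1%:R^-1 : R, 0 : R).

(** Forward quotients are used for strong convergence to the derivative; the centred ones [ctr] have
    a purely imaginary symbol and admit an exact summation by parts. *)
Definition fwd u n z := n.+1%:R * (tr (shift n) u z - u z).
Definition ctr u n z := n.+1%:R / 2 * (tr (shift n) u z - tr (shift' n) u z).

Lemma dot_shift n z : dot (shift n) z = n.+1%:R^-1 * z.1.
Proof. by rewrite /dot/= mul0r addr0. Qed.

Lemma dot_shift' n z : dot (shift' n) z = - (n.+1%:R^-1 * z.1).
Proof. by rewrite /dot/= mul0r addr0 mulNr. Qed.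

Lemma fwd_L2 u n : L2 mu2 u -> L2 mu2 (fwd u n).
Proof. by move=> lu; exact: (L2Z _ (L2B (tr_L2 _ lu) lu)). Qed.

Lemma ft_ctr u A B n : is_ft u A B -> is_ft (ctr u n)
  (fun z => - (n.+1%:R * sin (n.+1%:R^-1 * xi z)) * B z)
  (fun z => n.+1%:R * sin (n.+1%:R^-1 * xi z) * A z).
Proof.
move=> hu; have := ftZ (n.+1%:R / 2) (ftB (ft_tr (shift n) hu) (ft_tr (shift' n) hu)).
by congr is_ft; apply/funext => z; rewrite dot_shift dot_shift' cosN sinN; field.
Qed.

Lemma ft_fwd u A B n : is_ft u A B -> is_ft (fwd u n)
  (fun z => n.+1%:R * (cos (n.+1%:R^-1 * xi z) - 1) * A z - n.+1%:R * sin (n.+1%:R^-1 * xi z) * B z)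
  (fun z => n.+1%:R * (cos (n.+1%:R^-1 * xi z) - 1) * B z + n.+1%:R * sin (n.+1%:R^-1 * xi z) * A z).
Proof.
move=> hu; have := ftZ n.+1%:R (ftB (ft_tr (shift n) hu) hu).
by congr is_ft; apply/funext => z; rewrite dot_shift; ring.
Qed.

Lemma msin n : measurable_fun setT (fun z : plane R => n.+1%:R * sin (n.+1%:R^-1 * xi z)).
Proof.
apply: measurable_funM => //; apply: (measurableT_comp (@sin_measurable R)).
by apply: measurable_funM => //; exact: measurable_fst.
Qed.

Lemma mcos n : measurable_fun setT (fun z : plane R => n.+1%:R * (cos (n.+1%:R^-1 * xi z) - 1)).
Proof.
apply: measurable_funM => //; apply: measurable_funB => //.
apply: (measurableT_comp (@cos_measurable R)).
by apply: measurable_funM => //; exact: measurable_fst.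
Qed.

Lemma sin_quot_le n z A : `|n.+1%:R * sin (n.+1%:R^-1 * xi z) * A z| <= `|xi z * A z|.
Proof.
rewrite !normrM ler_wpM2r// ger0_norm// mulrC -ler_pdivlMr//.
by apply: sin_abs_le; rewrite invr_gt0.
Qed.

Lemma cos_quot_le n z A : `|n.+1%:R * (cos (n.+1%:R^-1 * xi z) - 1) * A z| <= `|xi z * A z|.
Proof.
rewrite !normrM ler_wpM2r// [X in X * _]ger0_norm// mulrC -ler_pdivlMr//.
by apply: cos_abs_le; rewrite invr_gt0.
Qed.

Lemma cvg2_sin A : L2 mu2 A -> L2 mu2 (fun z => xi z * A z) ->
  cvg2 mu2 (fun n z => n.+1%:R * sin (n.+1%:R^-1 * xi z) * A z) (fun z => xi z * A z).
Proof.
move=> lA lxA; apply: (L2_dct mu2 _ _ (fun z => xi z * A z) _ (L2_measurable lxA) lxA _ _).2.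
- by move=> n; apply: (measurable_funM (msin n)); exact: L2_measurable lA.
- by move=> n z; exact: sin_quot_le.
- by apply: aeW => z; apply: cvgM; [exact: sin_quotient|exact: cvg_cst].
Qed.

Lemma cvg2_cos A : L2 mu2 A -> L2 mu2 (fun z => xi z * A z) ->
  cvg2 mu2 (fun n z => n.+1%:R * (cos (n.+1%:R^-1 * xi z) - 1) * A z) (fun=> 0).
Proof.
move=> lA lxA.
apply: (L2_dct mu2 _ _ (fun z => xi z * A z) _ (measurable_cst _) lxA _ _).2.
- by move=> n; apply: (measurable_funM (mcos n)); exact: L2_measurable lA.
- by move=> n z; exact: cos_quot_le.
- apply: aeW => z; apply: (cvgn_eq (mul0r (A z))).
  by apply: cvgM; [exact: cos_quotient|exact: cvg_cst].
Qed.

Lemma L2_sin n A : L2 mu2 A -> L2 mu2 (fun z => xi z * A z) ->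
  L2 mu2 (fun z => n.+1%:R * sin (n.+1%:R^-1 * xi z) * A z).
Proof.
move=> lA lxA; apply: (L2_le mu2 (fun z => xi z * A z)) => // [|z].
  by apply: (measurable_funM (msin n)); exact: L2_measurable lA.
exact: sin_quot_le.
Qed.

Lemma L2_cos n A : L2 mu2 A -> L2 mu2 (fun z => xi z * A z) ->
  L2 mu2 (fun z => n.+1%:R * (cos (n.+1%:R^-1 * xi z) - 1) * A z).
Proof.
move=> lA lxA; apply: (L2_le mu2 (fun z => xi z * A z)) => // [|z].
  by apply: (measurable_funM (mcos n)); exact: L2_measurable lA.
exact: cos_quot_le.
Qed.

(** Both parts of the symbol of the quotient are bounded by [|xi|], and the symbol tends to [i xi]:
    dominated convergence on the Fourier side. *)
Lemma fwd_cvg u v A B : is_ft u A B -> is_ft v (fun z => - (xi z * B z)) (fun z => xi z * A z) ->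
  cvg2 mu2 (fwd u) v.
Proof.
move=> hu hv; have lA := ft_L2r hu; have lB := ft_L2i hu; have lxA := ft_L2i hv.
have lxB : L2 mu2 (fun z => xi z * B z).
  by have := L2N (ft_L2r hv); under eq_fun do rewrite opprK.
pose cA n z := n.+1%:R * (cos (n.+1%:R^-1 * xi z) - 1) * A z.
pose cB n z := n.+1%:R * (cos (n.+1%:R^-1 * xi z) - 1) * B z.
pose sA n z := n.+1%:R * sin (n.+1%:R^-1 * xi z) * A z.
pose sB n z := n.+1%:R * sin (n.+1%:R^-1 * xi z) * B z.
have h1 := cvg2B (fun n => L2_cos n lA lxA) (fun n => L2_sin n lB lxB) (L20 mu2) lxB
  (cvg2_cos lA lxA) (cvg2_sin lB lxB).
have h2 := cvg2D (fun n => L2_cos n lB lxB) (fun n => L2_sin n lA lxA) (L20 mu2) lxA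
  (cvg2_cos lB lxB) (cvg2_sin lA lxA).
apply: eq_cvgn (cvgn_eq (addr0 0) (cvgD h1 h2)) => n.
rewrite (ft_n2 (ftB (ft_fwd n hu) hv)) fctE; congr (_ + _); congr n2; apply/funext => z; ring.
Qed.

(** The limit is the pairing of [u_x] with [g], written through transforms so that it makes sense
    when only [xi A] and [xi B] are available and no function [u_x] has been named. *)
Lemma ctr_cvg u g A B GA GB : is_ft u A B -> is_ft g GA GB ->
  L2 mu2 (fun z => xi z * A z) -> L2 mu2 (fun z => xi z * B z) ->
  (fun n => ip mu2 (ctr u n) g) @ \oo -->
  - ip mu2 (fun z => xi z * B z) GA + ip mu2 (fun z => xi z * A z) GB.
Proof.
move=> hu hg lxA lxB; have lA := ft_L2r hu; have lB := ft_L2i hu.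
have lGA := ft_L2r hg; have lGB := ft_L2i hg.
have h1 := ip_cvg (fun n => L2_sin n lB lxB) (fun=> lGA) lxB lGA (cvg2_sin lB lxB) (cvg2_cst mu2 GA).
have h2 := ip_cvg (fun n => L2_sin n lA lxA) (fun=> lGB) lxA lGB (cvg2_sin lA lxA) (cvg2_cst mu2 GB).
apply: eq_cvgn (cvgD (cvgN h1) h2) => n.
rewrite (ft_ip (ft_ctr n hu) hg) fctE; congr (_ + _).
rewrite fctE -ipNl//; last exact: L2_sin.
by congr ip; apply/funext => z; rewrite !mulNr.
Qed.

(** An exact discrete product rule: translating the backward term, both terms carry
    [v (z) v (z + h)], against [w (z)] and [w (z + h)]. *)
Lemma ctr_fwd v w M n : L2 mu2 v -> L2 mu2 w -> (forall z, `|v z| <= M) -> (forall z, `|w z| <= M) ->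
  ip mu2 (ctr v n) (fun z => v z * w z) =
  - (2^-1 * ip mu2 (fun z => v z * tr (shift n) v z) (fwd w n)).
Proof.
move=> lv lw vM wM; have mv := L2_measurable lv; have mw := L2_measurable lw.
have lt := tr_L2 (shift n) lv; have lt' := tr_L2 (shift' n) lv.
have lvw : L2 mu2 (fun z => v z * w z) := L2_bounded mu2 M mv vM lw.
have lvt : L2 mu2 (fun z => v z * tr (shift n) v z) := L2_bounded mu2 M mv vM lt.
have ltw := tr_L2 (shift n) lw.
rewrite /ctr /fwd ipZl//; last exact: L2B.
rewrite ipBl// ipZr//; last exact: L2B.
rewrite ipBr//.
have -> : ip mu2 (tr (shift' n) v) (fun z => v z * w z) =
    ip mu2 (fun z => v z * tr (shift n) v z) (tr (shift n) w).
  rewrite -(tr_ip (shift n) lt' lvw) tr_tr/= addrN addr0 tr0.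
  by apply: eq_Rintegral => z _; rewrite /tr; ring.
have -> : ip mu2 (tr (shift n) v) (fun z => v z * w z) =
    ip mu2 (fun z => v z * tr (shift n) v z) w.
  by apply: eq_Rintegral => z _; ring.
by field.
Qed.

(* The limit of [ctr_fwd]: formally [\int v_x v w = - 2^-1 \int v^2 w_x]. *)
Lemma commutator v w wx M A B NA NB : is_ft v A B ->
  L2 mu2 (fun z => xi z * A z) -> L2 mu2 (fun z => xi z * B z) ->
  is_ft (fun z => v z * w z) NA NB -> L2 mu2 w -> L2 mu2 wx ->
  (forall z, `|v z| <= M) -> (forall z, `|w z| <= M) -> cvg2 mu2 (fwd w) wx ->
  - ip mu2 (fun z => xi z * B z) NA + ip mu2 (fun z => xi z * A z) NB =
  - (2^-1 * ip mu2 (fun z => v z * v z) wx).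
Proof.
move=> hv lxA lxB hN lw lwx vM wM cw; have lv := ft_L2 hv; have mv := L2_measurable lv.
apply: (cvg_unique _ (ctr_cvg hv hN lxA lxB)) => //.
apply: (eq_cvgn (fun n => ctr_fwd n lv lw vM wM)).
apply: cvgN; apply: cvgM; first exact: cvg_cst.
have b n : `|n.+1%:R^-1 : R| <= 1 by rewrite ger0_norm// invf_le1// ler1n.
have ct : cvg2 mu2 (fun n => tr (shift n) v) v.
  apply: (@tr_cvg _ _ 1) => //= [n||]; rewrite ?normr0 ?ler01//; first exact: cvg_harmonic.
  exact: cvg_cst.
apply: ip_cvg => //.
- by move=> n; exact: (L2_bounded mu2 M mv vM (tr_L2 _ lv)).
- by move=> n; exact: fwd_L2.
- exact: (L2_bounded mu2 M mv vM lv).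
- exact: (cvg2_bounded mu2 M mv vM (fun n => tr_L2 _ lv) lv ct).
Qed.

End difference_quotients.

(** * The kernels [p] and [p_x] *)

Section kernels.
Context {R : realType}.
Local Notation leb1 := (@lebesgue_measure R).
Local Notation mu2 := (@lebesgue_measure R \x @lebesgue_measure R)%E.
Implicit Types (u v w f g A B : R * R -> R) (e a z zeta : R * R) (h t x d K M : R).

Lemma dot_ex z : dot ex z = z.1.
Proof. by rewrite /dot/= mul1r mul0r addr0. Qed.

Lemma dot_ey z : dot ey z = z.2.
Proof. by rewrite /dot/= mul1r mul0r add0r. Qed.

Lemma pkerE t : pker t = 2^-1 * expR (- (1 * `|t|)).
Proof. by rewrite mul1r. Qed.

Lemma rint_pker : rint leb1 (@pker R).
Proof. by have := rintZ 2^-1 (rint_expN (@ltr01 R)); congr rint; apply/funext => t; rewrite pkerE. Qed.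

(* the derivative of [pker] away from 0, where [pker] is not differentiable *)
Definition dpker t : R := - (Num.sg t * pker t).

Lemma rint_dpker : rint leb1 dpker.
Proof. by apply: rintN; exact: (rint_bounded leb1 1 (@sgr_measurable R) (@sgr_le1 R) rint_pker). Qed.

Lemma kc_pker z : kc ex pker z = (1 + z.1 ^+ 2)^-1.
Proof.
rewrite /kc dot_ex.
transitivity (\int[leb1]_t (2^-1 * (expR (- (1 * `|t|)) * cos (z.1 * t)))).
  by apply: eq_Rintegral => t _; rewrite pkerE mulrA.
rewrite RintegralZl//; last exact: rint_exp_cos.
by rewrite int_exp_cos// expr1n mulr1 mulrA mulVf ?mul1r.
Qed.

Lemma ks_pker z : ks ex pker z = 0.
Proof.
rewrite /ks dot_ex.
transitivity (\int[leb1]_t (2^-1 * (expR (- (1 * `|t|)) * sin (z.1 * t)))).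
  by apply: eq_Rintegral => t _; rewrite pkerE mulrA.
by rewrite RintegralZl ?int_exp_sin ?mulr0//; exact: rint_exp_sin.
Qed.

Lemma kc_dpker z : kc ex dpker z = 0.
Proof.
rewrite /kc dot_ex.
transitivity (\int[leb1]_t (- 2^-1 * (Num.sg t * (expR (- (1 * `|t|)) * cos (z.1 * t))))).
  by apply: eq_Rintegral => t _; rewrite /dpker pkerE; ring.
rewrite RintegralZl//; first by rewrite int_sgexp_cos ?mulr0.
exact: (rint_bounded leb1 1 (@sgr_measurable R) (@sgr_le1 R) (rint_exp_cos _ _)).
Qed.

Lemma ks_dpker z : ks ex dpker z = - (z.1 / (1 + z.1 ^+ 2)).
Proof.
rewrite /ks dot_ex.
transitivity (\int[leb1]_t (- 2^-1 * (Num.sg t * (expR (- (1 * `|t|)) * sin (z.1 * t))))).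
  by apply: eq_Rintegral => t _; rewrite /dpker pkerE; ring.
rewrite RintegralZl//; last exact: (rint_bounded leb1 1 (@sgr_measurable R) (@sgr_le1 R) (rint_exp_sin _ _)).
by rewrite int_sgexp_sin// expr1n; field; rewrite gt_eqF// ltr_pwDl// sqr_ge0.
Qed.

Lemma convx_conv k f : rint leb1 k -> L2 mu2 f ->
  {ae mu2, forall z, convx k f z = conv ex k f z}.
Proof.
move=> k1 lf; apply: aeS (conv_section ex k1 lf) => z [h _].
have m : mpc leb1 1 (fun t : measurableTypeR R => - t + z.1 : measurableTypeR R).
  by have := mpc_comp (mpc_shift z.1) (@mpc_opp R); rewrite mulr1.
have E : (fun x => k (z.1 - x) * f (x, z.2)) \o (fun t => - t + z.1) =
    (fun t => k t * tr (- (t * ex.1), - (t * ex.2)) f z).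
  apply/funext => t; rewrite /tr/= opprD opprK addrCA subrr addr0.
  by rewrite mulr1 mulr0 oppr0 addr0 [- t + _]addrC.
have i : rint leb1 (fun x => k (z.1 - x) * f (x, z.2)).
  have := mpc_rint m h; rewrite -E; congr rint; apply/funext => t /=.
  by have -> : - (- t + z.1) + z.1 = t by ring.
by rewrite /convx -[LHS]mul1r -(mpc_Rintegral m i) /conv -E.
Qed.

Lemma derive1_pker t : t != 0 -> derive1 pker t = dpker t.
Proof.
move=> t0; rewrite derive1E.
have D (a : R) : is_derive t 1 (fun x => 2^-1 * expR (a * x + 0)) (2^-1 * (expR (a * t + 0) * a)).
  exact: is_deriveZ (is_derive_affine (is_derive_expR (a * t + 0))).
have [tp|tn] := ltP 0 t.
  have -> : 'D_1 pker t = 'D_1 (fun x => 2^-1 * expR (- 1 * x + 0)) t.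
    apply: near_eq_derive; near=> x; rewrite /pker ger0_norm ?mulN1r ?addr0//.
    by near: x; apply: filterS (lt_nbhsr tp) => x /ltW.
  have [_ ->] := D (- 1).
  by rewrite /dpker /pker gtr0_sg// gtr0_norm// mulN1r addr0; ring.
have {}tn : t < 0 by rewrite lt_neqAle t0.
have -> : 'D_1 pker t = 'D_1 (fun x => 2^-1 * expR (1 * x + 0)) t.
  apply: near_eq_derive; near=> x; rewrite /pker ler0_norm ?opprK ?mul1r ?addr0//.
  by near: x; apply: filterS (lt_nbhsl tn) => x /ltW.
have [_ ->] := D 1.
by rewrite /dpker /pker ltr0_sg// ltr0_norm// opprK mul1r addr0; ring.
Unshelve. all: by end_near. Qed.

Lemma convx_derive1_pker f z : measurable_fun setT (f : plane R -> R) ->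
  convx (derive1 pker) f z = convx dpker f z.
Proof.
(* [pker] has no derivative at 0, so this value carries no information; it is isolated as a
   correction at one point, which keeps measurability explicit. *)
move=> mf; pose c := derive1 pker 0 : R.
have E t : derive1 pker t = dpker t + c * \1_[set 0] t.
  rewrite indicE; have [->|t0] := eqVneq t 0.
    by rewrite /dpker sgr0 mul0r oppr0 add0r mem_set// mulr1.
  by rewrite memNset ?mulr0 ?addr0 ?derive1_pker//; exact/eqP.
have mq : measurable_fun setT (dpker : measurableTypeR R -> R) := rint_measurable rint_dpker.
have mz : measurable_fun setT (fun x : measurableTypeR R => z.1 - x : measurableTypeR R).
  by apply: measurable_funB.
have mfz : measurable_fun setT (fun x : measurableTypeR R => f (x, z.2)).
  exact: (measurableT_comp mf (measurable_pair2 z.2)).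
apply: Rintegral_ae.
- apply: measurable_funM => //.
  apply: (measurableT_comp (f := fun t : measurableTypeR R => derive1 pker t)) => //.
  under eq_fun do rewrite E.
  by apply: measurable_funD => //; apply: measurable_funM => //; exact: measurable_indic.
- by apply: measurable_funM => //; exact: measurableT_comp.
apply: aeS (mpc_ae (mpc_shift (- z.1)) (@ae_neq0 R)) => x xz.
by rewrite derive1_pker// -oppr_eq0 opprB.
Qed.

End kernels.

(** * Sobolev weights *)

Section sobolev.
Context {R : realType}.
Local Notation leb1 := (@lebesgue_measure R).
Local Notation mu2 := (@lebesgue_measure R \x @lebesgue_measure R)%E.
Local Notation normc := ComplexField.Normc.normc.
Implicit Types (u v w f g A B : R * R -> R) (U : R * R -> R[i]) (e a z zeta : R * R) (s h t x d K M : R).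

Lemma ae_fst_neq0 : {ae mu2, forall z, z.1 != 0 :> R}.
Proof.
exists ([set 0] `*` setT); split.
- exact: measurableX.
- transitivity (leb1 [set (0 : R)%R] * leb1 setT)%E; first exact: product_measure1E.
  by rewrite lebesgue_measure_set1 mul0e.
by move=> z /= /negP/negbNE/eqP ->.
Qed.

Definition bracket z : R := 1 + z.1 ^+ 2 + z.2 ^+ 2.

Lemma powR_measurable p : measurable_fun setT (fun x : measurableTypeR R => x `^ p : measurableTypeR R).
Proof. exact: measurable_powR. Qed.

Lemma bracket_ge1 z : 1 <= bracket z.
Proof. by rewrite /bracket -addrA lerDl addr_ge0 ?sqr_ge0. Qed.

Lemma bracket_gt0 z : 0 < bracket z.
Proof. exact: lt_le_trans (bracket_ge1 z). Qed.

Lemma bracket_measurable : measurable_fun setT (bracket : plane R -> R).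
Proof.
apply: measurable_funD; last by apply: measurable_funX; exact: measurable_snd.
by apply: measurable_funD => //; apply: measurable_funX; exact: measurable_fst.
Qed.

Lemma normc_Re (x : R[i]) : `|complex.Re x| <= normc x.
Proof.
have h := normc_ge0 x; rewrite -(ler_pXn2r (ltn0Sn 1)) ?nnegrE//.
by rewrite normc_sqr real_normK ?num_real// lerDl sqr_ge0.
Qed.

Lemma normc_Im (x : R[i]) : `|complex.Im x| <= normc x.
Proof.
have h := normc_ge0 x; rewrite -(ler_pXn2r (ltn0Sn 1)) ?nnegrE//.
by rewrite normc_sqr real_normK ?num_real// lerDr sqr_ge0.
Qed.

Lemma normc_measurable U : measurable_fun setT (@complex.Re R \o U : plane R -> R) ->
  measurable_fun setT (@complex.Im R \o U : plane R -> R) ->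
  measurable_fun setT (fun z : plane R => normc (U z)).
Proof.
move=> mr mi; have -> : (fun z => normc (U z)) = fun z => Num.sqrt (complex.Re (U z) ^+ 2 + complex.Im (U z) ^+ 2).
  by apply/funext => z /=; case: (U z).
apply: (measurableT_comp (continuous_measurable_fun (@sqrt_continuous R))).
by apply: measurable_funD; exact: measurable_funX.
Qed.

Lemma Hs_L2 s u : Hs s u -> let U := fourier u in
  is_ft u (@complex.Re R \o U) (@complex.Im R \o U) /\
  L2 mu2 (fun z => bracket z `^ (s / 2) * normc (U z)).
Proof.
move=> [/is_fourierP hu fin] U; split => //; apply: L2norm_fin fin.
apply: measurable_funM.
  exact: (measurableT_comp (powR_measurable (s / 2)) bracket_measurable).
apply: normc_measurable; [exact: L2_measurable (ft_L2r hu)|exact: L2_measurable (ft_L2i hu)].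
Qed.

Lemma bracket_powR s z : 2 <= s -> bracket z <= bracket z `^ (s / 2).
Proof.
move=> s2; rewrite -[leLHS]powRr1 ?(ltW (bracket_gt0 z))//.
by apply: ler_powR; [exact: bracket_ge1|rewrite ler_pdivlMr// mul1r].
Qed.

(** The weight of [H^s] is [bracket ^ (s / 2)] with [bracket >= 1], so [s >= 2] leaves at least one
    full power. *)
Lemma Hs_weight s u : 2 <= s -> Hs s u ->
  L2 mu2 (fun z => bracket z * complex.Re (fourier u z)) /\
  L2 mu2 (fun z => bracket z * complex.Im (fourier u z)).
Proof.
move=> s2 /Hs_L2[hu lW]; have mb := bracket_measurable.
have le z (a : R) : `|a| <= normc (fourier u z) ->
    `|bracket z * a| <= `|bracket z `^ (s / 2) * normc (fourier u z)|.
  move=> h; rewrite !normrM (gtr0_norm (bracket_gt0 z)) ler_pM//; first exact/ltW/bracket_gt0.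
  - by rewrite ger0_norm ?powR_ge0// bracket_powR.
  - exact: le_trans (ler_norm _).
split; apply: (L2_le mu2 _ _ lW).
- by apply: measurable_funM => //; exact: L2_measurable (ft_L2r hu).
- by move=> z; exact/le/normc_Re.
- by apply: measurable_funM => //; exact: L2_measurable (ft_L2i hu).
- by move=> z; exact/le/normc_Im.
Qed.

Lemma weight_L2 (m : R * R -> R) A : measurable_fun setT (m : plane R -> R) ->
  measurable_fun setT (A : plane R -> R) -> (forall z, `|m z| <= bracket z) ->
  L2 mu2 (fun z => bracket z * A z) -> L2 mu2 (fun z => m z * A z).
Proof.
move=> mm mA mb lA; apply: (L2_le mu2 _ _ lA); first exact: measurable_funM.
by move=> z; rewrite !normrM ler_wpM2r// (le_trans (mb z))// ler_norm.
Qed.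

(** The Sobolev embedding into bounded functions, on the Fourier side: [bracket^-1] is in L^2 since
    [bracket^2 >= (1 + xi^2) (1 + eta^2)], and Cauchy-Schwarz applies. *)
Lemma weight_rint A : measurable_fun setT (A : plane R -> R) ->
  L2 mu2 (fun z => bracket z * A z) -> rint mu2 A.
Proof.
move=> mA lA; have [i _] := @rint_oneDsqrV R.
have mV : measurable_fun setT (fun z : plane R => (bracket z)^-1).
  have -> : (fun z : plane R => (bracket z)^-1) = (fun z => bracket z `^ (- 1)).
    by apply/funext => z; rewrite powRN powRr1// ltW// bracket_gt0.
  exact: (measurableT_comp (powR_measurable (- 1)) bracket_measurable).
have l : L2 mu2 (fun z => (bracket z)^-1).
  split => //; apply: (rint_le mu2 _ _ (rint_tensor i i)); first exact: measurable_funX.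
  move=> z /=; rewrite ger0_norm ?sqr_ge0// -invfM.
  have h1 : 0 <= z.1 ^+ 2 by exact: sqr_ge0.
  have h2 : 0 <= z.2 ^+ 2 by exact: sqr_ge0.
  rewrite exprVn lef_pV2 ?posrE ?exprn_gt0 ?bracket_gt0 ?mulr_gt0 ?ltr_pwDl//.
  rewrite /bracket; move: (z.1 ^+ 2) (z.2 ^+ 2) h1 h2 => x y x0 y0; nra.
have := L2M l lA; congr rint; apply/funext => z.
by rewrite mulrA mulVf ?mul1r// gt_eqF// bracket_gt0.
Qed.

End sobolev.

(** * A solution at a fixed time *)

Section snapshot.
Context {R : realType}.
Local Notation leb1 := (@lebesgue_measure R).
Local Notation mu2 := (@lebesgue_measure R \x @lebesgue_measure R)%E.
Implicit Types (u v w f g A B : R * R -> R) (U : R * R -> R[i]) (e a z zeta : R * R) (s h t x d K M : R).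

Definition nonlin sigma v vx : R * R -> R :=
  fun z => (3 - sigma) / 2 * v z ^+ 2 + sigma / 2 * vx z ^+ 2.

(* The data of a solution at a fixed time: [wt], [wx], [wtx] are the derivatives of [w], [G] is the
   antiderivative of [w_yy], the pairs [A, B], ... are the Fourier transforms, and [v], [vx] are
   everywhere bounded representatives of [w], [wx]. *)
Record snapshot sigma (w wt wx wtx A B At Bt v vx G GA GB : R * R -> R) (M : R) : Prop := {
  sn_w : is_ft w A B;
  sn_wt : is_ft wt At Bt;
  sn_wx : is_ft wx (fun z => - (z.1 * B z)) (fun z => z.1 * A z);
  sn_wtx : is_ft wtx (fun z => - (z.1 * Bt z)) (fun z => z.1 * At z);
  sn_A2 : L2 mu2 (fun z => z.1 * (z.1 * A z));
  sn_B2 : L2 mu2 (fun z => z.1 * (z.1 * B z));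
  sn_v : L2 mu2 v;
  sn_vx : L2 mu2 vx;
  sn_vM : forall z, `|v z| <= M;
  sn_vxM : forall z, `|vx z| <= M;
  sn_vw : {ae mu2, forall z, w z = v z};
  sn_vxw : {ae mu2, forall z, wx z = vx z};
  sn_G : is_ft G GA GB;
  sn_Gxi : {ae mu2, forall z, z.1 * GA z = - (z.2 ^+ 2 * B z) /\ z.1 * GB z = z.2 ^+ 2 * A z};
  sn_eq : {ae mu2, forall z, wt z = - (sigma * (v z * vx z)) -
    conv ex dpker (nonlin sigma v vx) z - conv ex pker G z}
}.

(** The relation is [i xi (GA + i GB) = A + i B] in real form; clearing the denominator costs only
    the null set [xi = 0]. *)
Lemma is_dxinv_ft u v A B : is_dxinv u v -> is_ft u A B ->
  exists GA GB, is_ft v GA GB /\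
    {ae mu2, forall z, z.1 * GA z = B z /\ z.1 * GB z = - A z}.
Proof.
move=> [U /is_fourierP hU /is_fourierP hV] hu.
exists (@complex.Re R \o (fun zeta => ('i%C * (zeta.1)%:C)^-1 * U zeta)),
  (@complex.Im R \o (fun zeta => ('i%C * (zeta.1)%:C)^-1 * U zeta)); split => //.
have [eA eB] := ft_unique hu hU (aeW _ (fun=> erefl)).
apply: aeS2 (ae_and eA eB) ae_fst_neq0 => z [-> ->] z0 /=.
set W := _^-1 * _.
have n0 : 'i%C * (z.1)%:C != 0 :> R[i].
  by rewrite mulf_neq0 ?neq0Ci// eq_complex /= negb_and z0.
have : 'i%C * (z.1)%:C * W = U z by rewrite /W mulVKf.
by case: W => a b <- /=; split; ring.
Qed.

(** Replaces the transform given for [v] by [i xi (A + i B)], so that later computations involve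
    only [A] and [B]. *)
Lemma wderiv_ft u v A B A' B' : is_wderiv ex u v -> is_ft u A B -> is_ft v A' B' ->
  is_ft v (fun z => - (z.1 * B z)) (fun z => z.1 * A z).
Proof.
move=> wd hu hv; have h := ft_wderiv (or_introl erefl) wd hu hv.
have mA := L2_measurable (ft_L2r hu); have mB := L2_measurable (ft_L2i hu).
have mx : measurable_fun setT (fun z : plane R => z.1) by exact: measurable_fst.
apply: (ft_ae hv).
- exact: L2_measurable (ft_L2 hv).
- by apply: measurable_funN; exact: measurable_funM.
- exact: measurable_funM.
- exact: aeW.
- by apply: aeS h => z [-> _]; rewrite dot_ex mulNr.
- by apply: aeS h => z [_ ->]; rewrite dot_ex.
Qed.

Lemma nonlin_L2 sigma v vx M : L2 mu2 v -> L2 mu2 vx -> (forall z, `|v z| <= M) ->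
  (forall z, `|vx z| <= M) ->
  L2 mu2 (nonlin sigma v vx) /\ rint mu2 (nonlin sigma v vx).
Proof.
move=> lv lvx vM vxM; split.
  apply: L2D; apply: L2Z.
    exact: (L2_bounded mu2 M (L2_measurable lv) vM lv).
  exact: (L2_bounded mu2 M (L2_measurable lvx) vxM lvx).
by apply: rintD; apply: rintZ; [exact: lv.2|exact: lvx.2].
Qed.

(** The condition [s >= 2] is spent twice: it makes the transforms of [w] and [w_x] integrable,
    hence both functions bounded, and it puts [xi^2 A] and [xi^2 B] in L^2. *)
Lemma snapshot_of sigma s w wt : 2 <= s -> Xs s w -> Xs (s - 2) wt -> rodKP sigma w wt ->
  exists A B At Bt v vx GA GB M,
    snapshot sigma w wt (wderiv ex w) (wderiv ex wt) A B At Bt v vx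
      (dxinv (wderiv ey (wderiv ey w))) GA GB M.
Proof.
move=> s2 [hw [dw hwx] _] [hwt [dwt hwtx] _] [_ dy dyy dxi eq].
have [fw _] := Hs_L2 hw; have [fwt _] := Hs_L2 hwt.
have [fwx0 _] := Hs_L2 hwx; have [fwtx0 _] := Hs_L2 hwtx.
have fwx := wderiv_ft dw fw fwx0; have fwtx := wderiv_ft dwt fwt fwtx0.
set A := _ \o fourier w in fw fwx; set B := _ \o fourier w in fw fwx.
have mA := L2_measurable (ft_L2r fw); have mB := L2_measurable (ft_L2i fw).
have [bA bB] := Hs_weight s2 hw; have [bAx bBx] := Hs_weight s2 hwx.
have [K K0 wK] := ft_bounded fw (weight_rint mA bA) (weight_rint mB bB).
have [Kx Kx0 wxK] := ft_bounded fwx0 (weight_rint (L2_measurable (ft_L2r fwx0)) bAx)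
   (weight_rint (L2_measurable (ft_L2i fwx0)) bBx).
have [v [lv vK wv]] := L2_truncate (ft_L2 fw) K0 wK.
have [vx [lvx vxK wxv]] := L2_truncate (ft_L2 fwx) Kx0 wxK.
have [U hU _] := dxi; have hU' := (is_fourierP _ _).1 hU.
(* The transform of [w_yy] comes with the definedness of its antiderivative; none is available for
   [w_y]. *)
have yy := ft_wderiv2 (or_intror erefl) dy dyy fw hU'.
have [GA [GB [hG eG]]] := is_dxinv_ft dxi hU'.
exists A, B, (@complex.Re R \o fourier wt), (@complex.Im R \o fourier wt), v, vx, GA, GB, (K + Kx).
have mx : measurable_fun setT (fun z : plane R => z.1) by exact: measurable_fst.
have mxx : measurable_fun setT (fun z : plane R => z.1 * z.1) by exact: measurable_funM.
have xb z : `|z.1 * z.1 : R| <= bracket z.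
  by rewrite -expr2 ger0_norm ?sqr_ge0// /bracket; have := sqr_ge0 z.2; lra.
have lF := nonlin_L2 sigma lv lvx (fun z => le_trans (vK z) (ler_wpDr Kx0 (lexx K)))
   (fun z => le_trans (vxK z) (ler_wpDl K0 (lexx Kx))).
split => //.
- by have := weight_L2 mxx mA xb bA; congr (L2 mu2); apply/funext => z; rewrite mulrA.
- by have := weight_L2 mxx mB xb bB; congr (L2 mu2); apply/funext => z; rewrite mulrA.
- by move=> z; rewrite (le_trans (vK z))// lerDl.
- by move=> z; rewrite (le_trans (vxK z))// lerDr.
- by apply: aeS2 eG yy => z [-> ->] [-> ->]; rewrite dot_ey; split; ring.
have mF0 : measurable_fun setT (nonlin sigma w (wderiv ex w) : plane R -> R).
  have m1 := L2_measurable (ft_L2 fw); have m2 := L2_measurable (ft_L2 fwx).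
  apply: measurable_funD; apply: measurable_funM (measurable_cst _) _.
    exact: (measurable_funX 2 m1).
  exact: (measurable_funX 2 m2).
have eF : {ae mu2, forall z, nonlin sigma v vx z = nonlin sigma w (wderiv ex w) z}.
  by apply: aeS2 wv wxv => z e1 e2; rewrite /nonlin e1 e2.
have lF0 := L2_ae mF0 eF lF.1.
have c1 := convx_conv (@rint_dpker R) lF0.
have c2 := convx_conv (@rint_pker R) (ft_L2 hG).
have c3 := conv_ae ex (@rint_dpker R) lF.1 lF0 eF.
apply: aeS2 (ae_and (ae_and wv wxv) eq) (ae_and c1 (ae_and c2 c3)).
move=> z [[e1 e2] e3] [e4 [e5 e6]].
move: e3; rewrite e5 -/(nonlin sigma w (wderiv ex w)) convx_derive1_pker// e4 -e6.
rewrite -e1 -e2 => /eqP; rewrite -!addrA addr_eq0 => /eqP ->; ring.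
Qed.

End snapshot.

(** * Vanishing of the derivative of the energy *)

Section energy.
Context {R : realType}.
Local Notation leb1 := (@lebesgue_measure R).
Local Notation mu2 := (@lebesgue_measure R \x @lebesgue_measure R)%E.
Variables (sigma M : R) (w wt wx wtx A B At Bt v vx G GA GB : R * R -> R).
Hypothesis sn : snapshot sigma w wt wx wtx A B At Bt v vx G GA GB M.
Implicit Types z : R * R.

Let lv := sn_v sn.
Let lvx := sn_vx sn.
Let mv := L2_measurable lv.
Let mvx := L2_measurable lvx.
Let lA := ft_L2r (sn_w sn).
Let lB := ft_L2i (sn_w sn).
Let lxA : L2 mu2 (fun z => z.1 * A z) := ft_L2i (sn_wx sn).
Let lxB : L2 mu2 (fun z => z.1 * B z).
Proof. by have := L2N (ft_L2r (sn_wx sn)); under eq_fun do rewrite opprK. Qed.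

Lemma sn_ft_v : is_ft v A B.
Proof.
apply: (ft_ae (sn_w sn) mv); [exact: L2_measurable lA|exact: L2_measurable lB|exact: sn_vw sn|exact: aeW..].
Qed.

Lemma sn_ft_vx : is_ft vx (fun z => - (z.1 * B z)) (fun z => z.1 * A z).
Proof.
apply: (ft_ae (sn_wx sn) mvx); [exact: L2_measurable (ft_L2r (sn_wx sn))|exact: L2_measurable lxA|exact: sn_vxw sn|exact: aeW..].
Qed.

Let F := nonlin sigma v vx.
Let N z := vx z * v z.

Let lF := (nonlin_L2 sigma lv lvx (sn_vM sn) (sn_vxM sn)).1.
Let rF := (nonlin_L2 sigma lv lvx (sn_vM sn) (sn_vxM sn)).2.
Let lN : L2 mu2 N := L2_bounded mu2 M mvx (sn_vxM sn) lv.
Let rN : rint mu2 N := L2M lvx lv.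

Lemma sn_ft_F : is_ft F (Cf F) (fun z => - Sf F z).
Proof. exact: ft_rint. Qed.

Let ftN : is_ft N (Cf N) (fun z => - Sf N z).
Proof. exact: ft_rint. Qed.

(** The factor [1 + xi^2] is the action of [1 - d_x^2]: it turns [p] into 1 and [p_x] into
    [i xi]. *)
Lemma sn_fourier_eq : {ae mu2, forall z,
  (1 + z.1 ^+ 2) * At z = - sigma * ((1 + z.1 ^+ 2) * Cf N z) - z.1 * Sf F z - GA z /\
  (1 + z.1 ^+ 2) * Bt z = sigma * ((1 + z.1 ^+ 2) * Sf N z) - z.1 * Cf F z - GB z}.
Proof.
have h := ftB (ftB (ftZ (- sigma) ftN) (ft_conv ex (@rint_dpker R) sn_ft_F))
  (ft_conv ex (@rint_pker R) (sn_G sn)).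
have [|e1 e2] := ft_unique (sn_wt sn) h.
  by apply: aeS (sn_eq sn) => z ->; rewrite /N; ring.
apply: aeS2 e1 e2 => z -> ->; rewrite kc_dpker ks_dpker kc_pker ks_pker.
have h0 : 1 + z.1 ^+ 2 != 0 by rewrite gt_eqF// ltr_pwDl// sqr_ge0.
by split; field.
Qed.

(** [commutator] with [w = v] makes the pairing equal to minus one half of itself. *)
Let ip_sq : ip mu2 (fun z => v z * v z) vx = 0.
Proof.
have rvv : rint mu2 (fun z => v z * v z) := L2M lv lv.
have lvv : L2 mu2 (fun z => v z * v z) := L2_bounded mu2 M mv (sn_vM sn) lv.
have := commutator sn_ft_v lxA lxB (ft_rint rvv lvv) lv lvx (sn_vM sn) (sn_vM sn)
  (fwd_cvg sn_ft_v sn_ft_vx).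
have := ft_ip sn_ft_vx (ft_rint rvv lvv); rewrite ipC ipNl//; last exact: Cf_L2.
by move=> <-; lra.
Qed.

(** The left side is the pairing of [- v_xx] with [v v_x], and [commutator] is applied to [v_x] in
    the role of [v]. The function [v_xx] appears only through its transform. *)
Let ip_cube : ip mu2 (fun z => z.1 * (z.1 * A z)) (Cf N) +
    ip mu2 (fun z => z.1 * (z.1 * B z)) (fun z => - Sf N z) =
  2^-1 * ip mu2 (fun z => vx z * vx z) vx.
Proof.
have lxxB : L2 mu2 (fun z => z.1 * - (z.1 * B z)).
  by have := L2N (sn_B2 sn); congr (L2 mu2); apply/funext => z; rewrite mulrN.
have := commutator sn_ft_vx lxxB (sn_A2 sn) ftN lv lvx (sn_vxM sn) (sn_vM sn)
  (fwd_cvg sn_ft_v sn_ft_vx).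
have -> : ip mu2 (fun z => z.1 * - (z.1 * B z)) (fun z => - Sf N z) =
    - ip mu2 (fun z => z.1 * (z.1 * B z)) (fun z => - Sf N z).
  rewrite -ipNl; [|exact: (sn_B2 sn)|exact/L2N/Sf_L2].
  by congr ip; apply/funext => z; rewrite mulrN.
by move=> h; lra.
Qed.

(** The sum pairs [w] with [(1 - d_x^2) w_t]. Only [At] and [xi At] are given in L^2, so the factor
    [1 + xi^2] is formed inside one integral, the equation is substituted pointwise, and the result
    is split again into pairings that are all integrable. *)
Lemma energy_derivative : ip mu2 w wt + ip mu2 wx wtx = 0.
Proof.
have lAt := ft_L2r (sn_wt sn); have lBt := ft_L2i (sn_wt sn).
have lxAt : L2 mu2 (fun z => z.1 * At z) := ft_L2i (sn_wtx sn).
have lxBt : L2 mu2 (fun z => z.1 * Bt z).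
  by have := L2N (ft_L2r (sn_wtx sn)); under eq_fun do rewrite opprK.
have lCF := Cf_L2 rF lF; have lSF := L2N (Sf_L2 rF lF).
have lCN := Cf_L2 rN lN; have lSN := L2N (Sf_L2 rN lN).
have lA2 := sn_A2 sn; have lB2 := sn_B2 sn.
rewrite (ft_ip (sn_w sn) (sn_wt sn)) (ft_ip (sn_wx sn) (sn_wtx sn)).
rewrite (ipNl lxB (ft_L2r (sn_wtx sn))) (ipNr lxBt lxB) opprK.
have i1 := L2M lA lAt; have i2 := L2M lB lBt; have i3 := L2M lxA lxAt; have i4 := L2M lxB lxBt.
have j1 := L2M lA lCN; have j2 := L2M lB lSN; have j3 := L2M lA2 lCN; have j4 := L2M lB2 lSN.
have j5 := L2M lxA lSF; have j6 := L2M lxB lCF.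
have -> : ip mu2 A At + ip mu2 B Bt + (ip mu2 (fun z => z.1 * B z) (fun z => z.1 * Bt z) +
      ip mu2 (fun z => z.1 * A z) (fun z => z.1 * At z)) =
    - sigma * ((ip mu2 A (Cf N) + ip mu2 B (fun z => - Sf N z)) +
      (ip mu2 (fun z => z.1 * (z.1 * A z)) (Cf N) +
       ip mu2 (fun z => z.1 * (z.1 * B z)) (fun z => - Sf N z))) +
    (ip mu2 (fun z => z.1 * A z) (fun z => - Sf F z) - ip mu2 (fun z => z.1 * B z) (Cf F)).
  have k1 := rintD (rintD i1 i2) (rintD i4 i3).
  have k2 := rintD (rintD j1 j2) (rintD j3 j4).
  have k3 := rintB j5 j6.
  have k4 := rintD (rintZ (- sigma) k2) k3.
  have E1 : ip mu2 A At + ip mu2 B Bt + (ip mu2 (fun z => z.1 * B z) (fun z => z.1 * Bt z) +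
      ip mu2 (fun z => z.1 * A z) (fun z => z.1 * At z)) = \int[mu2]_z (A z * At z + B z * Bt z +
      (z.1 * B z * (z.1 * Bt z) + z.1 * A z * (z.1 * At z))).
    rewrite (RintegralD _ (rintD i1 i2) (rintD i4 i3))//.
    by rewrite (RintegralD _ i1 i2)// (RintegralD _ i4 i3).
  have E2 : - sigma * ((ip mu2 A (Cf N) + ip mu2 B (fun z => - Sf N z)) +
      (ip mu2 (fun z => z.1 * (z.1 * A z)) (Cf N) +
       ip mu2 (fun z => z.1 * (z.1 * B z)) (fun z => - Sf N z))) +
    (ip mu2 (fun z => z.1 * A z) (fun z => - Sf F z) - ip mu2 (fun z => z.1 * B z) (Cf F)) =
    \int[mu2]_z (- sigma * (A z * Cf N z + B z * - Sf N z +
      (z.1 * (z.1 * A z) * Cf N z + z.1 * (z.1 * B z) * - Sf N z)) +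
      (z.1 * A z * - Sf F z - z.1 * B z * Cf F z)).
    rewrite (RintegralD _ (rintZ (- sigma) k2) k3)// RintegralZl//.
    rewrite (RintegralD _ (rintD j1 j2) (rintD j3 j4))//.
    by rewrite (RintegralD _ j1 j2)// (RintegralD _ j3 j4)// (RintegralB _ j5 j6).
  rewrite E1 E2; apply: Rintegral_ae; [exact: rint_measurable k1|exact: rint_measurable k4|].
  apply: aeS2 (ae_and sn_fourier_eq (sn_Gxi sn)) (@ae_fst_neq0 R) => z [[e1 e2] [e3 e4]] z0.
  (* The skew-symmetry of [dx^-1 d_y^2]: multiplied by [xi], the two terms become [- eta^2 A B] and
     [eta^2 A B]. *)
  have e5 : A z * GA z + B z * GB z = 0.
    by apply: (mulfI z0); rewrite mulr0 mulrDr !(mulrCA z.1) e3 e4; ring.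
  rewrite [LHS](_ : _ = A z * ((1 + z.1 ^+ 2) * At z) + B z * ((1 + z.1 ^+ 2) * Bt z)); last by ring.
  rewrite e1 e2 [LHS](_ : _ = - sigma * (A z * Cf N z + B z * - Sf N z +
      (z.1 * (z.1 * A z) * Cf N z + z.1 * (z.1 * B z) * - Sf N z)) +
      (z.1 * A z * - Sf F z - z.1 * B z * Cf F z) - (A z * GA z + B z * GB z)); last by ring.
  by rewrite e5 subr0.
rewrite ip_cube -(ft_ip sn_ft_v ftN).
have -> : ip mu2 v N = 0.
  by rewrite -ip_sq; apply: eq_Rintegral => z _; rewrite /N; ring.
have -> : ip mu2 (fun z => z.1 * A z) (fun z => - Sf F z) - ip mu2 (fun z => z.1 * B z) (Cf F) =
    ip mu2 vx F.
  by rewrite (ft_ip sn_ft_vx sn_ft_F) ipNl// addrC.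
have lvv : L2 mu2 (fun z => v z * v z) := L2_bounded mu2 M mv (sn_vM sn) lv.
have lvvx : L2 mu2 (fun z => vx z * vx z) := L2_bounded mu2 M mvx (sn_vxM sn) lvx.
have -> : ip mu2 vx F = (3 - sigma) / 2 * ip mu2 (fun z => v z * v z) vx +
    sigma / 2 * ip mu2 (fun z => vx z * vx z) vx.
  by rewrite -ipZl// -ipZl// -ipDl; [rewrite ipC|exact: L2Z..|].
(* The cubic term occurs with [- sigma / 2] from the transport term and with [sigma / 2] from
   [u_x^2]. *)
by rewrite ip_sq; ring.
Qed.

End energy.

(** * Transforms of tensor test functions *)

Section tensor_transform.
Context {R : realType}.
Local Notation leb1 := (@lebesgue_measure R).
Local Notation mu2 := (@lebesgue_measure R \x @lebesgue_measure R)%E.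
Implicit Types (b c : R -> R) (z : R * R) (x s : R).

Definition cos1 b s := \int[leb1]_x (b x * cos (s * x)).
Definition sin1 b s := \int[leb1]_x (b x * sin (s * x)).

Lemma Rint_derivative (F f : R -> R) (M : R) : (forall x : R, is_derive x 1 F (f x)) ->
  continuous f -> (forall x, M < `|x| -> F x = 0) -> (forall x, M < `|x| -> f x = 0) ->
  \int[leb1]_x f x = 0.
Proof.
move=> dF cf F0 f0; pose L := `|M| + 1; have L0 : 0 < L by rewrite ltr_wpDl.
have ML : M < L by rewrite (le_lt_trans (ler_norm _))// ltrDl.
transitivity (\int[leb1]_(x in `[- L, L]) f x).
  rewrite [RHS]Rintegral_indic1; apply: eq_Rintegral => x _.
  rewrite indicE mem_setE in_itv/= -ler_norml; case: leP => h; first by rewrite mul1r.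
  by rewrite mul0r f0// (lt_trans ML).
have LL : - L < L by rewrite (lt_trans _ L0)// oppr_lt0.
by rewrite (FTC2 LL dF cf) !F0 ?subrr// ?normrN gtr0_norm.
Qed.

Lemma trig_ibp b (b' : R -> R) s : bsmooth b -> bsmooth b' -> (forall x : R, is_derive x 1 b (b' x)) ->
  cos1 b' s = s * sin1 b s /\ sin1 b' s = - (s * cos1 b s).
Proof.
move=> bb bb' db; have ib := bsmooth_rint bb; have ib' := bsmooth_rint bb'.
have [_ [M hM]] := bb; have [_ [M' hM']] := bb'.
have cos_c : continuous (fun x => cos (s * x)).
  by move=> x; apply: (@continuous_comp _ _ _ (fun x => s * x) cos); [apply: cvgM; [exact: cvg_cst|exact: cvg_id]|exact: continuous_cos].
have sin_c : continuous (fun x => sin (s * x)).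
  by move=> x; apply: (@continuous_comp _ _ _ (fun x => s * x) sin); [apply: cvgM; [exact: cvg_cst|exact: cvg_id]|exact: continuous_sin].
have D1 (x : R) : is_derive x 1 (fun x => cos (s * x)) (- (s * sin (s * x))).
  have := is_derive_affine (is_derive_cos (s * x + 0)).
  by under eq_fun do rewrite addr0; rewrite addr0 mulNr [sin _ * s]mulrC.
have D2 (x : R) : is_derive x 1 (fun x => sin (s * x)) (s * cos (s * x)).
  have := is_derive_affine (is_derive_sin (s * x + 0)).
  by under eq_fun do rewrite addr0; rewrite addr0 [cos _ * s]mulrC.
have big x : Num.max M M' < `|x| -> b x = 0 /\ b' x = 0.
  by rewrite gt_max => /andP[h1 h2]; rewrite hM// hM'.
split.
- have := @Rint_derivative (fun x => b x * cos (s * x))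
    (fun x => b x * - (s * sin (s * x)) + cos (s * x) * b' x) (Num.max M M').
  have -> : \int[leb1]_x (b x * - (s * sin (s * x)) + cos (s * x) * b' x) = cos1 b' s - s * sin1 b s.
    transitivity (\int[leb1]_x (b' x * cos (s * x) - s * (b x * sin (s * x)))).
      by apply: eq_Rintegral => x _; ring.
    rewrite RintegralB ?RintegralZl//; [exact: rint_ks|exact: rint_kc|exact/rintZ/rint_ks].
  move=> h; apply/eqP; rewrite -subr_eq0; apply/eqP; apply: h.
  + by move=> x; exact: is_deriveM.
  + move=> x; apply: cvgD; apply: cvgM; [exact: (bsmooth_continuous bb)| |exact: cos_c|exact: (bsmooth_continuous bb')].
    by apply: cvgN; apply: cvgM; [exact: cvg_cst|exact: sin_c].
  + by move=> x /big[-> _]; rewrite mul0r.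
  + by move=> x /big[-> ->]; rewrite mul0r mulr0 addr0.
- have := @Rint_derivative (fun x => b x * sin (s * x))
    (fun x => b x * (s * cos (s * x)) + sin (s * x) * b' x) (Num.max M M').
  have -> : \int[leb1]_x (b x * (s * cos (s * x)) + sin (s * x) * b' x) = s * cos1 b s + sin1 b' s.
    transitivity (\int[leb1]_x (s * (b x * cos (s * x)) + b' x * sin (s * x))).
      by apply: eq_Rintegral => x _; ring.
    rewrite RintegralD ?RintegralZl//; [exact: rint_kc|exact/rintZ/rint_kc|exact: rint_ks].
  move=> h; apply/eqP; rewrite -addr_eq0 addrC; apply/eqP; apply: h.
  + by move=> x; exact: is_deriveM.
  + move=> x; apply: cvgD; apply: cvgM; [exact: (bsmooth_continuous bb)| |exact: sin_c|exact: (bsmooth_continuous bb')].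
    by apply: cvgM; [exact: cvg_cst|exact: cos_c].
  + by move=> x /big[-> _]; rewrite mul0r.
  + by move=> x /big[-> ->]; rewrite mul0r mulr0 addr0.
Qed.

Lemma tensor_rint b c : bsmooth b -> bsmooth c -> rint mu2 (tensor b c).
Proof. by move=> bb bc; exact: (rint_tensor (bsmooth_rint bb) (bsmooth_rint bc)). Qed.

Lemma Cf_tensor b c z : bsmooth b -> bsmooth c -> Cf (tensor b c) z =
  (2 * pi)^-1 * (cos1 b z.1 * cos1 c z.2 - sin1 b z.1 * sin1 c z.2).
Proof.
move=> /bsmooth_rint ib /bsmooth_rint ic; rewrite /Cf; congr (_ * _).
transitivity (\int[mu2]_w ((b w.1 * cos (z.1 * w.1)) * (c w.2 * cos (z.2 * w.2)) -
   (b w.1 * sin (z.1 * w.1)) * (c w.2 * sin (z.2 * w.2)))).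
  by apply: eq_Rintegral => w _; rewrite /dot cosD ![z.1 * _]mulrC ![z.2 * _]mulrC /tensor; ring.
have i1 := rint_tensor (rint_kc ib z.1) (rint_kc ic z.2).
have i2 := rint_tensor (rint_ks ib z.1) (rint_ks ic z.2).
rewrite RintegralB// (Rintegral_tensor (rint_kc ib z.1) (rint_kc ic z.2)).
by rewrite (Rintegral_tensor (rint_ks ib z.1) (rint_ks ic z.2)).
Qed.

Lemma Sf_tensor b c z : bsmooth b -> bsmooth c -> Sf (tensor b c) z =
  (2 * pi)^-1 * (sin1 b z.1 * cos1 c z.2 + cos1 b z.1 * sin1 c z.2).
Proof.
move=> /bsmooth_rint ib /bsmooth_rint ic; rewrite /Sf; congr (_ * _).
transitivity (\int[mu2]_w ((b w.1 * sin (z.1 * w.1)) * (c w.2 * cos (z.2 * w.2)) +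
   (b w.1 * cos (z.1 * w.1)) * (c w.2 * sin (z.2 * w.2)))).
  by apply: eq_Rintegral => w _; rewrite /dot sinD ![z.1 * _]mulrC ![z.2 * _]mulrC /tensor; ring.
have i1 := rint_tensor (rint_ks ib z.1) (rint_kc ic z.2).
have i2 := rint_tensor (rint_kc ib z.1) (rint_ks ic z.2).
rewrite RintegralD// (Rintegral_tensor (rint_ks ib z.1) (rint_kc ic z.2)).
by rewrite (Rintegral_tensor (rint_kc ib z.1) (rint_ks ic z.2)).
Qed.

Lemma ft_tensor b c : bsmooth b -> bsmooth c ->
  is_ft (tensor b c) (Cf (tensor b c)) (fun z => - Sf (tensor b c) z).
Proof. by move=> bb bc; apply: ft_rint; [exact: tensor_rint|exact: tensor_L2]. Qed.

(** The symbol [i xi] applied to [Cf - i Sf], by integration by parts in one variable. *)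
Lemma ft_tensor_dx b (b' c : R -> R) : bsmooth b -> bsmooth b' -> bsmooth c ->
  (forall x : R, is_derive x 1 b (b' x)) ->
  is_ft (tensor b' c) (fun z => z.1 * Sf (tensor b c) z) (fun z => z.1 * Cf (tensor b c) z).
Proof.
move=> bb bb' bc db; have := ft_tensor bb' bc; congr is_ft; apply/funext => z.
- rewrite Cf_tensor// Sf_tensor//; have [-> ->] := trig_ibp z.1 bb bb' db; ring.
- rewrite Sf_tensor// Cf_tensor//; have [-> ->] := trig_ibp z.1 bb bb' db; ring.
Qed.

Lemma ft_tensor_dyy b c (c' c'' : R -> R) : bsmooth b -> bsmooth c -> bsmooth c' -> bsmooth c'' ->
  (forall x : R, is_derive x 1 c (c' x)) -> (forall x : R, is_derive x 1 c' (c'' x)) ->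
  is_ft (tensor b c'') (fun z => - (z.2 ^+ 2 * Cf (tensor b c) z))
    (fun z => z.2 ^+ 2 * Sf (tensor b c) z).
Proof.
move=> bb bc bc' bc'' dc dc'; have := ft_tensor bb bc''; congr is_ft; apply/funext => z.
- rewrite !Cf_tensor//; have [-> ->] := trig_ibp z.2 bc' bc'' dc'.
  by have [-> ->] := trig_ibp z.2 bc bc' dc; ring.
- rewrite !Sf_tensor//; have [-> ->] := trig_ibp z.2 bc' bc'' dc'.
  by have [-> ->] := trig_ibp z.2 bc bc' dc; ring.
Qed.

Lemma bsmooth_scale b (a : R) : 0 < a -> bsmooth b -> bsmooth (fun x => b (a * x)).
Proof.
move=> a0 [sb [M hM]]; split.
  by have := smooth_affine a 0 sb; under eq_fun do rewrite addr0.
exists (M / a) => x h; apply: hM; rewrite normrM gtr0_norm// mulrC -ltr_pdivrMr//.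
Qed.

Lemma is_derive_scale b (b' : R -> R) (a : R) : (forall x : R, is_derive x 1 b (b' x)) ->
  forall x : R, is_derive x 1 (fun x => b (a * x)) (a * b' (a * x)).
Proof.
move=> db x; have := is_derive_affine (db (a * x + 0)).
by under eq_fun do rewrite addr0; rewrite addr0 [a * b' _]mulrC.
Qed.

Lemma n2_tensor b c : bsmooth b -> bsmooth c ->
  n2 mu2 (tensor b c) = (\int[leb1]_x (b x ^+ 2)) * (\int[leb1]_x (c x ^+ 2)).
Proof.
have sq f : bsmooth f -> rint leb1 (fun x => f x ^+ 2).
  move=> bf; have [M hM] := bsmooth_bounded bf.
  exact: (rint_bounded leb1 M (bsmooth_measurable bf) hM (bsmooth_rint bf)).
move=> bb bc; rewrite n2E -(Rintegral_tensor (sq _ bb) (sq _ bc)).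
by apply: eq_Rintegral => z _; rewrite exprMn.
Qed.

End tensor_transform.

(** * Propagation from a strip to the plane *)

Section unique_continuation.
Context {R : realType}.
Local Notation leb1 := (@lebesgue_measure R).
Local Notation mu2 := (@lebesgue_measure R \x @lebesgue_measure R)%E.
Variables (sigma M : R) (w wt wx wtx A B At Bt v vx G GA GB : R * R -> R).
Hypothesis sn : snapshot sigma w wt wx wtx A B At Bt v vx G GA GB M.
Hypothesis sigma03 : 0 <= sigma <= 3.
Variables (a b b1 : R).
Hypotheses (ab : a < b) (bb1 : b < b1).
Hypothesis w0 : forall z, a < z.1 < b1 -> w z = 0.
Hypothesis wt0 : {ae mu2, forall z, a < z.1 < b1 -> wt z = 0}.
Implicit Types z : R * R.

Let lv := sn_v sn.
Let lvx := sn_vx sn.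
Let mv := L2_measurable lv.
Let mvx := L2_measurable lvx.
Let F := nonlin sigma v vx.
Let lF := (nonlin_L2 sigma lv lvx (sn_vM sn) (sn_vxM sn)).1.
Let rF := (nonlin_L2 sigma lv lvx (sn_vM sn) (sn_vxM sn)).2.

Lemma strip_v : {ae mu2, forall z, a < z.1 < b1 -> v z = 0}.
Proof. by apply: aeS (sn_vw sn) => z <-; exact: w0. Qed.

Let strip z : R := \1_(`]a, b[%classic : set R) z.1.

Let stripE z : strip z = (a < z.1 < b)%R%:R.
Proof. by rewrite /strip indicE mem_setE in_itv. Qed.

Let strip_measurable : measurable_fun setT (strip : plane R -> R).
Proof. by apply: (measurableT_comp _ measurable_fst); exact: measurable_indic. Qed.

Let strip_le1 z : `|strip z| <= 1. Proof. exact: indic_norm_le1. Qed.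

(** [vx] is the L^2 limit of forward quotients. These look to the right by [1/(n+1)], whence the
    narrowing of the strip from [b1] to [b]. *)
Lemma strip_vx : {ae mu2, forall z, a < z.1 < b -> vx z = 0}.
Proof.
have c := cvg2_bounded mu2 1 strip_measurable strip_le1 (fun n => fwd_L2 n lv) lvx
  (fwd_cvg (sn_ft_v sn) (sn_ft_vx sn)).
have lsx := L2_bounded mu2 1 strip_measurable strip_le1 lvx.
have h : n2 mu2 (fun z => strip z * vx z) = 0.
  apply: (cvg_unique _ _ c) => //; apply: cvg_near_cst.
  (* Beyond this index the step [1/(n+1)] is smaller than [b1 - b]. *)
  exists (Num.trunc (b1 - b)^-1) => // n /= Nn.
  have hn : n.+1%:R^-1 < b1 - b.
    rewrite invf_plt ?posrE ?subr_gt0//; apply: (lt_le_trans (truncnS_gt _)).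
    by rewrite ler_nat ltnS.
  have n0 : 0 < n.+1%:R^-1 :> R by rewrite invr_gt0.
  rewrite -[RHS]n2N; apply: n2_ae.
  - exact: L2_measurable (L2B (L2_bounded mu2 1 strip_measurable strip_le1 (fwd_L2 n lv)) lsx).
  - exact: L2_measurable (L2N lsx).
  apply: aeS2 strip_v (tr_ae (n.+1%:R^-1, 0) strip_v) => z h1 h2.
  rewrite stripE; have [/andP[z1 z2]|_] := boolP (a < z.1 < b); last by rewrite !mul0r subrr oppr0.
  rewrite !mul1r; rewrite /fwd /tr/= in h2 *.
  rewrite h1 ?z1 ?(lt_trans z2)// h2; first by rewrite subrr mulr0 sub0r.
  apply/andP; split; first by rewrite (lt_trans z1)// ltrDl.
  by rewrite (lt_le_trans (ltrD z2 hn))// addrC subrK.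
apply: aeS (n2_eq0 lsx h) => z + zab.
by rewrite stripE zab mul1r.
Qed.

Lemma strip_F : {ae mu2, forall z, a < z.1 < b -> F z = 0}.
Proof.
apply: aeS2 strip_v strip_vx => z h1 h2 /[dup] zab /andP[z1 z2].
by rewrite /F /nonlin h2// h1 ?z1 ?(lt_trans z2)// expr0n/= !mulr0 addr0.
Qed.

Lemma strip_conv : {ae mu2, forall z, a < z.1 < b ->
  conv ex dpker F z + conv ex pker G z = 0}.
Proof.
apply: aeS2 (ae_and strip_v wt0) (sn_eq sn) => z [h1 h2] + /andP[z1 z2].
have zb : a < z.1 < b1 by rewrite z1 (lt_trans z2).
rewrite h2// h1// mul0r mulr0 oppr0 sub0r -opprD => /esym/eqP.
by rewrite oppr_eq0 => /eqP.
Qed.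

Section tested.
Variables (f f' g g' g'' : R -> R).
Hypotheses (bf : bsmooth f) (bf' : bsmooth f') (df : forall x : R, is_derive x 1 f (f' x)).
Hypotheses (bg : bsmooth g) (bg' : bsmooth g') (bg'' : bsmooth g'').
Hypotheses (dg : forall x : R, is_derive x 1 g (g' x)) (dg' : forall x : R, is_derive x 1 g' (g'' x)).
Hypotheses (f0 : forall x, ~~ (a < x < b) -> f x = 0) (f'0 : forall x, ~~ (a < x < b) -> f' x = 0).

Let P := Cf (tensor f g).
Let Q := Sf (tensor f g).
Let k := @rint_pker R.
Let q := @rint_dpker R.

(* Integrating [p_x * F + p * G = 0] against the [x] derivative of [phi = f (x) g], where [phi F = 0],
   leaves [<phi, p * F> = - <phi_yy, p * v>]. *)
Lemma tested_identity :
  ip mu2 (conv ex pker (tensor f g)) F = - ip mu2 (tensor f g'') (conv ex pker v).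
Proof.
have hphi := ft_tensor bf bg.
have hx := ft_tensor_dx bf bf' bg df.
have hyy := ft_tensor_dyy bf bg bg' bg'' dg dg'.
have hF := sn_ft_F sn; have hG := sn_G sn; have hv := sn_ft_v sn.
have h1 := ft_ip hx (ft_conv ex q hF).
have h2 := ft_ip hx (ft_conv ex k hG).
have h3 := ft_ip (ft_conv ex k hphi) hF.
have h4 := ft_ip hyy (ft_conv ex k hv).
have h5 := ft_ip hphi hF.
have L := @L2M _ _ R mu2.
have i1 := L _ _ (ft_L2r hx) (ft_L2r (ft_conv ex q hF)).
have i2 := L _ _ (ft_L2i hx) (ft_L2i (ft_conv ex q hF)).
have i3 := L _ _ (ft_L2r hx) (ft_L2r (ft_conv ex k hG)).
have i4 := L _ _ (ft_L2i hx) (ft_L2i (ft_conv ex k hG)).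
have i5 := L _ _ (ft_L2r (ft_conv ex k hphi)) (ft_L2r hF).
have i6 := L _ _ (ft_L2i (ft_conv ex k hphi)) (ft_L2i hF).
have i7 := L _ _ (ft_L2r hyy) (ft_L2r (ft_conv ex k hv)).
have i8 := L _ _ (ft_L2i hyy) (ft_L2i (ft_conv ex k hv)).
have i9 := L _ _ (ft_L2r hphi) (ft_L2r hF).
have i10 := L _ _ (ft_L2i hphi) (ft_L2i hF).
have j12 := rintD i1 i2; have j34 := rintD i3 i4; have j56 := rintD i5 i6.
have j78 := rintD i7 i8; have j90 := rintD i9 i10.
have k14 := rintD j12 j34; have k58 := rintD j56 j78.
have k18 := rintD k14 k58.
move: h1 h2 h3 h4 h5.
rewrite -(RintegralD _ i1 i2)// -(RintegralD _ i3 i4)// -(RintegralD _ i5 i6)//.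
rewrite -(RintegralD _ i7 i8)// -(RintegralD _ i9 i10)// => h1 h2 h3 h4 h5.
have lx := tensor_L2 bf' bg.
have lphi := tensor_L2 bf bg; have lcF := ft_L2 (ft_conv ex q hF); have lcG := ft_L2 (ft_conv ex k hG).
have Z (c : R * R -> R) : rint mu2 c -> {ae mu2, forall z, c z = 0} -> \int[mu2]_z c z = 0.
  move=> ci c0; rewrite -[RHS](mul0r (fine (mu2 setT))) -Rintegral_cst//.
  by apply: Rintegral_ae => //; exact: rint_measurable ci.
have phiF : ip mu2 (tensor f g) F = 0.
  apply: (Z _ (L2M lphi lF)); apply: aeS strip_F => z h.
  by rewrite /tensor -/F; have [/h ->|/f0 ->] := boolP (a < z.1 < b); rewrite ?mulr0// !mul0r.
have phiH : ip mu2 (tensor f' g) (conv ex dpker F) + ip mu2 (tensor f' g) (conv ex pker G) = 0.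
  rewrite -(RintegralD _ (L2M lx lcF) (L2M lx lcG))//.
  apply: (Z _ (rintD (L2M lx lcF) (L2M lx lcG))); apply: aeS strip_conv => z h.
  by rewrite -mulrDr /tensor -/F; have [/h ->|/f'0 ->] := boolP (a < z.1 < b); rewrite ?mulr0// !mul0r.
(* This is [p_xx = p - delta] paired with [f g]; on transforms it reads
   [xi^2 / (1 + xi^2) + 1 / (1 + xi^2) = 1]. The function [G] enters only through [xi GA] and
   [xi GB], and its contribution cancels that of [v]. *)
suff E : ip mu2 (tensor f' g) (conv ex dpker F) + ip mu2 (tensor f' g) (conv ex pker G) +
    (ip mu2 (conv ex pker (tensor f g)) F + ip mu2 (tensor f g'') (conv ex pker v)) =
    ip mu2 (tensor f g) F.
  by move: E; rewrite phiH phiF add0r => /eqP; rewrite addr_eq0 => /eqP.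
rewrite h1 h2 h3 h4 h5 -(RintegralD _ j12 j34)// -(RintegralD _ j56 j78)// -(RintegralD _ k14 k58)//.
apply: Rintegral_ae; [exact: rint_measurable k18|exact: rint_measurable j90|].
apply: aeS (sn_Gxi sn) => z [e1 e2].
rewrite kc_dpker ks_dpker kc_pker ks_pker.
have n0 : 1 + z.1 ^+ 2 != 0 by rewrite gt_eqF// ltr_pwDl// sqr_ge0.
move: e1 e2; rewrite -/F -/P -/Q; move: (P z) (Q z) (Cf F z) (Sf F z) => p r c s e1 e2.
rewrite !mul0r !add0r !subr0 !addr0.
have -> : z.1 * r * ((1 + z.1 ^+ 2)^-1 * GA z) = (1 + z.1 ^+ 2)^-1 * r * (z.1 * GA z) by ring.
have -> : z.1 * p * ((1 + z.1 ^+ 2)^-1 * GB z) = (1 + z.1 ^+ 2)^-1 * p * (z.1 * GB z) by ring.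
by rewrite e1 e2; field.
Qed.

Lemma tested_le : `|ip mu2 (conv ex pker (tensor f g)) F| <=
  Num.sqrt (n2 mu2 (tensor f g'')) * Num.sqrt (n2 mu2 (conv ex pker v)).
Proof.
rewrite tested_identity normrN; apply: cauchy_abs; first exact: tensor_L2.
exact: (conv_L2 ex k lv).1.
Qed.

End tested.

(** With exponent 1, [bumpn] is [bump] itself: [psi] is positive on the strip and localises in [x],
    while [chi] is the cut-off to be dilated in [y]. *)
Let psi : R -> R := bumpn 1 a b.
Let chi : R -> R := bumpn 1 (- 1) 1.
Let kp := @rint_pker R.

Let bpsi : bsmooth psi. Proof. exact: bumpn_bsmooth. Qed.
Let bchi : bsmooth chi. Proof. exact: bumpn_bsmooth. Qed.

Let psi_gt0 x : a < x < b -> 0 < psi x.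
Proof. by move=> h; rewrite /psi /bumpn expr1 opprB addrCA subrr addr0 bump_gt0. Qed.

Let chi0_gt0 : 0 < chi 0.
Proof. by rewrite /chi /bumpn expr1 opprB addrCA subrr addr0 bump_gt0// ltrN10 ltr01. Qed.

Let psi_out x : ~~ (a < x < b) -> psi x = 0.
Proof. exact: bumpn_eq0. Qed.

(** Outside the interval, end points included, [psi] attains its minimum 0, so its derivative
    vanishes. *)
Let psi'_out (psi' : R -> R) : (forall x : R, is_derive x 1 psi (psi' x)) ->
  forall x, ~~ (a < x < b) -> psi' x = 0.
Proof.
move=> dpsi x /psi_out x0.
have xx : x - 1 < x + 1 by rewrite ltrD2l (lt_trans (ltrN10 R))// ltr01.
have d y : y \in `]x - 1, x + 1[ -> derivable psi y 1 by move=> _; have [] := dpsi y.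
have xin : x \in `]x - 1, x + 1[ by rewrite in_itv/= ltrBlDr !ltrDl ltr01.
have [|_ e] := derive1_at_min (ltW xx) d xin.
  by move=> t _; rewrite x0; have /andP[] := bumpn_itv 1 a b t.
by have [_ <-] := dpsi x.
Qed.

(** The convolution [p * psi]: the weight through which a test function supported in the strip sees
    [F] on the whole plane. *)
Let Psi x := \int[leb1]_t (pker t * psi (x - t)).

Let rint_Psi x : rint leb1 (fun t => pker t * psi (x - t)).
Proof.
under eq_fun do rewrite mulrC; apply: (rint_bounded leb1 1) => //.
- by apply: (measurableT_comp (bsmooth_measurable bpsi)); exact: measurable_funB.
- by move=> t; have /andP[h1 h2] := bumpn_itv 1 a b (x - t); rewrite ger0_norm.
Qed.

Let pker_gt0 t : 0 < pker t :> R.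
Proof. by rewrite mulr_gt0 ?invr_gt0// expR_gt0. Qed.

Let integrand_ge0 x t : 0 <= pker t * psi (x - t).
Proof. by have /andP[h _] := bumpn_itv 1 a b (x - t); rewrite mulr_ge0// ltW. Qed.

(** Otherwise the nonnegative integrand would vanish almost everywhere, yet it is positive for [t]
    between [x - b] and [x - a]. *)
Let Psi_gt0 x : 0 < Psi x.
Proof.
rewrite lt_neqAle Rintegral_ge0 ?andbT//; apply/negP => /eqP/esym h.
have [N [mN N0 sub]] := @Rint_eq0 _ _ _ leb1 _ (integrand_ge0 x) (rint_Psi x) h.
pose I : set (measurableTypeR R) := `]x - b, x - a[%classic.
have : (leb1 I <= leb1 N)%E.
  have mI : measurable I by exact: measurable_itv.
  apply: le_measure; [exact: mem_set mI|exact: mem_set mN|].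
  move=> t; rewrite /I/= in_itv/= => /andP[t1 t2].
  apply: sub => /= /eqP; rewrite mulf_eq0 gt_eqF//= gt_eqF// psi_gt0//.
  by apply/andP; split; lra.
rewrite N0 /I lebesgue_measure_itv/= lte_fin ltrD2l ltrN2 ab -EFinB lee_fin.
by move: ab; lra.
Qed.

Let K := \int[leb1]_t `|pker t : R|.

Let Psi_le x : `|Psi x| <= K.
Proof.
rewrite (le_trans (le_normr_Rintegral _ (rint_Psi x)))//.
apply: le_Rintegral => //; [exact/rint_norm/rint_Psi|exact: rint_norm|].
move=> t _; have /andP[h0 h1] := bumpn_itv 1 a b (x - t).
by rewrite normrM [X in _ * X]ger0_norm// ler_piMr.
Qed.

Let conv_tensor g z : conv ex pker (tensor psi g) z = Psi z.1 * g z.2.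
Proof.
rewrite /Psi -RintegralZr//; last exact: rint_Psi.
by apply: eq_Rintegral => t _; rewrite /tr /tensor/= mulr1 mulr0 oppr0 addr0 mulrA.
Qed.

Let Psi_measurable : measurable_fun setT (fun z : plane R => Psi z.1).
Proof.
have m : measurable_fun setT (fun z : plane R => psi z.1).
  exact: (measurableT_comp (bsmooth_measurable bpsi) measurable_fst).
have := conv_measurable ex kp m; apply: eq_measurable_fun => z _.
by apply: eq_Rintegral => t _; rewrite /tr/= mulr1.
Qed.

Let F_ge0 z : 0 <= F z.
Proof.
have /andP[s0 s3] := sigma03.
by rewrite addr_ge0// mulr_ge0 ?sqr_ge0// divr_ge0// subr_ge0.
Qed.

(** With [h = 1/(n+1)], the second [y] derivative of [psi (x) chi (h y)] has squared norm of order
    [h^4 * h^-1 = h^3]. By [tested_le] the integral is of order [h^(3/2)], which is bounded by [h]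
    as [h <= 1]. *)
Let test_cvg0 : (fun n : nat => \int[mu2]_z (Psi z.1 * chi (n.+1%:R^-1 * z.2) * F z)) @ \oo --> (0 : R).
Proof.
have [psi' bpsi' dpsi] := bsmooth_derive bpsi.
have [chi' bchi' dchi] := bsmooth_derive bchi.
have [chi'' bchi'' dchi'] := bsmooth_derive bchi'.
pose C := (\int[leb1]_x (psi x ^+ 2)) * (\int[leb1]_x (chi'' x ^+ 2)).
pose D := Num.sqrt C * Num.sqrt (n2 mu2 (conv ex pker v)).
have bd n : `|\int[mu2]_z (Psi z.1 * chi (n.+1%:R^-1 * z.2) * F z)| <= D * n.+1%:R^-1.
  set h := n.+1%:R^-1; have h0 : 0 < h by rewrite invr_gt0.
  have h1 : h <= 1 by rewrite invf_le1// ler1n.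
  have bc (c : R -> R) d : bsmooth c -> bsmooth (fun x => d * c (h * x)).
    move=> bc; have [sc [N hN]] := bsmooth_scale h0 bc; split; first exact: smoothM (smooth_cst d) sc.
    by exists N => x /hN ->; rewrite mulr0.
  have dc (c c' : R -> R) d : (forall x : R, is_derive x 1 c (c' x)) ->
      forall x : R, is_derive x 1 (fun x => d * c (h * x)) (d * h * c' (h * x)).
    move=> dcc x; have := is_deriveZ d (is_derive_scale h dcc x).
    by rewrite /GRing.scale/= mulrA.
  have := tested_le bpsi bpsi' dpsi (bc _ 1 bchi) (bc _ (1 * h) bchi') (bc _ (1 * h * h) bchi'')
    (dc _ _ 1 dchi) (dc _ _ (1 * h) dchi') psi_out (psi'_out dpsi).
  have -> : ip mu2 (conv ex pker (tensor psi (fun x => 1 * chi (h * x)))) F =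
      \int[mu2]_z (Psi z.1 * chi (h * z.2) * F z).
    by apply: eq_Rintegral => z _; rewrite conv_tensor mul1r.
  move/le_trans; apply; rewrite /D [leRHS]mulrAC ler_wpM2r ?sqrtr_ge0//.
  have -> : n2 mu2 (tensor psi (fun x => 1 * h * h * chi'' (h * x))) = h ^+ 3 * C.
    rewrite n2_tensor//; last exact: bc.
    have isq : rint leb1 (fun x => chi'' x ^+ 2).
      have [N hN] := bsmooth_bounded bchi''.
      exact: (rint_bounded leb1 N (bsmooth_measurable bchi'') hN (bsmooth_rint bchi'')).
    have := mpc_Rintegral (mpc_scale h0) isq => /= E.
    have -> : \int[leb1]_x (1 * h * h * chi'' (h * x)) ^+ 2 = h ^+ 4 * (h^-1 * \int[leb1]_x chi'' x ^+ 2).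
      rewrite -E -RintegralZl//; last exact: (mpc_rint (mpc_scale h0) isq).
      by apply: eq_Rintegral => x _; ring.
    by rewrite /C; field; rewrite gt_eqF.
  have C0 : 0 <= C by rewrite mulr_ge0// Rintegral_ge0// => x _; exact: sqr_ge0.
  rewrite sqrtrM ?exprn_ge0 ?(ltW h0)// mulrC ler_wpM2l ?sqrtr_ge0//.
  rewrite -[leRHS]ger0_norm ?(ltW h0)// -sqrtr_sqr ler_sqrt ?sqr_ge0//.
  by rewrite exprS ler_piMl ?sqr_ge0.
apply/cvgr0Pnorm_lt => e e0.
have /cvgr0Pnorm_lt/(_ _ e0) [N _ hN] : (fun n : nat => D * n.+1%:R^-1 : R) @ \oo --> (0 : R).
  by apply: (cvgn_eq (mulr0 D)); apply: cvgM; [exact: cvg_cst|exact: cvg_harmonic].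
by exists N => // n /= Nn; rewrite (le_lt_trans (bd n))// (le_lt_trans (ler_norm _))//; exact: hN.
Qed.

(** [F] is integrable and nonnegative, so [K F] dominates and the limit of the tested integrals is
    that of [Psi chi(0) F]. It is 0, and the weight is positive everywhere. *)
Lemma nonlin_eq0 : {ae mu2, forall z, F z = 0}.
Proof.
have mchi (h : R) : measurable_fun setT (fun z : plane R => chi (h * z.2)).
  apply: (measurableT_comp (bsmooth_measurable bchi)).
  exact: (measurable_funM (measurable_cst h) measurable_snd).
have mF := L2_measurable lF.
pose f z := Psi z.1 * chi 0 * F z.
have mf : measurable_fun setT (f : plane R -> R).
  exact: (measurable_funM (measurable_funM Psi_measurable (measurable_cst (chi 0))) mF).
have [fi c] : rint mu2 f /\ (fun n : nat => \int[mu2]_z (Psi z.1 * chi (n.+1%:R^-1 * z.2) * F z))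
    @ \oo --> \int[mu2]_z f z.
  apply: (dct mu2 (fun n z => Psi z.1 * chi (n.+1%:R^-1 * z.2) * F z) f (fun z => K * F z)) => //.
  - by move=> n; exact: (measurable_funM (measurable_funM Psi_measurable (mchi _)) mF).
  - exact: rintZ.
  - move=> n z; rewrite normrM (ger0_norm (F_ge0 z)) ler_wpM2r// normrM -[leRHS]mulr1 ler_pM//.
    by have /andP[h1 h2] := bumpn_itv 1 (- 1) 1 (n.+1%:R^-1 * z.2); rewrite ger0_norm.
  - apply: aeW => z; apply: cvgM; last exact: cvg_cst.
    apply: cvgM; first exact: cvg_cst.
    apply: (cvgn_comp (bsmooth_continuous bchi)); apply: (cvgn_eq (mul0r z.2)).
    by apply: cvgM; [exact: cvg_harmonic|exact: cvg_cst].
have f0 z : 0 <= f z := mulr_ge0 (mulr_ge0 (ltW (Psi_gt0 _)) (ltW chi0_gt0)) (F_ge0 z).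
have I0 : \int[mu2]_z f z = 0 by exact: (cvg_unique _ c test_cvg0).
apply: aeS (@Rint_eq0 _ _ _ mu2 _ f0 fi I0) => z /eqP.
by rewrite mulf_eq0 gt_eqF/= ?mulr_gt0// => /eqP.
Qed.

(** For [sigma < 3] the coefficient of [v^2] is positive and [w] vanishes. For [sigma = 3] only that
    of [v_x^2] is positive; then [xi A = xi B = 0], and [xi] is nonzero almost everywhere. In both
    cases the transform of [w] is 0. *)
Lemma snapshot_eq0 : n2 mu2 w + n2 mu2 wx = 0.
Proof.
have Z (f : R * R -> R) : L2 mu2 f -> {ae mu2, forall z, f z = 0} -> n2 mu2 f = 0.
  by move=> lf f0; rewrite -(n2_0 mu2); apply: n2_ae => //; exact: L2_measurable lf.
have lA := ft_L2r (sn_w sn); have lB := ft_L2i (sn_w sn).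
have AB0 : {ae mu2, forall z, A z = 0 /\ B z = 0}.
  have /andP[s0 s3] := sigma03.
  have h1 z : 0 <= (3 - sigma) / 2 * v z ^+ 2.
    by apply: mulr_ge0; [rewrite divr_ge0// subr_ge0|exact: sqr_ge0].
  have h2 z : 0 <= sigma / 2 * vx z ^+ 2.
    by apply: mulr_ge0; [rewrite divr_ge0|exact: sqr_ge0].
  have [s3'|s3'] := ltP sigma 3.
    have v0 : {ae mu2, forall z, w z = 0}.
      apply: aeS2 nonlin_eq0 (sn_vw sn) => z + ->.
      rewrite /F /nonlin => /eqP; rewrite paddr_eq0//.
      by rewrite mulf_eq0 gt_eqF/= ?divr_gt0 ?subr_gt0// sqrf_eq0 => /andP[/eqP].
    by have [h3 h4] := ft_zero (sn_w sn) v0; exact: ae_and.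
  have vx0 : {ae mu2, forall z, wx z = 0}.
    apply: aeS2 nonlin_eq0 (sn_vxw sn) => z + ->.
    rewrite /F /nonlin => /eqP; rewrite paddr_eq0//.
    have sg : 0 < sigma by rewrite (lt_le_trans _ s3').
    by move=> /andP[_]; rewrite mulf_eq0 gt_eqF/= ?divr_gt0// sqrf_eq0 => /eqP.
  have [h3 h4] := ft_zero (sn_wx sn) vx0.
  apply: aeS2 (ae_and h3 h4) (@ae_fst_neq0 R) => z [/eqP h5 /eqP h6] z0; move: h5 h6.
  by rewrite oppr_eq0 !mulf_eq0 (negbTE z0)/= => /eqP -> /eqP ->.
have -> : n2 mu2 w = 0.
  by rewrite (ft_n2 (sn_w sn)) !Z ?addr0//; apply: aeS AB0 => z [].
rewrite add0r (ft_n2 (sn_wx sn)) !Z ?addr0//.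
- exact: ft_L2i (sn_wx sn).
- by apply: aeS AB0 => z [-> _]; rewrite mulr0.
- exact: ft_L2r (sn_wx sn).
- by apply: aeS AB0 => z [_ ->]; rewrite mulr0 oppr0.
Qed.

End unique_continuation.

(** * Borel sets and continuous functions in the plane *)

Section plane_topology.
Context {R : realType}.
Local Notation leb1 := (@lebesgue_measure R).
Local Notation mu2 := (@lebesgue_measure R \x @lebesgue_measure R)%E.
Implicit Types (f phi : R * R -> R) (z : R * R).

Lemma open_rat_boxP (U : set (R * R)) : open U -> forall z, U z -> exists q : (rat * rat) * (rat * rat),
  (`]ratr q.1.1, ratr q.1.2[ `*` `]ratr q.2.1, ratr q.2.2[)%classic z /\
  (`]ratr q.1.1, ratr q.1.2[ `*` `]ratr q.2.1, ratr q.2.2[)%classic `<=` U.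
Proof.
move=> oU z Uz; have /nbhs_ballP[e /= e0 eU] : nbhs z U by exact: open_nbhs_nbhs.
have itv x : exists q : rat * rat, x - e < ratr q.1 < x /\ x < ratr q.2 < x + e.
  have /rat_in_itvoo[q1] : x - e < x by rewrite ltrBlDr ltrDl.
  have /rat_in_itvoo[q2] : x < x + e by rewrite ltrDl.
  by rewrite !in_itv/= => h2 h1; exists (q1, q2).
have [p [/andP[p1 p2] /andP[p3 p4]]] := itv z.1.
have [q [/andP[q1 q2] /andP[q3 q4]]] := itv z.2.
exists (p, q); split; first by split => /=; rewrite in_itv/=; apply/andP.
move=> w [/=]; rewrite !in_itv/= => /andP[w1 w2] /andP[w3 w4]; apply: eU.
by split; rewrite /ball/= ltr_norml; apply/andP; split; lra.
Qed.

(** The product sigma-algebra is generated by rectangles, not by open sets; an open set is the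
    countable union of the rational boxes it contains. *)
Lemma open_plane_measurable (U : set (R * R)) : open U -> measurable (U : set (plane R)).
Proof.
move=> oU; pose B (q : (rat * rat) * (rat * rat)) : set (plane R) :=
  (`]ratr q.1.1, ratr q.1.2[ `*` `]ratr q.2.1, ratr q.2.2[)%classic.
have -> : U = \bigcup_q (if `[< B q `<=` U >] then B q else set0).
  apply/seteqP; split => [z Uz|z [q _]]; last by case: asboolP => // h /h.
  have [q [Bz BU]] := open_rat_boxP oU Uz.
  by exists q => //; rewrite asboolT.
apply: countable_bigcupT_measurable; first exact: countableP.
by move=> q; case: asboolP => _; [exact: measurableX|exact: measurable0].
Qed.

Lemma continuous_plane_measurable f : continuous f -> measurable_fun setT (f : plane R -> R).
Proof.
move=> /continuousP cf; apply: (measurability _ (RGenOpens.measurableE R)).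
move=> _ [_ [a [b ->] <-]]; rewrite setTI; apply: open_plane_measurable.
exact/cf/interval_open.
Qed.

Lemma bounded_setP (V : normedModType R) (A : set V) : compact A -> exists N : R, forall x, A x -> `|x| <= N.
Proof.
move=> /compact_bounded[N [_ hN]]; exists (N + 1) => x Ax.
by apply: (hN (N + 1)) => //; rewrite ltrDl.
Qed.

Lemma compact_support_L2 f (K : set (R * R)) : continuous f -> compact K ->
  (forall z, ~ K z -> f z = 0) -> L2 mu2 f.
Proof.
move=> cf cK f0; have mf := continuous_plane_measurable cf.
have [N hN] := bounded_setP cK.
have [M hM] : exists M : R, forall x, (f @` K) x -> `|x| <= M.
  apply: (@bounded_setP R^o); apply: continuous_compact => //.
  exact: continuous_subspaceT.
pose n := (Num.trunc N).+1.
apply: (L2_le mu2 (fun z => M * \1_(box n) z)) => //; first exact/L2Z/L2_box_indic.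
move=> z; have [Kz|/f0 ->] := pselect (K z); last by rewrite normr0.
rewrite indicE mem_set ?mulr1.
  by rewrite (le_trans _ (ler_norm M))// hM//; exists z.
have h : `|z| <= n%:R by rewrite (le_trans (hN _ Kz))// ltW// truncnS_gt.
by have : Num.max `|z.1| `|z.2| <= n%:R := h; rewrite ge_max => /andP[].
Qed.

Lemma test_L2 phi : test_function phi -> L2 mu2 phi /\ L2 mu2 ('D_ex phi).
Proof.
move=> [cphi ck]; split.
  apply: (compact_support_L2 (cphi 0%N) ck) => z nz; apply: contrapT => h.
  by apply: nz; apply: subset_closure => /=; exact/eqP.
have [_ c1 _] := cphi 1%N.
apply: (compact_support_L2 c1 ck) => z nz.
have oC : open (~` closure [set z | phi z != 0]) by exact/closed_openC/closed_closure.
have h : \forall w \near z, phi w = 0.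
  apply: filterS (open_nbhs_nbhs (conj oC nz)) => w nw; apply: contrapT => h.
  by apply: nw; apply: subset_closure => /=; exact/eqP.
by rewrite (near_eq_derive _ (g := cst 0) h) derive_cst.
Qed.

(** A point where [f] is nonzero has a rational box around it where [f] is nonzero, and a box has
    positive measure. *)
Lemma continuous_ae_eq0 f : continuous f -> {ae mu2, forall z, f z = 0} -> forall z, f z = 0.
Proof.
move=> cf [N [mN N0 sub]] z; apply: contrapT => fz.
have oU : open [set w | f w != 0].
  have -> : [set w | f w != 0] = f @^-1` (~` [set 0]).
    by apply/seteqP; split => w /= /eqP.
  by move/continuousP : cf; apply; exact/closed_openC/closed_eq.
have [q [[/= q1 q2] qU]] := open_rat_boxP oU (introN eqP fz).
have : (mu2 (`]ratr q.1.1, ratr q.1.2[ `*` `]ratr q.2.1, ratr q.2.2[)%classic <= mu2 N)%E.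
  apply: le_measure; rewrite ?inE//; first exact: measurableX.
  by move=> w /qU h; apply: sub => /= /eqP; apply/negP.
move: q1 q2; rewrite !in_itv/= => /andP[h1 h2] /andP[h3 h4].
rewrite N0; apply/negP; rewrite -ltNge.
have -> A B : measurable A -> measurable B -> mu2 (A `*` B) = (leb1 A * leb1 B)%E.
  by move=> mA mB; exact: product_measure1E.
  rewrite !lebesgue_measure_itv/= !lte_fin (lt_trans h1 h2) (lt_trans h3 h4).
  by rewrite -!EFinB -EFinM lte_fin mulr_gt0// subr_gt0 ?(lt_trans h1 h2)// (lt_trans h3 h4).
- exact: measurable_itv.
- exact: measurable_itv.
Qed.

End plane_topology.

Lemma sqrte_sqr (R : realType) (x : \bar R) : (0 <= x -> (x `^ 2^-1) ^+ 2 = x)%E.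
Proof.
case: x => [r||] // h.
- by rewrite poweR_EFin powR12_sqrt// -EFin_expe sqr_sqrtr.
- by rewrite poweRyr ?invr_neq0// expe2 mulyy.
Qed.

(** * Evolution in time *)

Section evolution.
Context {R : realType}.
Local Notation leb1 := (@lebesgue_measure R).
Local Notation mu2 := (@lebesgue_measure R \x @lebesgue_measure R)%E.
Local Notation normc := ComplexField.Normc.normc.
Implicit Types (f g v w A B : R * R -> R) (z : R * R) (s sigma t x e d : R) (T : \bar R).

Lemma fourier_ft f A B : is_ft f A B -> is_fourier f (fourier f).
Proof.
move=> h; apply: (@xgetPex _ (cst 0) [set U | is_fourier f U]).
exists (fun z => A z +i* B z); apply/is_fourierP.
by have -> : @complex.Re R \o (fun z => A z +i* B z) = A by [].
Qed.

Lemma L2norm_sqr f : ((L2norm f) ^+ 2 = \int[mu2]_z (f z ^+ 2)%:E)%E.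
Proof.
by rewrite L2normE sqrte_sqr// integral_ge0// => z _; rewrite lee_fin sqr_ge0.
Qed.

(** Plancherel, together with a weight that is at least 1. The comparison is made in the extended
    reals, so [Hnorm] may be infinite. *)
Lemma n2_Hnorm s f A B : 0 <= s -> is_ft f A B -> ((n2 mu2 f)%:E <= Hnorm s f ^+ 2)%E.
Proof.
move=> s0 /fourier_ft hf; have h := (is_fourierP _ _).1 hf.
have lA := ft_L2r h; have lB := ft_L2i h.
rewrite /Hnorm L2norm_sqr (ft_n2 h) !n2E -RintegralD//; [|exact: lA.2|exact: lB.2].
rewrite -rint_fin; last exact: (rintD lA.2 lB.2).
have mn : measurable_fun setT (fun z : plane R => normc (fourier f z)).
  exact: normc_measurable (L2_measurable lA) (L2_measurable lB).
apply: ge0_le_integral => //.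
- by move=> z _; rewrite lee_fin addr_ge0 ?sqr_ge0.
- by apply/measurable_EFinP; exact: rint_measurable (rintD lA.2 lB.2).
- apply/measurable_EFinP; apply: measurable_funX; apply: measurable_funM => //.
  exact: (measurableT_comp (powR_measurable (s / 2)) bracket_measurable).
move=> z _; rewrite lee_fin -normc_sqr exprMn -[leLHS]mul1r ler_wpM2r ?sqr_ge0//.
have b1 := bracket_ge1 z; rewrite -/(bracket z).
have h1 : 1 <= bracket z `^ (s / 2).
  by rewrite -[leLHS](powRr0 (bracket z)) ler_powR// divr_ge0.
by rewrite -[leLHS](expr1n _ 2) ler_pXn2r ?nnegrE// (le_trans ler01).
Qed.

Lemma Xnorm_sqr s f : (Xnorm s f ^+ 2 =
  Hnorm s f ^+ 2 + Hnorm s (dxinv f) ^+ 2 + Hnorm s (wderiv ex f) ^+ 2)%E.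
Proof.
by rewrite /Xnorm sqrte_sqr// !adde_ge0// L2norm_sqr integral_ge0// => z _; rewrite lee_fin sqr_ge0.
Qed.

(** [wderiv] is a choice of representative, so the derivative chosen for a difference quotient and
    the quotient of the chosen derivatives agree only almost everywhere. *)
Lemma wderiv_unique f v w : is_wderiv ex f v -> is_wderiv ex f w -> {ae mu2, forall z, v z = w z}.
Proof.
move=> [_ /isL2P lv hv] [_ /isL2P lw hw].
have h : {ae mu2, forall z, v z - w z = 0}.
  apply: (test_orthogonal (L2B lv lw)) => b c bb bc; have lt := tensor_L2 bb bc.
  have tt := tensor_test bb bc; rewrite ipBl//.
  have := hv _ tt; rewrite (hw _ tt) => /oppr_inj e.
  by rewrite /ip e subrr.
by apply: aeS h => z /eqP; rewrite subr_eq0 => /eqP.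
Qed.

Lemma wderiv_lin f g w f' g' w' e : is_wderiv ex f f' -> is_wderiv ex g g' -> is_wderiv ex w w' ->
  is_wderiv ex (fun z => e * (f z - g z) - w z) (fun z => e * (f' z - g' z) - w' z).
Proof.
move=> [/isL2P lf /isL2P lf' hf] [/isL2P lg /isL2P lg' hg] [/isL2P lw /isL2P lw' hw].
split; [exact/isL2P/L2B/lw/L2Z/L2B|exact/isL2P/L2B/lw'/L2Z/L2B|].
move=> phi tphi; have [l1 l2] := test_L2 tphi.
have lin (f1 f2 f3 q : R * R -> R) : L2 mu2 f1 -> L2 mu2 f2 -> L2 mu2 f3 -> L2 mu2 q ->
    ip mu2 (fun z => e * (f1 z - f2 z) - f3 z) q = e * (ip mu2 f1 q - ip mu2 f2 q) - ip mu2 f3 q.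
  move=> k1 k2 k3 k4; rewrite ipBl//; last exact/L2Z/L2B.
  by rewrite ipZl ?ipBl//; exact: L2B.
rewrite -/(ip mu2 _ _) -/(ip mu2 _ phi) !lin// /ip hf// hg// hw//; ring.
Qed.

(** The time interval is half-open, so later times are always at hand, also at [t = 0]. The witness
    stays below [T] by taking a midpoint when [T] is finite. *)
Lemma time_dom_right T t d : time_dom T t -> 0 < d ->
  exists2 t', time_dom T t' & t < t' < t + d.
Proof.
move=> [t0 tT] d0; case: T tT => [r||] // tT.
- move: tT; rewrite lte_fin => tr; exists (Num.min (t + d / 2) ((t + r) / 2)).
    split; first by rewrite le_min; apply/andP; split; lra.
    by rewrite lte_fin gt_min; apply/orP; right; lra.
  by rewrite lt_min gt_min; apply/andP; split; [apply/andP|apply/orP; left]; lra.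
- by exists (t + d / 2); [split; [lra|exact: ltry]|apply/andP; split; lra].
Qed.

Definition energy (u : R -> R * R -> R) t : R := n2 mu2 (u t) + n2 mu2 (wderiv ex (u t)).

Section solution.
Variables (sigma s : R) (T : \bar R) (u ut : R -> R * R -> R).
Hypotheses (s2 : 2 <= s) (uX : forall t, time_dom T t -> Xs s (u t))
  (utX : forall t, time_dom T t -> Xs (s - 2) (ut t)) (du : has_derivX (s - 2) T u ut)
  (eqn : forall t, time_dom T t -> rodKP sigma (u t) (ut t)).

Let ux t := wderiv ex (u t).
Let utx t := wderiv ex (ut t).
(** The errors of the time difference quotients of [u] and, in [remx], of [u_x]. *)
Let rem t t' z := (t' - t)^-1 * (u t' z - u t z) - ut t z.
Let remx t t' z := (t' - t)^-1 * (ux t' z - ux t z) - utx t z.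

Let Lu t : time_dom T t -> L2 mu2 (u t).
Proof. by move=> /uX[/Hs_L2[/ft_L2]]. Qed.
Let Lux t : time_dom T t -> L2 mu2 (ux t).
Proof. by move=> /uX[_ [_ /Hs_L2[/ft_L2]]]. Qed.
Let Lut t : time_dom T t -> L2 mu2 (ut t).
Proof. by move=> /utX[/Hs_L2[/ft_L2]]. Qed.
Let Lutx t : time_dom T t -> L2 mu2 (utx t).
Proof. by move=> /utX[_ [_ /Hs_L2[/ft_L2]]]. Qed.

Let rem_L2 t t' : time_dom T t -> time_dom T t' -> L2 mu2 (rem t t').
Proof. by move=> d d'; apply: L2B; [apply: L2Z; apply: L2B|]; auto. Qed.

Let remx_L2 t t' : time_dom T t -> time_dom T t' -> L2 mu2 (remx t t').
Proof. by move=> d d'; apply: L2B; [apply: L2Z; apply: L2B|]; auto. Qed.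

(** As [s - 2 >= 0], the norm of [X^(s-2)] controls the L^2 norms of a function and of its [x]
    derivative, which are exactly what the energy contains. *)
Let rem_le t t' : time_dom T t -> time_dom T t' ->
  ((n2 mu2 (rem t t'))%:E <= Xnorm (s - 2) (rem t t') ^+ 2)%E /\
  ((n2 mu2 (remx t t'))%:E <= Xnorm (s - 2) (rem t t') ^+ 2)%E.
Proof.
move=> d d'; have s0 : 0 <= s - 2 by rewrite subr_ge0.
have [hu [wu hux] _] := uX d; have [hu' [wu' hux'] _] := uX d'.
have [hut [wut hutx] _] := utX d.
have [fu _] := Hs_L2 hu; have [fu' _] := Hs_L2 hu'; have [fut _] := Hs_L2 hut.
have [fux _] := Hs_L2 hux; have [fux' _] := Hs_L2 hux'; have [futx _] := Hs_L2 hutx.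
have fr := ftB (ftZ (t' - t)^-1 (ftB fu' fu)) fut.
have frx := ftB (ftZ (t' - t)^-1 (ftB fux' fux)) futx.
have wr := wderiv_lin (t' - t)^-1 wu' wu wut.
have wr' : is_wderiv ex (rem t t') (wderiv ex (rem t t')).
  by apply: (@xgetPex _ (cst 0) [set v | is_wderiv ex (rem t t') v]); exists (remx t t').
have e := wderiv_unique wr wr'.
have [_ /isL2P lw _] := wr'.
have fw := ft_ae frx (L2_measurable lw) (L2_measurable (ft_L2r frx)) (L2_measurable (ft_L2i frx)) e
  (aeW _ (fun=> erefl)) (aeW _ (fun=> erefl)).
have H f : (0 <= Hnorm (s - 2) f ^+ 2)%E.
  by rewrite L2norm_sqr integral_ge0// => z _; rewrite lee_fin sqr_ge0.
rewrite Xnorm_sqr; split.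
  by rewrite (le_trans (n2_Hnorm s0 fr))// -addeA leeDl// adde_ge0.
rewrite (n2_ae (L2_measurable (remx_L2 d d')) (L2_measurable lw) e).
by rewrite (le_trans (n2_Hnorm s0 fw))// leeDr// adde_ge0.
Qed.

Lemma remainder_small t e : time_dom T t -> 0 < e -> exists2 d, 0 < d &
  forall t', time_dom T t' -> t' != t -> `|t' - t| < d ->
  n2 mu2 (rem t t') <= e ^+ 2 /\ n2 mu2 (remx t t') <= e ^+ 2.
Proof.
move=> dt e0.
have N0 : nbhs 0%E [set x : \bar R | (x < e%:E)%E].
  by apply: open_nbhs_nbhs; split; [exact: open_ereal_lt_ereal|rewrite /= lte_fin].
have := du dt N0; rewrite /= => /nbhs_ballP[d /= d0 hd].
exists d => // t' dt' tt' td.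
have hX : (Xnorm (s - 2) (rem t t') < e%:E)%E.
  by apply: hd => //; rewrite /ball/= distrC.
have X0 : (0 <= Xnorm (s - 2) (rem t t'))%E by exact: poweR_ge0.
have [h1 h2] := rem_le dt dt'.
have Xe : (Xnorm (s - 2) (rem t t') ^+ 2 <= (e ^+ 2)%:E)%E.
  move: X0 hX; case: (Xnorm _ _) => [x||] //; rewrite lee_fin lte_fin => x0 xe.
  by rewrite -EFin_expe lee_fin ler_pXn2r ?nnegrE// ltW.
by rewrite -!lee_fin; split; [exact: le_trans h1 Xe|exact: le_trans h2 Xe].
Qed.

Local Notation E := (energy u).

(** The statement [E' = 0] in quantitative form, one-sided at 0. Expanding
    [u(t') = u(t) + h (u_t + rem)], the first-order part is twice [energy_derivative]; the rest is
    the pairing with the remainders plus a term of order [h^2]. *)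
Lemma energy_flat t e : time_dom T t -> 0 < e -> exists2 d, 0 < d &
  forall t', time_dom T t' -> `|t' - t| < d -> `|E t' - E t| <= e * `|t' - t|.
Proof.
move=> dt e0.
have [A [B [At [Bt [v [vx [GA [GB [M sn]]]]]]]]] := snapshot_of s2 (uX dt) (utX dt) (eqn dt).
have en := energy_derivative sn.
have lu := Lu dt; have lux := Lux dt; have lut := Lut dt; have lutx := Lutx dt.
pose K := Num.sqrt (n2 mu2 (u t)) + Num.sqrt (n2 mu2 (ux t)).
have K0 : 0 <= K by rewrite addr_ge0 ?sqrtr_ge0.
(* By Cauchy-Schwarz the remainders contribute at most [2 K c <= e / 2]; the [+ 1] covers
   [K = 0]. *)
pose c := e / (4 * (K + 1)).
have K1 : 0 < 4 * (K + 1) by rewrite mulr_gt0// ltr_wpDl.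
have c0 : 0 < c by rewrite divr_gt0.
(* A bound for the coefficient of [h^2]; the second entry of the minimum below then gives
   [|h| S <= e / 2]. *)
pose S := 2 * n2 mu2 (ut t) + 2 * n2 mu2 (utx t) + 4 * c ^+ 2.
have S0 : 0 <= S by rewrite !addr_ge0// mulr_ge0 ?n2_ge0 ?sqr_ge0.
have [d d0 hd] := remainder_small dt c0.
exists (Num.min d (e / (2 * (S + 1)))).
  by rewrite lt_min d0 divr_gt0// mulr_gt0// ltr_wpDl.
move=> t' dt'; rewrite lt_min => /andP[td ts].
have [->|tt'] := eqVneq t' t; first by rewrite !subrr normr0 mulr0.
have [r1 r2] := hd _ dt' tt' td.
have lr := rem_L2 dt dt'; have lrx := remx_L2 dt dt'.
set h := t' - t in td ts *.
have h0 : h != 0 by rewrite subr_eq0.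
have expand (f f' g r : R * R -> R) : L2 mu2 f -> L2 mu2 g -> L2 mu2 r ->
    (forall z, r z = h^-1 * (f' z - f z) - g z) ->
    n2 mu2 f' - n2 mu2 f = h * (2 * ip mu2 f g + 2 * ip mu2 f r + h * n2 mu2 (fun z => g z + r z)).
  move=> lf lg lr' hr.
  have -> : f' = (fun z => f z + h * (g z + r z)).
    by apply/funext => z; rewrite hr; field.
  have lgr := L2D lg lr'.
  rewrite (n2D lf (L2Z h lgr)) (n2Z _ lgr) (ipZr _ lgr lf) (ipDr lg lr' lf); ring.
have e1 := expand _ _ _ _ lu lut lr (fun z => erefl).
have e2 := expand _ _ _ _ lux lutx lrx (fun z => erefl).
have -> : E t' - E t = h * (2 * (ip mu2 (u t) (rem t t') + ip mu2 (ux t) (remx t t')) +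
    h * (n2 mu2 (fun z => ut t z + rem t t' z) + n2 mu2 (fun z => utx t z + remx t t' z))).
  rewrite /energy opprD addrACA e1 e2.
  have -> : ip mu2 (u t) (ut t) = - ip mu2 (ux t) (utx t) by apply/eqP; rewrite -addr_eq0; apply/eqP.
  by ring.
rewrite normrM mulrC ler_wpM2r//.
have cs (f r : R * R -> R) : L2 mu2 f -> L2 mu2 r -> n2 mu2 r <= c ^+ 2 ->
    `|ip mu2 f r| <= Num.sqrt (n2 mu2 f) * c.
  move=> lf lr' rc; apply: le_trans (cauchy_abs lf lr') _; rewrite ler_wpM2l ?sqrtr_ge0//.
  by rewrite -[leRHS]ger0_norm ?(ltW c0)// -sqrtr_sqr ler_sqrt ?sqr_ge0.
have b1 := cs _ _ lu lr r1; have b2 := cs _ _ lux lrx r2.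
have b3 := n2D_le lut lr; have b4 := n2D_le lutx lrx.
have b5 : `|h| * S <= e / 2.
  have S1 : 0 < 2 * (S + 1) by rewrite mulr_gt0// ltr_wpDl.
  have : `|h| * (2 * (S + 1)) <= e by rewrite -ler_pdivlMr// ltW.
  rewrite mulrCA mulrDr mulr1 => h1; have h2 := normr_ge0 h.
  rewrite ler_pdivlMr// mulrC (le_trans _ h1)// ler_wpM2l// lerDl.
  exact: normr_ge0.
have b6 : 2 * (K * c) <= e / 2.
  have -> : e / 2 = 2 * ((K + 1) * c).
    by rewrite /c; field; rewrite gt_eqF// ltr_wpDl.
  by rewrite ler_wpM2l// ler_wpM2r ?(ltW c0)// lerDl.
rewrite (le_trans (ler_normD _ _))// !normrM (ger0_norm (ler0n R 2)).
have b7 : `|ip mu2 (u t) (rem t t') + ip mu2 (ux t) (remx t t')| <= K * c.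
  by rewrite /K mulrDl (le_trans (ler_normD _ _))// lerD.
have b8 : `|n2 mu2 (fun z => ut t z + rem t t' z) + n2 mu2 (fun z => utx t z + remx t t' z)| <= S.
  rewrite ger0_norm ?addr_ge0 ?n2_ge0// /S.
  apply: le_trans (lerD b3 b4) _; rewrite addrACA lerD2l.
  have -> : 4 * c ^+ 2 = 2 * c ^+ 2 + 2 * c ^+ 2 by ring.
  by apply: lerD; rewrite ler_wpM2l.
have -> : e = e / 2 + e / 2 by rewrite -splitr.
apply: lerD; first by apply: le_trans b6; rewrite ler_wpM2l.
by apply: le_trans b5; rewrite ler_wpM2l.
Qed.

(** [energy_flat] gives a zero derivative inside the interval and continuity up to its ends, which
    is all the mean value theorem asks. *)
Lemma energy_le t1 t2 : time_dom T t1 -> time_dom T t2 -> t1 < t2 -> E t1 = E t2.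
Proof.
move=> d1 d2 t12.
have dom x : x \in `[t1, t2] -> time_dom T x.
  rewrite in_itv/= => /andP[x1 x2]; split; first exact: le_trans d1.1 x1.
  by apply: le_lt_trans d2.2; rewrite lee_fin.
have dE (x : R) : x \in `]t1, t2[ -> is_derive x 1 E 0.
  move=> xin; have xdom : time_dom T x by apply: dom; exact: subset_itv_oo_cc xin.
  move: xin; rewrite in_itv/= => /andP[x1 x2].
  suff h : (fun h : R => h^-1 *: ((E \o shift x) (h *: 1) - E x)) @ 0^' --> (0 : R).
    by apply: DeriveDef; [apply/cvg_ex; exists 0|exact/cvg_lim].
  apply/cvgr0Pnorm_lt => e e0.
  (* Applied with [e / 2], as a strict inequality is required. *)
  have [d d0 hd] := energy_flat xdom (divr_gt0 e0 (ltr0Sn R 1)).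
  have m0 : 0 < Num.min d (Num.min (x - t1) (t2 - x)) by rewrite !lt_min d0 !subr_gt0 x1.
  near=> h.
  have h0 : h != 0 by near: h; exact: nbhs_dnbhs_neq.
  have : `|h| < Num.min d (Num.min (x - t1) (t2 - x)) by near: h; exact: dnbhs0_lt.
  rewrite !lt_min => /and3P[hd' ha hb].
  rewrite /= /GRing.scale/= mulr1 normrM normfV.
  have hx : time_dom T (h + x).
    apply: dom; rewrite in_itv/=; move: ha hb; rewrite !ltr_norml => /andP[? ?] /andP[? ?].
    by apply/andP; split; lra.
  have := hd _ hx; rewrite addrK => /(_ hd') h1.
  by rewrite mulrC ltr_pdivrMr ?normr_gt0// (le_lt_trans h1)// ltr_pM2r ?normr_gt0//; lra.
have cE : {within `[t1, t2], continuous E}.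
  apply/subspace_continuousP => x xin; have xdom := dom _ xin.
  apply/cvgrPdist_le => e e0.
  have [d d0 hd] := energy_flat xdom ltr01.
  apply/nbhs_ballP; exists (Num.min d e); first by rewrite /= lt_min d0.
  move=> y; rewrite /ball/= distrC lt_min => /andP[yd ye] /dom ydom.
  by rewrite distrC (le_trans (hd _ ydom yd))// mul1r ltW.
have [c _ h] := MVT t12 dE cE.
by apply/esym/subr0_eq; rewrite h mul0r.
Unshelve. all: by end_near. Qed.

Lemma energy_const t1 t2 : time_dom T t1 -> time_dom T t2 -> E t1 = E t2.
Proof.
move=> d1 d2; have [lt|gt|->//] := ltgtP t1 t2; first exact: energy_le.
by apply/esym; exact: energy_le.
Qed.

(** [u] vanishes on the strip at nearby times, so there the remainder is exactly [- u_t]; as it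
    tends to 0 in L^2, [u_t] vanishes on the strip too and the fixed-time argument applies. *)
Lemma energy_vanishes t0 x0 d : 0 <= sigma <= 3 -> time_dom T t0 -> 0 < d ->
  (forall t x y, time_dom T t -> `|t - t0| < d -> `|x - x0| < d -> u t (x, y) = 0) ->
  E t0 = 0.
Proof.
move=> sg dt d0 u0.
have [A [B [At [Bt [v [vx [GA [GB [M sn]]]]]]]]] := snapshot_of s2 (uX dt) (utX dt) (eqn dt).
(* The wide strip is the whole interval of radius [d]; its left half is the narrower one on which
   [u_x] is controlled. *)
have ab : x0 - d < x0 by rewrite ltrBlDr ltrDl.
have bb1 : x0 < x0 + d by rewrite ltrDl.
have close z : x0 - d < z.1 < x0 + d -> `|z.1 - x0| < d.
  by move=> /andP[h1 h2]; rewrite ltr_norml; apply/andP; split; lra.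
have w0 z : x0 - d < z.1 < x0 + d -> u t0 z = 0.
  by move=> /close h; case: z h => x y h; apply: u0 => //; rewrite subrr normr0.
suff wt0 : {ae mu2, forall z, x0 - d < z.1 < x0 + d -> ut t0 z = 0}.
  exact: (snapshot_eq0 sn sg ab bb1 w0 wt0).
pose strip z : R := \1_(`]x0 - d, x0 + d[%classic : set R) z.1.
have stripE z : strip z = (x0 - d < z.1 < x0 + d)%R%:R.
  by rewrite /strip indicE mem_setE in_itv.
have ms : measurable_fun setT (strip : plane R -> R).
  by apply: (measurableT_comp _ measurable_fst); exact: measurable_indic.
have s1 z : `|strip z| <= 1 by exact: indic_norm_le1.
have lsu := L2_bounded mu2 1 ms s1 (Lut dt).
have h : n2 mu2 (fun z => strip z * ut t0 z) = 0.
  apply/eqP; rewrite eq_le n2_ge0 andbT leNgt; apply/negP => n0.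
  (* With this tolerance the squared norm of [u_t] on the strip would be at most half of itself. *)
  have e0 : 0 < Num.sqrt (n2 mu2 (fun z => strip z * ut t0 z) / 2).
    by rewrite sqrtr_gt0 divr_gt0.
  have [c c0 hc] := remainder_small dt e0.
  have cd : 0 < Num.min c d by rewrite lt_min c0.
  have [t' dt' /andP[tt' t't]] := time_dom_right dt cd.
  have t'd : `|t' - t0| < Num.min c d by rewrite gtr0_norm ?subr_gt0// ltrBlDl.
  move: (t'd); rewrite lt_min => /andP[t'c t'd'].
  have [+ _] := hc _ dt' (negbT (gt_eqF tt')) t'c.
  rewrite sqr_sqrtr ?divr_ge0 ?n2_ge0//; apply/negP; rewrite -ltNge.
  have : n2 mu2 (fun z => strip z * ut t0 z) <= n2 mu2 (rem t0 t').
    rewrite -n2N; apply: le_n2; [exact: L2_measurable (L2N lsu)|exact: rem_L2|].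
    move=> z; rewrite stripE; have [zs|_] := boolP (x0 - d < z.1 < x0 + d).
      rewrite mul1r /rem w0// subr0.
      have -> : u t' z = 0 by case: z zs => x y /close; exact: u0.
      by rewrite mulr0 sub0r.
    by rewrite mul0r oppr0 normr0.
  by apply: lt_le_trans; rewrite ltr_pdivrMr// ltr_pMr// ltr1n.
apply: aeS (n2_eq0 lsu h) => z + zs.
by rewrite stripE zs mul1r.
Qed.

(** Zero energy gives vanishing almost everywhere; the continuous representative turns this into
    vanishing at every point. *)
Lemma energy_eq0 t : time_dom T t -> continuous (u t) -> E t = 0 -> forall z, u t z = 0.
Proof.
move=> dt cu E0; apply: (continuous_ae_eq0 cu); apply: (n2_eq0 (Lu dt)).
have := n2_ge0 mu2 (u t); have := n2_ge0 mu2 (ux t); move: E0; rewrite /energy -/(ux t); lra.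
Qed.

End solution.
End evolution.

Theorem theorem1p6 (R : realType) (sigma s : R)
    (hsigma : 0 <= sigma <= 3) (hs : 2 <= s)
    (T : \bar R) (hT : (0 < T)%E) (u : R -> R * R -> R)
    (hu : maximal_rodKP_solution sigma s T u)
    (Omega : set (R * R))
    (hOmega0 : Omega !=set0)
    (hOmega : exists2 O : set (R * R), open O &
       Omega = O `&` (time_dom T `*` [set: R]))
    (hu0 : forall t x, Omega (t, x) -> forall y, u t (x, y) = 0) :
  forall t, time_dom T t -> forall x y, u t (x, y) = 0.
Proof.
have [[cX cu [ut [ctX du eqn]]] _] := hu.
have uX t : time_dom T t -> Xs s (u t) by move=> /cX[].
have utX t : time_dom T t -> Xs (s - 2) (ut t) by move=> /ctX[].
have [[t0 x0] Om0] := hOmega0; have [V oV VE] := hOmega.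
move: Om0; rewrite VE => -[V0 [/= dt0 _]].
(* [Omega] is only relatively open, so the ball is taken in [V], and times are restricted to
   [time_dom T] when vanishing is used. *)
have /nbhs_ballP[d /= d0 dV] : nbhs (t0, x0) V by exact: open_nbhs_nbhs.
have E0 := energy_vanishes (x0 := x0) hs uX utX du eqn hsigma dt0 d0.
move=> t dt x y; apply: (energy_eq0 uX dt (cu _ dt)).
rewrite (energy_const hs uX utX du eqn dt dt0); apply: E0 => t1 x1 y1 dt1 h1 h2.
apply: hu0; rewrite VE; split => //; apply: dV.
by split; rewrite /ball/= distrC.
Qed.
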